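(* If $\{\xi_i\}_{i\in\mathbb N}$ is a sequence generated by Algorithm A (described in the context), then $\lim_{i\to\infty}\theta(\xi_i)=0$.
   Context: Setting. $\mathbb N=\{0,1,2,\dots\}$. Fix positive integers $n,m,q,N_c$, put $\mathcal Q=\{1,\dots,q\}$, $\mathcal J=\{1,\dots,N_c\}$, fix $x_0\in\mathbb R^n$ and a bounded convex set $U\subset\mathbb R^m$. Let $e_1,\dots,e_q$ be the standard basis of $\mathbb R^q$, $\Sigma_r^q=\{d\in[0,1]^q:\sum_{i=1}^q d_i=1\}$ and $\Sigma_p^q=\{e_1,\dots,e_q\}$. For a function $w$ on $[0,1]$ with Euclidean values, $\|w\|_{L^2}=(\int_0^1\|w(t)\|_2^2dt)^{1/2}$. Let $\mathcal U$, $\mathcal D_r$, $\mathcal D_p$ be the sets of functions in $L^2$ and of bounded variation on $[0,1]$ with values in $U$, $\Sigma_r^q$, $\Sigma_p^q$ respectively; $\mathcal X_r=\mathcal U\times\mathcal D_r$, $\mathcal X_p=\mathcal U\times\mathcal D_p\subset\mathcal X_r$, and $\|(u,d)\|_{\mathcal X}=\|u\|_{L^2}+\|d\|_{L^2}$. Dynamics. For each $i\in\mathcal Q$, $f(\cdot,\cdot,\cdot,e_i):\mathbb R\times\mathbb R^n\times\mathbb R^m\to\mathbb R^n$ is differentiable in $x$ and $u$, and there is $L>0$ such that for $F\in\{f(\cdot,e_i),\frac{\partial f}{\partial x}(\cdot,e_i),\frac{\partial f}{\partial u}(\cdot,e_i)\}$, $\|F(t_1,x_1,u_1)-F(t_2,x_2,u_2)\|\le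 L(|t_1-t_2|+\|x_1-x_2\|_2+\|u_1-u_2\|_2)$ for all $t_1,t_2\in[0,1]$, $x_1,x_2\in\mathbb R^n$, $u_1,u_2\in U$ (2-norm, resp. induced matrix 2-norm). For $d\in\mathbb R^q$ set $f(t,x,u,d)=\sum_{i=1}^q d_if(t,x,u,e_i)$. For $\xi=(u,d)\in\mathcal X_r$, $x^{(\xi)}$ is the unique solution of $\dot x(t)=f(t,x(t),u(t),d(t))$, $x(0)=x_0$ on $[0,1]$, and $\phi_t(\xi)=x^{(\xi)}(t)$. Cost and constraints. $h_0,h_j:\mathbb R^n\to\mathbb R$ ($j\in\mathcal J$) are differentiable, and they and their derivatives are Lipschitz with constant $L$. For $\xi\in\mathcal X_r$: $J(\xi)=h_0(\phi_1(\xi))$, $\psi_{j,t}(\xi)=h_j(\phi_t(\xi))$, $\Psi(\xi)=\max_{j\in\mathcal J,t\in[0,1]}\psi_{j,t}(\xi)$. Optimality function. $\mathrm DG(\xi;\eta)=\lim_{\lambda\downarrow0}\frac{G(\xi+\lambda\eta)-G(\xi)}\lambda$. Fix $\gamma>0$. For $\xi,\xi'\in\mathcal X_r$ let $\zeta(\xi,\xi')=\max\{\mathrm DJ(\xi;\xi'-\xi),\ \max_{j\in\mathcal J,t\in[0,1]}\mathrm D\psi_{j,t}(\xi;\xi'-\xi)+\gamma\Psi(\xi)\}+\|\xi'-\xi\|_{\mathcal X}$ if $\Psi(\xi)\le0$, and $\zeta(\xi,\xi')=\max\{\mathrm DJ(\xi;\xi'-\xi)-\Psi(\xi),\ \max_{j\in\mathcal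 J,t\in[0,1]}\mathrm D\psi_{j,t}(\xi;\xi'-\xi)\}+\|\xi'-\xi\|_{\mathcal X}$ if $\Psi(\xi)>0$. For $\xi\in\mathcal X_p$: $\theta(\xi)=\min_{\xi'\in\mathcal X_r}\zeta(\xi,\xi')$ and $g(\xi)=\arg\min_{\xi'\in\mathcal X_r}\zeta(\xi,\xi')$, the minimizer being taken to exist and be unique. Projection. Let $\lambda=1$ on $[0,\frac12)$, $-1$ on $[\frac12,1)$, $0$ elsewhere, $b_{kj}(t)=\lambda(2^kt-j)$. For scalar $c\in L^2\cap BV$, $\mathcal F_N(c)=\langle c,1\rangle+\sum_{k=0}^N\sum_{j=0}^{2^k-1}\langle c,b_{kj}\rangle b_{kj}/\|b_{kj}\|_{L^2}^2$ ($L^2([0,1])$ inner product), applied coordinate-wise to vector-valued functions. For $d\in\mathcal D_r$, $[\mathcal P_N(d)]_i(t)=1$ if $t\in[2^{-N}(k+\sum_{j=1}^{i-1}d_j(\frac k{2^N})),2^{-N}(k+\sum_{j=1}^{i}d_j(\frac k{2^N})))$ for some $k\in\{0,\dots,2^N-1\}$, and $0$ otherwise. $\rho_N(u,d)=(\mathcal F_N(u),\mathcal P_N(\mathcal F_N(d)))\in\mathcal X_p$. Functions given by such formulas are understood on $[0,1)$ and extended to $t=1$ by left limits. Step sizes. Fix $\alpha,\beta,\omega\in(0,1)$, $\bar\alpha\in(0,\infty)$, $\bar\beta\in(\frac1{\sqrt2},1)$. For $\xi\in\mathcal X_p$, $\mu(\xi)$ is the least $k\in\mathbb N$ such that, writing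 $\xi_k=\xi+\beta^k(g(\xi)-\xi)$: if $\Psi(\xi)\le0$, $J(\xi_k)-J(\xi)\le\alpha\beta^k\theta(\xi)$ and $\Psi(\xi_k)\le\alpha\beta^k\theta(\xi)$; if $\Psi(\xi)>0$, $\Psi(\xi_k)-\Psi(\xi)\le\alpha\beta^k\theta(\xi)$. With $\xi'=\xi+\beta^{\mu(\xi)}(g(\xi)-\xi)$, $\nu(\xi)$ is the least $k\in\mathbb N$ such that $\bar\alpha\bar\beta^k\le(1-\omega)\alpha\beta^{\mu(\xi)}$ and: if $\Psi(\xi)\le0$, $J(\rho_k(\xi'))-J(\xi)\le(\alpha\beta^{\mu(\xi)}-\bar\alpha\bar\beta^k)\theta(\xi)$ and $\Psi(\rho_k(\xi'))\le0$; if $\Psi(\xi)>0$, $\Psi(\rho_k(\xi'))-\Psi(\xi)\le(\alpha\beta^{\mu(\xi)}-\bar\alpha\bar\beta^k)\theta(\xi)$. Algorithm A. Start from any $\xi_0\in\mathcal X_p$. At step $j$: if $\theta(\xi_j)=0$, stop and return $\xi_j$; otherwise set $\xi_{j+1}=\rho_{\nu(\xi_j)}\bigl(\xi_j+\beta^{\mu(\xi_j)}(g(\xi_j)-\xi_j)\bigr)$. If the algorithm stops at $\xi_j$, the sequence is continued constantly equal to $\xi_j$. *)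

(* Defs.v *)
From HB Require Import structures.
From mathcomp Require Import all_boot all_order all_algebra.
From mathcomp Require Import all_classical all_reals all_analysis.
Set Implicit Arguments.
Unset Strict Implicit.
Unset Printing Implicit Defensive.
Import Order.TTheory GRing.Theory Num.Theory.
Import numFieldNormedType.Exports.
Local Open Scope classical_set_scope.
Local Open Scope ring_scope.

(* Vectors of R^k are row vectors 'rV[R]_k.  The norm `| _ | of 'rV[R]_k in the
   library is the sup norm, hence a separate Euclidean norm. *)
Definition enorm {R : realType} {k : nat} (v : 'rV[R]_k) : R :=
  Num.sqrt (\sum_(i < k) v ord0 i ^+ 2).

(* Induced 2-norm of a linear map A; the target norm is enorm for vector-valued
   maps and the absolute value for linear forms. *)
Definition opnorm2 {R : realType} {k : nat} {W : Type} (nrmW : W -> R)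
    (A : 'rV[R]_k -> W) : R :=
  sup [set nrmW (A v) | v in [set v | enorm v <= 1]].

(* Functions on [0, 1] are represented by total functions on R of which only the
   values on [0, 1] are used. *)

Definition ip {R : realType} (c c' : R -> R) : R :=
  \int[lebesgue_measure]_(t in `[0, 1]) (c t * c' t).

Definition L2norm {R : realType} {k : nat} (w : R -> 'rV[R]_k) : R :=
  Num.sqrt (\int[lebesgue_measure]_(t in `[0, 1]) (enorm (w t) ^+ 2)).

(* For a vector-valued function, measurability and bounded variation are those
   of the coordinates. *)
Definition L2BV {R : realType} {k : nat} (S : set 'rV[R]_k) :
    set (R -> 'rV[R]_k) :=
  [set w : R -> 'rV[R]_k | [/\ forall t, 0 <= t <= 1 -> S (w t),
    forall i, measurable_fun `[0 : R, 1] (fun t => w t ord0 i),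
    lebesgue_measure.-integrable `[0, 1] (fun t => (enorm (w t) ^+ 2)%:E) &
    forall i, bounded_variation 0 1 (fun t => w t ord0 i)]].

Definition simplexr (R : realType) (q : nat) : set 'rV[R]_q :=
  [set d | (forall i, 0 <= d ord0 i <= 1) /\ \sum_(i < q) d ord0 i = 1].

Definition simplexp (R : realType) (q : nat) : set 'rV[R]_q :=
  [set d | exists i : 'I_q, d = delta_mx ord0 i].

Notation control R m q := ((R -> 'rV[R]_m) * (R -> 'rV[R]_q))%type.

Definition normX {R : realType} {m q : nat} (xi : control R m q) : R :=
  L2norm xi.1 + L2norm xi.2.

(* vfield i t x u is f(t, x, u, e_i). *)
Record problem (R : realType) (n m q Nc : nat) := Problem {
  vfield : 'I_q -> R -> 'rV[R]_n -> 'rV[R]_m -> 'rV[R]_n ;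
  xinit : 'rV[R]_n ;
  inputs : set 'rV[R]_m ;
  cost : 'rV[R]_n -> R ;
  constr : 'I_Nc -> 'rV[R]_n -> R }.

Record alg_params (R : realType) := AlgParams {
  gamma : R ;
  alpha : R ;
  beta : R ;
  omega : R ;
  alphabar : R ;
  betabar : R }.

Definition alg_params_ok {R : realType} (S : alg_params R) : Prop :=
  [/\ 0 < gamma S,
    [/\ 0 < alpha S < 1, 0 < beta S < 1 & 0 < omega S < 1],
    0 < alphabar S &
    (Num.sqrt 2)^-1 < betabar S < 1].

Definition dynamics_ok {R : realType} {n m q Nc : nat}
    (P : problem R n m q Nc) (L : R) : Prop :=
  forall i : 'I_q, let f := vfield P i in
  [/\ forall t x u, differentiable (fun y => f t y u) x,
      forall t x u, differentiable (fun v => f t x v) u &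
      forall (t1 t2 : R) (x1 x2 : 'rV[R]_n) (u1 u2 : 'rV[R]_m),
        0 <= t1 <= 1 -> 0 <= t2 <= 1 -> inputs P u1 -> inputs P u2 ->
        let bnd := L * (`|t1 - t2| + enorm (x1 - x2) + enorm (u1 - u2)) in
        [/\ enorm (f t1 x1 u1 - f t2 x2 u2) <= bnd,
          opnorm2 enorm (fun z => 'd (fun y => f t1 y u1) x1 z
                                - 'd (fun y => f t2 y u2) x2 z) <= bnd &
          opnorm2 enorm (fun z => 'd (fun v => f t1 x1 v) u1 z
                                - 'd (fun v => f t2 x2 v) u2 z) <= bnd]].

Definition diff_lipschitz {R : realType} {n : nat} (L : R)
    (h : 'rV[R]_n -> R) : Prop :=
  (forall x, differentiable h x) /\
  forall x1 x2 : 'rV[R]_n,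
    `|h x1 - h x2| <= L * enorm (x1 - x2) /\
    opnorm2 Num.norm (fun z => 'd h x1 z - 'd h x2 z) <= L * enorm (x1 - x2).

Definition problem_ok {R : realType} {n m q Nc : nat}
    (P : problem R n m q Nc) (L : R) : Prop :=
  [/\ bounded_set (inputs P) /\ convex_set (inputs P),
    dynamics_ok P L,
    diff_lipschitz L (cost P) &
    forall j, diff_lipschitz L (constr P j)].

Section OptimalControl.
Context {R : realType} {n m q Nc : nat}.
Variables (P : problem R n m q Nc) (S : alg_params R).
Implicit Types xi eta : control R m q.

Definition Xr : set (control R m q) :=
  [set xi | L2BV (inputs P) xi.1 /\ L2BV (@simplexr R q) xi.2].

Definition Xp : set (control R m q) :=
  [set xi | L2BV (inputs P) xi.1 /\ L2BV (@simplexp R q) xi.2].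

Definition rhs (t : R) (x : 'rV[R]_n) (u : 'rV[R]_m) (d : 'rV[R]_q) :
    'rV[R]_n :=
  \sum_(i < q) d ord0 i *: vfield P i t x u.

(* Since u and d may jump, the differential equation is taken in the sense of
   Caratheodory: x is continuous and solves the integrated equation. *)
Definition is_solution xi (x : R -> 'rV[R]_n) : Prop :=
  {within `[0, 1], continuous x} /\
  forall t, 0 <= t <= 1 -> forall i : 'I_n,
    x t ord0 i = xinit P ord0 i +
      \int[lebesgue_measure]_(s in `[0, t]) rhs s (x s) (xi.1 s) (xi.2 s) ord0 i.

(* The solution, picked by choice; it is unique on [0, 1] for xi in Xr. *)
Definition trajectory xi : R -> 'rV[R]_n :=
  xget (fun=> 0) [set x | is_solution xi x].

Definition phi (t : R) xi : 'rV[R]_n := trajectory xi t.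

Definition J xi : R := cost P (phi 1 xi).

Definition psi (j : 'I_Nc) (t : R) xi : R := constr P j (phi t xi).

Definition Psi xi : R :=
  sup [set psi j t xi | j in [set: 'I_Nc] & t in `[0, 1]].

Definition DD (G : control R m q -> R) xi eta : R :=
  lim ((G (xi + l *: eta) - G xi) / l @[l --> 0^'+]).

Definition maxDpsi xi eta : R :=
  sup [set DD (psi j t) xi eta | j in [set: 'I_Nc] & t in `[0, 1]].

Definition zeta xi xi' : R :=
  if Psi xi <= 0 then
    Num.max (DD J xi (xi' - xi)) (maxDpsi xi (xi' - xi) + gamma S * Psi xi)
    + normX (xi' - xi)
  else
    Num.max (DD J xi (xi' - xi) - Psi xi) (maxDpsi xi (xi' - xi))
    + normX (xi' - xi).

Definition theta xi : R := inf [set zeta xi xi' | xi' in Xr].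

Definition is_argmin xi xi' : Prop :=
  Xr xi' /\ forall eta, Xr eta -> zeta xi xi' <= zeta xi eta.

(* Uniqueness is that of elements of (X, normX): zeta xi does not distinguish
   controls that are equal almost everywhere on [0, 1]. *)
Definition is_argmin_map (g : control R m q -> control R m q) : Prop :=
  forall xi, Xp xi ->
    is_argmin xi (g xi) /\
    forall xi', is_argmin xi xi' -> normX (xi' - g xi) = 0.

Definition haar (t : R) : R :=
  if 0 <= t < 2^-1 then 1 else if 2^-1 <= t < 1 then -1 else 0.

Definition haarb (k j : nat) (t : R) : R := haar (2 ^+ k * t - j%:R).

Definition left_ext (c : R -> R) (t : R) : R :=
  if t == 1 then lim (c s @[s --> 1^'-]) else c t.

Definition haar_sum (N : nat) (c : R -> R) (t : R) : R :=
  ip c (fun=> 1) +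
  \sum_(0 <= k < N.+1) \sum_(0 <= j < 2 ^ k)
    ip c (haarb k j) * haarb k j t / ip (haarb k j) (haarb k j).

Definition FN {k : nat} (N : nat) (w : R -> 'rV[R]_k) (t : R) : 'rV[R]_k :=
  \row_(i < k) left_ext (haar_sum N (fun s => w s ord0 i)) t.

Definition pulse (N : nat) (d : R -> 'rV[R]_q) (i : 'I_q) (t : R) : R :=
  [exists k : 'I_(2 ^ N),
    2 ^- N * (k%:R + \sum_(j < q | (j < i)%N) d (k%:R / 2 ^+ N) ord0 j)
      <= t <
    2 ^- N * (k%:R + \sum_(j < q | (j <= i)%N) d (k%:R / 2 ^+ N) ord0 j)]%:R.

Definition PN (N : nat) (d : R -> 'rV[R]_q) (t : R) : 'rV[R]_q :=
  \row_(i < q) left_ext (pulse N d i) t.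

Definition rho (N : nat) xi : control R m q := (FN N xi.1, PN N (FN N xi.2)).

(* The least element of a set of natural numbers (0 if the set is empty). *)
Definition least (A : set nat) : nat :=
  xget 0%N [set k | A k /\ forall l, A l -> (k <= l)%N].

Variable g : control R m q -> control R m q.

Definition xi_step xi (k : nat) : control R m q :=
  xi + beta S ^+ k *: (g xi - xi).

Definition mu_test xi (k : nat) : Prop :=
  let c := alpha S * beta S ^+ k in
  if Psi xi <= 0 then
    J (xi_step xi k) - J xi <= c * theta xi /\ Psi (xi_step xi k) <= c * theta xi
  else Psi (xi_step xi k) - Psi xi <= c * theta xi.

Definition mu xi : nat := least [set k | mu_test xi k].

Definition nu_test xi (k : nat) : Prop :=
  let xi' := xi_step xi (mu xi) in
  let a := alpha S * beta S ^+ mu xi in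
  let b := alphabar S * betabar S ^+ k in
  b <= (1 - omega S) * a /\
  if Psi xi <= 0 then
    J (rho k xi') - J xi <= (a - b) * theta xi /\ Psi (rho k xi') <= 0
  else Psi (rho k xi') - Psi xi <= (a - b) * theta xi.

Definition nu xi : nat := least [set k | nu_test xi k].

Definition algorithmA_step xi : control R m q :=
  if theta xi == 0 then xi else rho (nu xi) (xi_step xi (mu xi)).

Definition generated_by_A (xi : nat -> control R m q) : Prop :=
  Xp (xi 0%N) /\ forall j, xi j.+1 = algorithmA_step (xi j).

End OptimalControl.

(* Main.v *)
Require Import Defs.
From HB Require Import structures.
From mathcomp Require Import all_boot all_order all_algebra.
From mathcomp Require Import all_classical all_reals all_analysis.
From mathcomp Require Import measurable_realfun ring lra.
Set Implicit Arguments.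
Unset Strict Implicit.
Unset Printing Implicit Defensive.
Import Order.TTheory GRing.Theory Num.Theory.
Import numFieldNormedType.Exports.
Local Open Scope classical_set_scope.
Local Open Scope ring_scope.

(** The algorithm is a descent method, and the theorem follows once each step taken
    at a control xi with theta xi <= - e decreases a merit function by an amount
    depending on e only.  The merit is the cost J once an iterate is feasible
    ([Psi xi <= 0], a property that later iterates keep) and Psi before.  Both are
    bounded below, so theta cannot stay below - e infinitely often
    ([descent_cvg0], [theta_cvg0]).  The uniform decrease has two sources.

    Armijo's step.  Trajectories are solutions of a Caratheodory equation, which
    exist by Picard's theorem ([picard]) and are bounded uniformly over the
    admissible controls.  Along a segment of controls of length l, their
    deviation from the chord is of order l^2, with a uniform constant
    ([trajectory_second]): this needs only that the fields have Lipschitz partial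
    differentials ([field_second]) and Gronwall's inequality.  Hence J and the
    psi_{j,t} have directional derivatives and first-order expansions with a
    uniform remainder C l^2 ([directional_derivative]).  The value theta xi bounds
    the derivatives in the direction g xi - xi, so the test defining mu holds for
    a step beta^M where M depends on e alone ([mu_test_uniform]).

    The projection.  A Haar partial sum is the average over a dyadic cell
    ([haar_partial_avg]), and the pulses of a cell last for the sampled average of
    each mode.  Thus the projected control stays within O(2^-N) of the original
    when integrated in time against functions of bounded variation
    ([FN_integral_dist], [PN_integral_dist]).  As the stability of trajectories is
    governed by such integrals ([trajectory_stable]), J and Psi move by O(2^-N)
    ([rho_trajectory]).  The slack alphabar betabar^k |theta| decays more slowly,
    because betabar > 1/2, hence the test defining nu holds for some k
    ([nu_test_exists]).  The condition on nu then leaves a fraction omega of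
    Armijo's decrease ([step_decrease]).

    Finally, the iterates must stay in the set of admissible switched controls,
    although the set of inputs is convex but maybe not closed.  The mean of a
    function with values in a convex subset of a finite-dimensional space belongs
    to that subset ([convex_mean]); this is proved by induction on the number of
    nonzero coordinates, pairing values on both sides of a coordinate hyperplane. *)

(** * Integrals of bounded measurable functions on subintervals of [0, 1] *)

Section BoundedMeasurable.
Context {R : realType}.
Implicit Types (f g : R -> R) (a b c : R).
Local Notation mu := (@lebesgue_measure R).

Definition bmeas f := measurable_fun `[0 : R, 1] f /\
  exists M, forall t, 0 <= t <= 1 -> `|f t| <= M.

Lemma bmeas_cst (k : R) : bmeas (fun=> k).
Proof. by split; [exact: measurable_cst | exists `|k|]. Qed.

Lemma bmeasD f g : bmeas f -> bmeas g -> bmeas (fun t => f t + g t).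
Proof.
move=> [mf [M fM]] [mg [N gN]]; split; first exact: measurable_funD.
exists (M + N) => t t01; apply: (le_trans (ler_normD _ _)).
by rewrite lerD ?fM ?gN.
Qed.

Lemma bmeasM f g : bmeas f -> bmeas g -> bmeas (fun t => f t * g t).
Proof.
move=> [mf [M fM]] [mg [N gN]]; split; first exact: measurable_funM.
by exists (M * N) => t t01; rewrite normrM ler_pM ?fM ?gN.
Qed.

Lemma bmeasZ k f : bmeas f -> bmeas (fun t => k * f t).
Proof. exact: (bmeasM (bmeas_cst k)). Qed.

Lemma bmeasN f : bmeas f -> bmeas (fun t => - f t).
Proof.
move=> [mf [M fM]]; split; first exact: measurableT_comp.
by exists M => t t01; rewrite normrN fM.
Qed.

Lemma bmeasB f g : bmeas f -> bmeas g -> bmeas (fun t => f t - g t).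
Proof. by move=> bf bg; apply: bmeasD => //; exact: bmeasN. Qed.

Lemma bmeas_norm f : bmeas f -> bmeas (fun t => `|f t|).
Proof.
move=> [mf [M fM]]; split; first exact: measurableT_comp.
by exists M => t t01; rewrite normr_id fM.
Qed.

Lemma bmeas_sum (I : Type) (r : seq I) (P : pred I) (F : I -> R -> R) :
  (forall i, bmeas (F i)) -> bmeas (fun t => \sum_(i <- r | P i) F i t).
Proof.
move=> bF; elim: r => [|i r IH].
  by under eq_fun do rewrite big_nil; exact: bmeas_cst.
under eq_fun do rewrite big_cons.
by case: (P i) => //; apply: bmeasD.
Qed.

Lemma bmeas_integrable f a b : 0 <= a -> b <= 1 -> bmeas f ->
  mu.-integrable `[a, b] (EFin \o f).
Proof.
move=> a0 b1 [mf [M fM]].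
have sub : `[a, b] `<=` `[0 : R, 1].
  by move=> t /=; rewrite !in_itv/= => /andP[? ?]; apply/andP; split; lra.
apply: measurable_bounded_integrable => //.
- rewrite /= lebesgue_measure_itv/=; case: ifP => // _.
  by rewrite -EFinB ltry.
- by apply: measurable_funS mf.
- exists M; split; first exact: num_real.
  move=> x Mx t /sub /=; rewrite in_itv/= => /fM.
  by move/le_trans; apply; exact: ltW.
Qed.

Definition intR a b f : R := \int[mu]_(s in `[a, b]) f s.

Section OnInterval.
Variables (a b : R).
Hypotheses (a0 : 0 <= a) (b1 : b <= 1).
Let bi f : bmeas f -> mu.-integrable `[a, b] (EFin \o f).
Proof. exact: bmeas_integrable. Qed.

Lemma intRD f g : bmeas f -> bmeas g ->
  intR a b (fun t => f t + g t) = intR a b f + intR a b g.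
Proof. by move=> bf bg; rewrite /intR RintegralD//; exact: bi. Qed.

Lemma intRB f g : bmeas f -> bmeas g ->
  intR a b (fun t => f t - g t) = intR a b f - intR a b g.
Proof. by move=> bf bg; rewrite /intR RintegralB//; exact: bi. Qed.

Lemma intRZ k f : bmeas f -> intR a b (fun t => k * f t) = k * intR a b f.
Proof. by move=> bf; rewrite /intR RintegralZl//; exact: bi. Qed.

Lemma intR_sum (I : Type) (r : seq I) (F : I -> R -> R) :
  (forall i, bmeas (F i)) ->
  intR a b (fun t => \sum_(i <- r) F i t) = \sum_(i <- r) intR a b (F i).
Proof.
move=> bF; elim: r => [|i r IH].
  under eq_fun do rewrite big_nil.
  by rewrite /intR big_nil Rintegral_cst// mul0r.
under eq_fun do rewrite big_cons.
rewrite intRD ?IH ?big_cons//; exact: bmeas_sum.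
Qed.

Lemma eq_intR f g : (forall t, a <= t <= b -> f t = g t) ->
  intR a b f = intR a b g.
Proof.
by move=> fg; apply: eq_Rintegral => t; rewrite inE/= in_itv/=; exact: fg.
Qed.

Lemma le_intR f g : bmeas f -> bmeas g ->
  (forall t, a <= t <= b -> f t <= g t) -> intR a b f <= intR a b g.
Proof.
by move=> bf bg fg; apply: le_Rintegral => //; exact: bi.
Qed.

Lemma intR_cst k : a <= b -> intR a b (fun=> k) = k * (b - a).
Proof.
move=> ab; rewrite /intR Rintegral_cst//= lebesgue_measure_itv/= lte_fin.
case: ltP => // ba; have -> : a = b by apply/eqP; rewrite eq_le ab ba.
by rewrite subrr.
Qed.

Lemma intR_abs f : bmeas f -> `|intR a b f| <= intR a b (fun t => `|f t|).
Proof. by move=> bf; apply: le_normr_Rintegral => //; exact: bi. Qed.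

Lemma intR_ge0 f : (forall t, a <= t <= b -> 0 <= f t) -> 0 <= intR a b f.
Proof.
by move=> f0; apply: Rintegral_ge0 => t /=; rewrite in_itv/=; exact: f0.
Qed.

Lemma intR_bound f M : a <= b -> bmeas f ->
  (forall t, a <= t <= b -> `|f t| <= M) -> `|intR a b f| <= M * (b - a).
Proof.
move=> ab bf fM; apply: (le_trans (intR_abs bf)); rewrite -intR_cst//.
apply: le_intR => //; first exact: bmeas_norm.
exact: bmeas_cst.
Qed.

End OnInterval.

Lemma intR_cat f a b c : 0 <= a -> a <= b -> b <= c -> c <= 1 -> bmeas f ->
  intR a c f = intR a b f + intR b c f.
Proof.
move=> a0 ab bc c1 bf; have bi := bmeas_integrable a0 c1 bf.
have bi' : mu.-integrable `]b, c] (EFin \o f).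
  by apply: integrableS bi => //; apply: subset_itv; rewrite bnd_simp.
rewrite /intR -(Rintegral_itv_obnd_cbnd bi').
by rewrite -(Rintegral_itvB bi) ?bnd_simp// addrC subrK.
Qed.

Lemma intRxx f a : intR a a f = 0.
Proof. by rewrite /intR set_itv1 Rintegral_set1. Qed.

Lemma intR_oo f a b : 0 <= a -> b <= 1 -> bmeas f ->
  intR a b f = \int[mu]_(s in `]a, b[) f s.
Proof.
move=> a0 b1 bf; have bi := bmeas_integrable a0 b1 bf.
rewrite /intR -(Rintegral_itv_obnd_cbnd (r := a)).
  rewrite -(Rintegral_itv_bndo_bndc (r := b))//.
  by apply: integrableS bi => //; exact: subset_itv_oo_cc.
by apply: integrableS bi => //; exact: subset_itv_oc_cc.
Qed.

(** Formulas for step functions hold in open cells; the endpoints are null. *)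
Lemma eq_intR_oo f g a b : 0 <= a -> b <= 1 -> bmeas f -> bmeas g ->
  (forall t, a < t < b -> f t = g t) -> intR a b f = intR a b g.
Proof.
move=> a0 b1 bf bg fg; rewrite !intR_oo//; apply: eq_Rintegral => t.
by rewrite inE/= in_itv/=; exact: fg.
Qed.

Lemma intR_bound_oo f a b M : 0 <= a -> a <= b -> b <= 1 -> bmeas f ->
  (forall t, a < t < b -> `|f t| <= M) -> `|intR a b f| <= M * (b - a).
Proof.
move=> a0 ab b1 bf fM; rewrite -(intR_cst M ab).
apply: (le_trans (intR_abs a0 b1 bf)).
have sub : `]a, b[ `<=` `[a, b] by exact: subset_itv_oo_cc.
rewrite !intR_oo//; [|exact: bmeas_cst|exact: bmeas_norm].
apply: le_Rintegral => //.
- by apply: integrableS (bmeas_integrable a0 b1 (bmeas_norm bf)).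
- by apply: integrableS (bmeas_integrable a0 b1 (bmeas_cst M)).
Qed.

(** The error of each cell is
    charged to the growth of V over that cell, so the total error is h times
    the total growth, plus h M for the cell containing t. *)
Lemma intR_cells f (V : R -> R) (N : nat) (M : R) :
  (0 < N)%N -> bmeas f ->
  (forall s t, 0 <= s -> s <= t -> t <= 1 -> V s <= V t) ->
  (forall t, 0 <= t <= 1 -> `|f t| <= M) ->
  (forall k, (k < N)%N -> `|intR (k%:R / N%:R) (k.+1%:R / N%:R) f| <=
     N%:R^-1 * (V (k.+1%:R / N%:R) - V (k%:R / N%:R))) ->
  forall t, 0 <= t <= 1 -> `|intR 0 t f| <= N%:R^-1 * (V 1 - V 0 + M).
Proof.
move=> N0 bf Vh fM cell t /andP[t0 t1].
have NR : 0 < N%:R :> R by rewrite ltr0n.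
have kN k : (k <= N)%N -> (k%:R / N%:R : R) <= 1.
  by move=> kN; rewrite ler_pdivrMr// mul1r ler_nat.
have k0 k : 0 <= (k%:R / N%:R : R) by rewrite divr_ge0.
have kS k : (k%:R / N%:R : R) <= k.+1%:R / N%:R.
  by rewrite ler_pM2r ?invr_gt0// ler_nat.
have M0 : 0 <= M by apply: le_trans (fM 0 _) => //; rewrite lexx ler01.
have upto k : (k <= N)%N ->
    `|intR 0 (k%:R / N%:R) f| <= N%:R^-1 * (V (k%:R / N%:R) - V 0).
  elim: k => [_|k IH ltkN]; first by rewrite mul0r intRxx subrr mulr0 normr0.
  rewrite (intR_cat (lexx 0) (k0 k) (kS k) (kN _ ltkN) bf).
  apply: (le_trans (ler_normD _ _)).
  have := lerD (IH (ltnW ltkN)) (cell k ltkN).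
  by rewrite -mulrDr addrC [X in _ <= _ * X]addrC addrA subrK addrC.
have [->|tn1] := eqVneq t 1.
  have := upto N (leqnn _); rewrite divff ?gt_eqF// => /le_trans; apply.
  by rewrite ler_pM2l ?invr_gt0// lerDl.
pose k := Num.truncn (t * N%:R).
have tN0 : 0 <= t * N%:R by rewrite mulr_ge0// ltW.
have /andP[kt tk] : k%:R <= t * N%:R < k.+1%:R := truncn_itv tN0.
have ltkN : (k < N)%N.
  rewrite -(ltr_nat R); apply: (le_lt_trans kt).
  by rewrite gtr_pMl// lt_neqAle tn1.
have kt' : k%:R / N%:R <= t by rewrite ler_pdivrMr.
rewrite (intR_cat (lexx 0) (k0 k) kt' t1 bf).
apply: (le_trans (ler_normD _ _)); rewrite mulrDr; apply: lerD.
  apply: (le_trans (upto k (ltnW ltkN))).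
  by rewrite ler_pM2l ?invr_gt0// lerB// Vh// kN// ltnW.
apply: (@le_trans _ _ (M * (t - k%:R / N%:R))).
  apply: intR_bound => // s /andP[ks st]; apply: fM.
  by rewrite (le_trans (k0 k) ks) (le_trans st t1).
have step : N%:R^-1 + k%:R / N%:R = k.+1%:R / N%:R :> R.
  by rewrite -natr1 mulrDl mul1r addrC.
by rewrite mulrC ler_wpM2r// lerBlDr step ler_pdivlMr// ltW.
Qed.

End BoundedMeasurable.

(** * Bounded variation through nondecreasing majorants *)

Section Majorant.
Context {R : realType}.
Implicit Types (f g V W : R -> R).

(** V controls the increments of f, hence is itself nondecreasing.  A function
    on [0, 1] has bounded variation exactly when some V controls it, and unlike
    suprema over partitions, the control passes through sums, products and
    Lipschitz maps pointwise. *)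
Definition majorant f V := forall s t, 0 <= s -> s <= t -> t <= 1 ->
  `|f t - f s| <= V t - V s.

Lemma majorant_mono f V : majorant f V ->
  forall s t, 0 <= s -> s <= t -> t <= 1 -> V s <= V t.
Proof.
move=> fV s t s0 st t1; rewrite -subr_ge0.
exact: le_trans (normr_ge0 _) (fV _ _ s0 st t1).
Qed.

Lemma bounded_variation_majorant f :
  bounded_variation 0 1 f -> exists V, majorant f V.
Proof.
move=> bf; exists (fun t => fine (total_variation 0 t f)) => s t s0 st t1.
have fin a b : 0 <= a -> a <= b -> b <= 1 ->
    total_variation a b f \is a fin_num.
  move=> a0 ab b1; apply/bounded_variationP => //.
  apply: (@bounded_variationr _ 0) => //.
  by apply: (@bounded_variationl _ _ _ 1) => //; lra.
have t0 := le_trans s0 st; have s1 := le_trans st t1.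
have := @total_variation_ge R s t f st; rewrite -lee_fin => /le_trans; apply.
rewrite (total_variationD f s0 st) fineD ?fin//.
by rewrite addrC addKr fineK// fin.
Qed.

Lemma majorant_bounded_variation f V : majorant f V -> bounded_variation 0 1 f.
Proof.
move=> fV; have -> : f = V \+ \- (V \- f).
  by apply/funext => t /=; rewrite opprB addrC subrK.
apply: bounded_variationD; first exact: ltr01.
  apply: nondecreasing_bounded_variation => s t.
  rewrite !in_itv/= => /andP[s0 s1] /andP[t0 t1] st.
  exact: (majorant_mono fV).
apply: bounded_variationN; apply: nondecreasing_bounded_variation => s t.
rewrite !in_itv/= => /andP[s0 s1] /andP[t0 t1] st.
by have := fV s t s0 st t1; rewrite ler_norml => /andP[_] /=; lra.
Qed.

Lemma nondecreasing01_measurable V :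
  (forall s t, 0 <= s -> s <= t -> t <= 1 -> V s <= V t) ->
  measurable_fun `[0 : R, 1] V.
Proof.
move=> hV; pose c (t : R) := Num.max 0 (Num.min 1 t).
have c01 t : 0 <= c t <= 1.
  by rewrite /c le_max lexx/= ge_max ler01 ge_min lexx.
have mV : measurable_fun `[0 : R, 1] (V \o c).
  apply: nondecreasing_measurable => // s t st /=.
  have /andP[s0 s1] := c01 s; have /andP[t0 t1] := c01 t.
  apply: hV => //; rewrite /c ge_max le_max lexx/= le_max; apply/orP; right.
  by rewrite le_min ge_min lexx/= ge_min st orbT.
apply: eq_measurable_fun mV => t; rewrite inE/= in_itv/= => /andP[t0 t1] /=.
by rewrite /c (min_idPr t1) (max_idPr t0).
Qed.

Lemma majorant_bmeas f V : majorant f V -> bmeas f.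
Proof.
move=> fV; split.
  have -> : f = V \- (V \- f).
    by apply/funext => t /=; rewrite opprB addrC subrK.
  apply: measurable_funB; apply: nondecreasing01_measurable.
    exact: (majorant_mono fV).
  move=> s t s0 st t1; have := fV s t s0 st t1.
  by rewrite ler_norml => /andP[_] /=; lra.
exists (`|f 0| + (V 1 - V 0)) => t /andP[t0 t1].
have -> : f t = f 0 + (f t - f 0) by rewrite addrC subrK.
apply: (le_trans (ler_normD _ _)); rewrite lerD2l.
apply: le_trans (fV 0 t _ t0 t1) _; first exact: lexx.
by rewrite lerD2r; apply: (majorant_mono fV) => //; exact: lexx.
Qed.

Definition bv f := exists V, majorant f V.

Lemma bv_bmeas f : bv f -> bmeas f.
Proof. by case=> V; exact: majorant_bmeas. Qed.

Lemma majorantD f g V W : majorant f V -> majorant g W ->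
  majorant (fun t => f t + g t) (fun t => V t + W t).
Proof.
move=> fV gW s t s0 st t1; rewrite opprD addrACA.
apply: (le_trans (ler_normD _ _)); rewrite opprD [leRHS]addrACA.
by apply: lerD; [exact: fV|exact: gW].
Qed.

Lemma majorantZ k f V : majorant f V ->
  majorant (fun t => k * f t) (fun t => `|k| * V t).
Proof.
move=> fV s t s0 st t1; rewrite -!mulrBr normrM.
by apply: ler_wpM2l => //; exact: fV.
Qed.

Lemma bv_cst k : bv (fun=> k).
Proof. by exists (fun=> 0) => s t _ _ _; rewrite !subrr normr0. Qed.

Lemma bvD f g : bv f -> bv g -> bv (fun t => f t + g t).
Proof.
by move=> [V fV] [W gW]; exists (fun t => V t + W t); exact: majorantD.
Qed.

Lemma bvZ k f : bv f -> bv (fun t => k * f t).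
Proof. by move=> [V fV]; exists (fun t => `|k| * V t); exact: majorantZ. Qed.

Lemma bvB f g : bv f -> bv g -> bv (fun t => f t - g t).
Proof.
move=> bf /(bvZ (-1)) bg; have := bvD bf bg.
by congr bv; apply/funext => t; rewrite mulN1r.
Qed.

Lemma bv_sum (I : Type) (r : seq I) (P : pred I) (F : I -> R -> R) :
  (forall i, bv (F i)) -> bv (fun t => \sum_(i <- r | P i) F i t).
Proof.
move=> bF; elim: r => [|i r IH].
  by under eq_fun do rewrite big_nil; exact: bv_cst.
under eq_fun do rewrite big_cons.
by case: (P i) => //; apply: bvD.
Qed.

Lemma bv_mono V : (forall s t, s <= t -> V s <= V t) -> bv V.
Proof.
by move=> hV; exists V => s t _ st _; rewrite ger0_norm// subr_ge0 hV.
Qed.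

Lemma eq_bv f g : (forall t, 0 <= t <= 1 -> f t = g t) -> bv f -> bv g.
Proof.
move=> fg [V fV]; exists V => s t s0 st t1.
by rewrite -!fg ?(le_trans s0 st)// ?s0 ?(le_trans st t1)//; exact: fV.
Qed.

End Majorant.

(** * Measurability of a continuous function of finitely many coordinates *)

(** F need only be continuous with respect to the coordinates w along their
    range, so that F = f \o w with f defined on an arbitrary, possibly
    nonmeasurable, set of values.  The sets [F > a] are countable unions of
    preimages by w of rational boxes. *)
Lemma measurable_of_coordinates {R : realType} {d : measure_display}
    {T : measurableType d} (D : set T) (I : finType) (w : I -> T -> R)
    (F : T -> R) :
  (forall i, measurable_fun D (w i)) ->
  (forall t, D t -> forall e : R, 0 < e -> exists2 r : R, 0 < r &
     forall s, D s -> (forall i, `|w i s - w i t| < r) -> `|F s - F t| < e) ->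
  measurable_fun D F.
Proof.
move=> mw cF mD; apply: (measurability _ (RGenOInfty.measurableE R)) => //.
move=> /= _ [_ [a ->] <-]; rewrite preimage_itvoy.
pose box (p : {ffun I -> rat} * nat) := D `&` \bigcap_(i in [set: I])
  (D `&` (w i) @^-1` ball (ratr (p.1 i) : R) (p.2.+1%:R^-1 : R)).
have mbox p : measurable (box p).
  apply: measurableI => //; apply: fin_bigcap_measurable => // i _.
  exact: (mw i mD _ (measurable_ball _ _)).
rewrite [X in measurable X](_ : _ =
    \bigcup_(p in [set p | forall t, box p t -> a < F t]) box p); last first.
  apply/seteqP; split => [t [Dt aF]|t [p pF boxt]]; last first.
    by split; [case: boxt | exact: pF].
  have eps : 0 < F t - a by rewrite subr_gt0.
  have [r r0 rF] := cF t Dt _ eps.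
  pose k := Num.truncn (2 / r).
  have kr : k.+1%:R^-1 < r / 2.
    rewrite -invf_div ltf_pV2 ?posrE ?divr_gt0//.
    by case/andP: (truncn_itv (ltW (divr_gt0 (ltr0Sn R 1) r0))).
  have /choice [p wp] : forall i, exists c : rat, `|ratr c - w i t| < k.+1%:R^-1.
    move=> i; have k0 : 0 < k.+1%:R^-1 :> R by rewrite invr_gt0.
    have : w i t - k.+1%:R^-1 < w i t + k.+1%:R^-1.
      by rewrite ltrBlDr -addrA ltrDl addr_gt0.
    case/rat_in_itvoo => c; rewrite in_itv/= => /andP[c1 c2].
    exists c; rewrite ltr_norml; apply/andP; split.
      by rewrite ltrBrDl.
    by rewrite ltrBlDl.
  exists ([ffun i => p i], k); last first.
    by split=> // i _; split=> //=; rewrite ffunE /ball/=; exact: wp.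
  move=> s [Ds boxs]; suff : `|F s - F t| < F t - a.
    by rewrite ltr_norml => /andP[? _]; lra.
  apply: rF => // i; have [_] := boxs i Logic.I; rewrite /= ffunE /ball/= => ws.
  have -> : w i s - w i t = - (ratr (p i) - w i s) + (ratr (p i) - w i t) by ring.
  apply: (le_lt_trans (ler_normD _ _)); rewrite normrN (splitr r).
  by apply: ltrD; [exact: lt_trans ws kr | exact: lt_trans (wp i) kr].
rewrite bigcup_mkcond; apply: countable_bigcupT_measurable => [|p].
  exact: countableP.
by case: ifP.
Qed.

(** * Gronwall's inequality *)

Section Gronwall.
Context {R : realType}.
Variable K : R.
Hypothesis K0 : 0 < K.

(** The weight for which v |-> K * \int_0^t v is a contraction of ratio 1/2. *)
Definition weight (t : R) : R := expR (2 * K * t).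

Lemma weight_gt0 (t : R) : 0 < weight t. Proof. exact: expR_gt0. Qed.

Lemma weight_ge1 (t : R) : 0 <= t -> 1 <= weight t.
Proof. by move=> t0; rewrite /weight -expR0 ler_expR !mulr_ge0// ltW. Qed.

Lemma weight_le1 (t : R) : t <= 1 -> weight t <= weight 1.
Proof. by move=> t1; rewrite ler_expR ler_pM2l// mulr_gt0. Qed.

Lemma weight_bmeas : bmeas weight.
Proof.
by apply: bv_bmeas; apply: bv_mono => s t st; rewrite ler_expR ler_pM2l// mulr_gt0.
Qed.

Lemma intR_weight (t : R) : 0 <= t -> t <= 1 -> K * intR 0 t weight <= weight t / 2.
Proof.
rewrite le_eqVlt => /predU1P[<-|t0] t1.
  by rewrite intRxx mulr0 divr_ge0// expR_ge0.
have dW (s : R) : is_derive s 1 weight (2 * K * weight s).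
  have -> : weight = expR \o (fun x : R => 2 * K * x) by [].
  apply: is_derive_eq; rewrite /GRing.scale/= mulr1.
  by rewrite mulrC.
have cW : continuous weight.
  by move=> s; apply/differentiable_continuous/derivable1_diffP/ex_derive.
have ftc : (\int[lebesgue_measure]_(x in `[0%R, t]) (2 * K * weight x)%R%:E =
    (weight t)%:E - (weight 0%R)%:E)%E.
  apply: continuous_FTC2 => //.
  - apply: continuous_subspaceT => s.
    by apply: cvgM; [exact: cvg_cst | exact: cW].
  - split => [s _||].
    + exact: (@ex_derive _ _ _ _ _ _ _ (dW s)).
    + exact/cvg_at_right_filter/cW.
    + exact/cvg_at_left_filter/cW.
  - by move=> s _; rewrite derive1E; exact: (@derive_val _ _ _ _ _ _ _ (dW s)).
have : intR 0 t (fun s => 2 * K * weight s) = weight t - weight 0.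
  by rewrite /intR /Rintegral ftc.
rewrite (intRZ (lexx _) t1)//; last exact: weight_bmeas.
by have := weight_gt0 0; lra.
Qed.

(** One step of the contraction, which yields both Gronwall's inequality and the
    convergence of Picard's iterates. *)
Lemma weighted_contraction (v : R -> R) (C : R) : bmeas v ->
  (forall t, 0 <= t <= 1 -> v t <= C * weight t) -> 0 <= C ->
  forall t, 0 <= t <= 1 -> K * intR 0 t v <= C / 2 * weight t.
Proof.
move=> bv vC C0 t /andP[t0 t1].
apply: (@le_trans _ _ (K * (C * intR 0 t weight))).
  rewrite ler_pM2l// -intRZ//; last exact: weight_bmeas.
  apply: le_intR => //; first by apply: bmeasZ; exact: weight_bmeas.
  by move=> s /andP[s0 st]; rewrite vC// s0 (le_trans st t1).
have := ler_wpM2l C0 (intR_weight t0 t1); rewrite mulrCA => /le_trans; apply.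
by rewrite mulrA mulrAC.
Qed.

Lemma gronwall (e : R -> R) (b : R) : bmeas e -> 0 <= b ->
  (forall t, 0 <= t <= 1 -> e t <= b + K * intR 0 t e) ->
  forall t, 0 <= t <= 1 -> e t <= 2 * b * weight 1.
Proof.
move=> be b0 he.
have [M eM] := be.2.
pose Q := [set e t / weight t | t in `[0 : R, 1]].
have hQ : has_sup Q.
  split; first by exists (e 0 / weight 0), 0 => //=; rewrite in_itv/= lexx ler01.
  exists M => _ [t + <-]; rewrite /= in_itv/= => t01.
  rewrite ler_pdivrMr ?weight_gt0//; have eMt := eM t t01.
  apply: (le_trans (ler_norm _)); apply: (le_trans eMt).
  rewrite ler_peMr ?weight_ge1//; first exact: le_trans (normr_ge0 _) eMt.
  by case/andP: t01.
have eQ t : 0 <= t <= 1 -> e t <= Num.max 0 (sup Q) * weight t.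
  move=> t01; rewrite -ler_pdivrMr ?weight_gt0// le_max; apply/orP; right.
  by apply: (ub_le_sup hQ.2); exists t => //=; rewrite in_itv.
have S0 : 0 <= Num.max 0 (sup Q) by rewrite le_max lexx.
have SQ : Num.max 0 (sup Q) <= b + Num.max 0 (sup Q) / 2.
  rewrite {1}/Num.max; case: ifP => _; last by rewrite addr_ge0// divr_ge0.
  apply: (ge_sup hQ.1) => _ [t + <-]; rewrite /= in_itv/= => t01.
  rewrite ler_pdivrMr ?weight_gt0//; apply: (le_trans (he t t01)).
  rewrite mulrDl lerD ?weighted_contraction//.
  by rewrite ler_peMr// weight_ge1//; case/andP: t01.
have S2 : Num.max 0 (sup Q) <= 2 * b by lra.
move=> t t01; apply: (le_trans (eQ t t01)).
apply: ler_pM => //; first exact/ltW/weight_gt0.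
by apply: weight_le1; case/andP: t01.
Qed.

End Gronwall.

(** * Euclidean and sup norms, and second-order expansions *)

Section Norms.
Context {R : realType}.

Lemma coord_le_norm k (v : 'rV[R]_k) i : `|v ord0 i| <= `|v|.
Proof.
rewrite [leRHS]mx_normrE.
exact: (le_bigmax _ (fun ij : 'I_1 * 'I_k => `|v ij.1 ij.2|) (ord0, i)).
Qed.

Lemma norm_le_coord k (v : 'rV[R]_k) (c : R) : 0 <= c ->
  (forall i, `|v ord0 i| <= c) -> `|v| <= c.
Proof.
move=> c0 vc; rewrite [leLHS]mx_normrE; apply/bigmax_leP; split=> // -[i j] _.
by rewrite (ord1 i).
Qed.

Lemma coord_le_enorm k (v : 'rV[R]_k) i : `|v ord0 i| <= enorm v.
Proof.
rewrite /enorm -sqrtr_sqr ler_wsqrtr// (bigD1 i)//= lerDl sumr_ge0// => j _.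
exact: sqr_ge0.
Qed.

Lemma enorm_ge0 k (v : 'rV[R]_k) : 0 <= enorm v.
Proof. exact: sqrtr_ge0. Qed.

Lemma norm_le_enorm k (v : 'rV[R]_k) : `|v| <= enorm v.
Proof. by apply: norm_le_coord => [|i]; rewrite ?enorm_ge0 ?coord_le_enorm. Qed.

Lemma enorm_le_norm k (v : 'rV[R]_k) (c : R) : k%:R <= c -> 1 <= c ->
  enorm v <= c * `|v|.
Proof.
move=> kc c1; have c0 : 0 <= c := le_trans ler01 c1.
rewrite -[leRHS]ger0_norm ?mulr_ge0// -sqrtr_sqr ler_wsqrtr//.
apply: (@le_trans _ _ (\sum_(i < k) `|v| ^+ 2)).
  apply: ler_sum => i _; rewrite -[leLHS]real_normK ?num_real//.
  by rewrite lerXn2r ?nnegrE// coord_le_norm.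
rewrite sumr_const card_ord -mulr_natl exprMn ler_wpM2r ?sqr_ge0//.
by apply: (le_trans kc); rewrite expr2 ler_peMl.
Qed.

Lemma enormZ k (a : R) (v : 'rV[R]_k) : enorm (a *: v) = `|a| * enorm v.
Proof.
rewrite /enorm -sqrtr_sqr -sqrtrM ?sqr_ge0// mulr_sumr; congr Num.sqrt.
by apply: eq_bigr => i _; rewrite mxE exprMn.
Qed.

Lemma sup_ge0 (A : set R) : (forall x, A x -> 0 <= x) -> 0 <= sup A.
Proof.
move=> A0; have [[[x Ax] ubA]|/sup_out ->//] := pselect (has_sup A).
by apply: (le_trans (A0 x Ax)); exact: ub_le_sup.
Qed.

(** The supremum defining opnorm2 is finite only because a linear map on a
    finite-dimensional space is bounded; hypothesis M provides that bound. *)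
Lemma opnorm2_bound k (W : lmodType R) (nrm : W -> R) (A : 'rV[R]_k -> W)
    (M : R) :
  (forall a w, nrm (a *: w) = `|a| * nrm w) ->
  (forall a v, A (a *: v) = a *: A v) ->
  (forall v, nrm (A v) <= M * enorm v) ->
  forall v, nrm (A v) <= opnorm2 nrm A * enorm v.
Proof.
move=> nrmZ AZ AM v; have [v0|v0] := eqVneq (enorm v) 0.
  by rewrite v0 mulr0 -(mulr0 M) -v0.
have v_gt0 : 0 < enorm v by rewrite lt_neqAle eq_sym v0 enorm_ge0.
rewrite -ler_pdivrMr//.
have -> : nrm (A v) / enorm v = nrm (A ((enorm v)^-1 *: v)).
  by rewrite AZ nrmZ ger0_norm ?invr_ge0 ?enorm_ge0// mulrC.
apply: ub_le_sup.
  exists `|M| => _ [w w1 <-]; apply: (le_trans (AM w)).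
  apply: (le_trans (ler_norm _)); rewrite normrM ler_piMr//.
  by rewrite ger0_norm ?enorm_ge0.
exists ((enorm v)^-1 *: v) => //=.
by rewrite enormZ ger0_norm ?invr_ge0 ?enorm_ge0// mulVf.
Qed.

Lemma opnorm2_diff_bound k (W : normedModType R) (nrm : W -> R) (c : R)
    (f g : 'rV[R]_k -> W) (x y : 'rV[R]_k) :
  (forall a w, nrm (a *: w) = `|a| * nrm w) ->
  (forall w, nrm w <= c * `|w|) -> 0 <= c ->
  differentiable f x -> differentiable g y ->
  forall v, nrm ('d f x v - 'd g y v) <=
    opnorm2 nrm (fun z => 'd f x z - 'd g y z) * enorm v.
Proof.
move=> nrmZ nc c0 df dg.
have [M M0 fM] := linear_lipschitz (diff_continuous df).
have [N N0 gN] := linear_lipschitz (diff_continuous dg).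
apply: (@opnorm2_bound _ _ _ _ (c * (M + N))) => // [a v|v].
  by rewrite scalerBr; congr (_ - _); exact: linearZZ.
apply: (le_trans (nc _)); rewrite -mulrA; apply: ler_wpM2l => //.
apply: (le_trans (ler_normB _ _)); rewrite mulrDl; apply: lerD.
  by apply: (le_trans (fM v)); rewrite ler_pM2l// norm_le_enorm.
by apply: (le_trans (gN v)); rewrite ler_pM2l// norm_le_enorm.
Qed.

Lemma is_derive_line k (h : 'rV[R]_k -> R) (x v : 'rV[R]_k) (s : R) :
  differentiable h (x + s *: v) ->
  is_derive s 1 (fun r : R => h (x + r *: v)) ('d h (x + s *: v) v).
Proof.
move=> dh; have der := diff_derivable (v := v) dh.
have eqf : (fun l : R => l^-1 *: (h (x + (l *: (1 : R) + s) *: v) -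
      h (x + s *: v))) =
    (fun l : R => l^-1 *: (h (l *: v + (x + s *: v)) - h (x + s *: v))).
  apply/funext => l; congr (_ *: (h _ - _)).
  by rewrite [l *: 1]mulr1 scalerDl addrCA.
rewrite -(deriveE _ dh); apply: DeriveDef.
  by rewrite /derivable; move: der; rewrite /derivable /= -eqf.
by rewrite /derive /= eqf.
Qed.

Lemma is_derive_line_coord k n (f : 'rV[R]_k -> 'rV[R]_n) (x v : 'rV[R]_k)
    (i : 'I_n) (s : R) :
  differentiable f (x + s *: v) ->
  is_derive s 1 (fun r : R => f (x + r *: v) ord0 i)
    ('d f (x + s *: v) v ord0 i).
Proof.
move=> df; pose h := fun y => f y ord0 i.
have dh : differentiable h (x + s *: v).
  exact: (differentiable_comp df (differentiable_coord _ _ _)).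
have -> : 'd f (x + s *: v) v ord0 i = 'd h (x + s *: v) v.
  rewrite -!deriveE//; apply/esym/cvg_lim => //.
  have := diff_derivable (v := v) df; rewrite /derivable => /= der.
  have := cvg_comp _ _ der (@coord_continuous R 1 n ord0 i _).
  apply: cvg_trans; apply: near_eq_cvg; near=> l.
  by rewrite /= !mxE.
exact: is_derive_line.
Unshelve. all: by end_near. Qed.

Lemma taylor1 (p dp : R -> R) (B : R) :
  (forall s : R, is_derive s 1 p (dp s)) ->
  (forall s : R, 0 <= s <= 1 -> `|dp s - dp 0| <= B) ->
  `|p 1 - p 0 - dp 0| <= B.
Proof.
move=> dpP dpB.
have [|c] := @MVT R p dp 0 1 ltr01 (fun s _ => dpP s).
  apply: continuous_subspaceT => s.
  exact/differentiable_continuous/derivable1_diffP/(@ex_derive _ _ _ _ _ _ _ (dpP s)).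
rewrite in_itv/= subr0 mulr1 => /andP[c0 c1] ->.
by apply: dpB; rewrite !ltW.
Qed.

End Norms.

(** * Vector-valued integrals and Picard's theorem *)

Section VectorIntegral.
Context {R : realType} {n : nat}.
Implicit Types (x F G : R -> 'rV[R]_n).

Definition bmeasv x := forall i, bmeas (fun t => x t ord0 i).

Lemma bmeasv_norm x : bmeasv x -> bmeas (fun t => `|x t|).
Proof.
move=> bx; split; last first.
  have [M xM] := (bmeas_sum (index_enum 'I_n) xpredT
    (fun i => bmeas_norm (bx i))).2.
  exists M => t t01; apply: le_trans (xM t t01).
  rewrite normr_id [leRHS]ger0_norm ?sumr_ge0//.
  apply: norm_le_coord => [|i]; first exact: sumr_ge0.
  by rewrite (bigD1 i)//= lerDl sumr_ge0.
apply: (measurable_of_coordinates (w := fun i t => x t ord0 i)) => [i|t _ e e0].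
  by case: (bx i).
exists (e / 2); first by rewrite divr_gt0.
move=> s _ xst; apply: (le_lt_trans (ler_dist_dist _ _)).
apply: (@le_lt_trans _ _ (e / 2)); last by lra.
apply: norm_le_coord => [|i]; first by rewrite divr_ge0// ltW.
by rewrite !mxE ltW.
Qed.

Lemma bmeasvD x F : bmeasv x -> bmeasv F -> bmeasv (fun t => x t + F t).
Proof. by move=> bx bF i; under eq_fun do rewrite mxE; exact: bmeasD. Qed.

Lemma bmeasvB x F : bmeasv x -> bmeasv F -> bmeasv (fun t => x t - F t).
Proof. by move=> bx bF i; under eq_fun do rewrite !mxE; exact: bmeasB. Qed.

Lemma bmeasvZ k x : bmeasv x -> bmeasv (fun t => k *: x t).
Proof. by move=> bx i; under eq_fun do rewrite mxE; exact: bmeasZ. Qed.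

Lemma bmeasv_cst v : bmeasv (fun=> v).
Proof. by move=> i; exact: bmeas_cst. Qed.

Definition vint (t : R) F : 'rV[R]_n :=
  \row_i intR 0 t (fun s => F s ord0 i).

Lemma vint_le (t : R) F : t <= 1 -> bmeasv F ->
  `|vint t F| <= intR 0 t (fun s => `|F s|).
Proof.
move=> t1 bF; apply: norm_le_coord => [|i]; first exact: intR_ge0.
rewrite mxE; apply: (le_trans (intR_abs (lexx 0) t1 (bF i))).
apply: le_intR => //; [exact: bmeas_norm | exact: bmeasv_norm |].
by move=> s _; exact: coord_le_norm.
Qed.

Lemma vintB (t : R) F G : t <= 1 -> bmeasv F -> bmeasv G ->
  vint t F - vint t G = vint t (fun s => F s - G s).
Proof.
move=> t1 bF bG; apply/rowP => i; rewrite !mxE -intRB//.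
by apply: eq_intR => s _; rewrite !mxE.
Qed.

Lemma vint_cat (s t : R) F i : 0 <= s -> s <= t -> t <= 1 -> bmeasv F ->
  (vint t F - vint s F) ord0 i = intR s t (fun r => F r ord0 i).
Proof.
move=> s0 st t1 bF.
by rewrite !mxE (intR_cat (lexx 0) s0 st t1 (bF i)) addrC addKr.
Qed.

Definition lipschitz01 (M : R) x :=
  forall s t, 0 <= s -> s <= t -> t <= 1 -> `|x t - x s| <= M * (t - s).

Lemma vint_lipschitz F (M : R) : 0 <= M -> bmeasv F ->
  (forall t, 0 <= t <= 1 -> `|F t| <= M) ->
  forall v, lipschitz01 M (fun t => v + vint t F).
Proof.
move=> M0 bF FM v s t s0 st t1; rewrite opprD addrACA subrr add0r.
apply: norm_le_coord => [|i]; first by rewrite mulr_ge0// subr_ge0.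
rewrite vint_cat//; apply: intR_bound => // r /andP[sr rt].
apply: (le_trans (coord_le_norm _ _)); apply: FM.
by rewrite (le_trans s0 sr) (le_trans rt t1).
Qed.

Lemma lipschitz01_bv x M : lipschitz01 M x -> forall i, bv (fun t => x t ord0 i).
Proof.
move=> xM i; exists (fun t => M * t) => s t s0 st t1.
rewrite -mulrBr; apply: le_trans (xM s t s0 st t1).
by have := coord_le_norm (x t - x s) i; rewrite !mxE.
Qed.

Lemma lipschitz01_continuous x M : lipschitz01 M x ->
  {within `[0, 1], continuous x}.
Proof.
move=> xM; have M1 : 0 < `|M| + 1 by rewrite ltr_wpDl.
apply/subspace_continuousP => t /=; rewrite in_itv/= => /andP[t0 t1].
apply/cvgrPdist_le => e e0; rewrite near_withinE; near=> s.
rewrite /= in_itv/= => /andP[s0 s1].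
have st : `|t - s| <= e / (`|M| + 1).
  by near: s; apply: cvgr_dist_le; [exact: cvg_id | exact: divr_gt0].
apply: (@le_trans _ _ ((`|M| + 1) * `|t - s|)); last first.
  by rewrite mulrC -ler_pdivlMr.
apply: (@le_trans _ _ (M * `|t - s|)); last first.
  by rewrite ler_wpM2r// (le_trans (ler_norm M))// lerDl.
have [ts|/ltW ts] := leP s t.
  by rewrite ger0_norm ?subr_ge0//; exact: xM.
by rewrite distrC [`|t - s|]distrC ger0_norm ?subr_ge0//; exact: xM.
Unshelve. all: by end_near. Qed.

Lemma continuous01_bmeasv x : {within `[0, 1], continuous x} -> bmeasv x.
Proof.
move=> cx i; have cxi : {within `[0, 1], continuous (fun t => x t ord0 i)}.
  move=> t; apply: (@continuous_comp _ _ _ (x : subspace _ -> _)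
    (fun v : 'rV[R]_n => v ord0 i)); first exact: cx.
  exact: coord_continuous.
split; first exact: subspace_continuous_measurable_fun.
have [M [_ xM]] := compact_bounded (continuous_compact cxi
  (@segment_compact _ 0 1)).
exists (M + 1) => t t01; apply: xM; first by rewrite ltrDl.
by exists t => //=; rewrite in_itv.
Qed.

End VectorIntegral.

Section GeometricSequences.
Context {R : realType}.

Lemma le0_of_geometric (a c : R) : (forall k, a <= c / 2 ^+ k) -> a <= 0.
Proof.
move=> ac; rewrite leNgt; apply/negP => a0.
have c0 : 0 < c by have := lt_le_trans a0 (ac 0%N); rewrite expr0 divr1.
pose k := Num.truncn (c / a).
have ck : c / a < k.+1%:R.
  by case/andP: (truncn_itv (ltW (divr_gt0 c0 a0))).
have := ac k.+1; rewrite ler_pdivlMr ?exprn_gt0// leNgt => /negP; apply.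
rewrite mulrC -ltr_pdivrMr//; apply: (lt_le_trans ck).
by rewrite -natrX ler_nat ltnW// ltn_expl.
Qed.

(** The sequences u - 2 c / 2^k and u + 2 c / 2^k are monotone, and every value of
    the first lies below every value of the second; the supremum of the first
    separates them.  Here 2 c / 2^k is the tail of the geometric series. *)
Lemma geometric_limit (u : nat -> R) (c : R) :
  (forall k, `|u k.+1 - u k| <= c / 2 ^+ k) ->
  exists l, forall k, `|u k - l| <= 2 * c / 2 ^+ k.
Proof.
move=> uc; pose e k : R := 2 * c / 2 ^+ k.
have eS k : e k.+1 = e k - c / 2 ^+ k.
  by rewrite /e exprS invfM; field.
have lo j k : u j - e j <= u (j + k)%N - e (j + k)%N.
  elim: k => [|k /le_trans]; first by rewrite addn0.
  apply; rewrite addnS eS; have := uc (j + k)%N; rewrite ler_norml => /andP[].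
  by move: (u _) (u _) (e _) (c / _) => *; lra.
have hi j k : u (j + k)%N + e (j + k)%N <= u j + e j.
  elim: k => [|k]; first by rewrite addn0.
  apply: le_trans.
  rewrite addnS eS; have := uc (j + k)%N; rewrite ler_norml => /andP[].
  by move: (u _) (u _) (e _) (c / _) => *; lra.
have e0 k : 0 <= e k.
  have c0 : 0 <= c by have := le_trans (normr_ge0 _) (uc 0%N); rewrite expr0 divr1.
  by rewrite /e !mulr_ge0 ?invr_ge0 ?exprn_ge0.
have cross j k : u j - e j <= u k + e k.
  apply: (le_trans (lo j k)); rewrite addnC; apply: le_trans (hi k j).
  by rewrite lerD2l; have := e0 (k + j)%N; lra.
pose Q := [set u j - e j | j in [set: nat]].
have hQ : has_sup Q.
  split; first by exists (u 0%N - e 0%N), 0%N.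
  by exists (u 0%N + e 0%N) => _ [j _ <-]; exact: cross.
exists (sup Q) => k; rewrite distrC ler_distl; apply/andP; split.
  by apply: (ub_le_sup hQ.2); exists k.
by apply: (ge_sup hQ.1) => _ [j _ <-]; exact: cross.
Qed.

End GeometricSequences.

Section Picard.
Context {R : realType} {n : nat}.
Variables (Phi : R -> 'rV[R]_n -> 'rV[R]_n) (K M : R) (x0 : 'rV[R]_n).
Hypotheses (K0 : 0 < K) (M0 : 0 <= M).
Hypothesis Phi_lip : forall t : R, 0 <= t <= 1 ->
  forall x y, `|Phi t x - Phi t y| <= K * `|x - y|.
Hypothesis Phi_bound : forall t : R, 0 <= t <= 1 ->
  forall x, `|Phi t x| <= M * (1 + `|x|).
Hypothesis Phi_bmeas : forall x, bmeasv x -> bmeasv (fun t => Phi t (x t)).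

Fixpoint picard_iter (k : nat) : R -> 'rV[R]_n :=
  if k is k'.+1 then fun t => x0 + vint t (fun s => Phi s (picard_iter k' s))
  else fun=> x0.

Let X := picard_iter.

Let along_lipschitz x (B : R) : bmeasv x -> 0 <= B ->
  (forall t : R, 0 <= t <= 1 -> `|x t| <= B) ->
  lipschitz01 (M * (1 + B)) (fun t => x0 + vint t (fun s => Phi s (x s))).
Proof.
move=> bx B0 xB; apply: vint_lipschitz => [||t t01]; last 1 first.
- apply: (le_trans (Phi_bound t01 _)); apply: ler_wpM2l => //.
  by rewrite lerD2l xB.
- by rewrite mulr_ge0// addr_ge0.
- exact: Phi_bmeas.
Qed.

Let along_bmeasv x : bmeasv x ->
  bmeasv (fun t => x0 + vint t (fun s => Phi s (x s))).
Proof.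
move=> bx i; apply: bv_bmeas; have [B xB] := (bmeasv_norm bx).2.
apply: (lipschitz01_bv (M := M * (1 + `|B|))).
apply: along_lipschitz => // t /xB; rewrite normr_id => /le_trans; apply.
exact: ler_norm.
Qed.

Let X_bmeasv k : bmeasv (X k).
Proof. by elim: k => [|k IH]; [exact: bmeasv_cst | exact: along_bmeasv]. Qed.

Let vint_dist x y (t : R) : 0 <= t <= 1 -> bmeasv x -> bmeasv y ->
  `|vint t (fun s => Phi s (x s)) - vint t (fun s => Phi s (y s))| <=
  K * intR 0 t (fun s => `|x s - y s|).
Proof.
move=> /andP[t0 t1] bx by_; rewrite vintB//; try exact: Phi_bmeas.
apply: (le_trans (vint_le t1 _)).
  by apply: bmeasvB; exact: Phi_bmeas.
rewrite -intRZ//; last by apply: bmeasv_norm; exact: bmeasvB.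
apply: le_intR => //.
- by apply: bmeasv_norm; apply: bmeasvB; exact: Phi_bmeas.
- by apply: bmeasZ; apply: bmeasv_norm; exact: bmeasvB.
- move=> s /andP[s0 st]; apply: Phi_lip.
  by rewrite s0 (le_trans st t1).
Qed.

Let c := M * (1 + `|x0|).

Let X_dist (k : nat) : forall t : R, 0 <= t <= 1 ->
  `|X k.+1 t - X k t| <= c / 2 ^+ k * weight K t.
Proof.
have c0 : 0 <= c by rewrite mulr_ge0// addr_ge0.
elim: k => [|k IH] t t01.
  have /andP[t0 t1] := t01.
  rewrite expr0 divr1 /= addrAC subrr add0r.
  apply: (le_trans (vint_le t1 _)); first exact/Phi_bmeas/bmeasv_cst.
  apply: (@le_trans _ _ (c * (t - 0))).
    rewrite -intR_cst//; apply: le_intR => //.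
    - exact/bmeasv_norm/Phi_bmeas/bmeasv_cst.
    - exact: bmeas_cst.
    - by move=> s /andP[s0 st]; apply: Phi_bound; rewrite s0 (le_trans st t1).
  apply: ler_wpM2l => //; rewrite subr0; apply: (le_trans t1).
  exact: weight_ge1.
rewrite [X k.+2 t]/= [X k.+1 t]/= opprD addrACA subrr add0r.
apply: (le_trans (vint_dist t01 (X_bmeasv k.+1) (X_bmeasv k))).
have -> : c / 2 ^+ k.+1 = c / 2 ^+ k / 2 by rewrite exprSr invfM mulrA.
apply: weighted_contraction => //.
- by apply: bmeasv_norm; apply: bmeasvB; exact: X_bmeasv.
- by rewrite divr_ge0// exprn_ge0.
Qed.

(** The limit inherits a Lipschitz bound common to all iterates, which makes it
    measurable, so that one may pass to the limit under the integral. *)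
Theorem picard : exists x : R -> 'rV[R]_n, {within `[0, 1], continuous x} /\
  forall t : R, 0 <= t <= 1 -> x t = x0 + vint t (fun s => Phi s (x s)).
Proof.
have c0 : 0 <= c by rewrite mulr_ge0// addr_ge0.
pose C := 2 * (c * weight K 1).
have C0 : 0 <= C by rewrite !mulr_ge0//; exact/ltW/weight_gt0.
have /choice [xl xlP] : forall ti : R * 'I_n, exists l, 0 <= ti.1 <= 1 ->
    forall k, `|X k ti.1 ord0 ti.2 - l| <= C / 2 ^+ k.
  move=> [t i] /=; have [t01|] := boolP (0 <= t <= 1); last by exists 0.
  have [k|l lP] := @geometric_limit R (fun k => X k t ord0 i) (c * weight K 1).
    have := coord_le_norm (X k.+1 t - X k t) i; rewrite !mxE.
    move=> /le_trans; apply; apply: (le_trans (X_dist k t01)).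
    rewrite mulrAC ler_wpM2r ?invr_ge0 ?exprn_ge0// ler_wpM2l//.
    by apply: weight_le1 => //; case/andP: t01.
  by exists l.
pose x t : 'rV[R]_n := \row_i xl (t, i).
have xX (t : R) (k : nat) : 0 <= t <= 1 -> `|X k t - x t| <= C / 2 ^+ k.
  move=> t01; apply: norm_le_coord => [|i].
    by rewrite divr_ge0// exprn_ge0.
  by rewrite !mxE; exact: (xlP (t, i)).
have Xb (t : R) (k : nat) : 0 <= t <= 1 -> `|X k t| <= `|x0| + 2 * C.
  move=> t01; have -> : X k t = x0 + ((X k t - x t) - (X 0%N t - x t)).
    by rewrite [X 0%N t]/=; apply/rowP => i; rewrite !mxE; ring.
  apply: (le_trans (ler_normD _ _)); rewrite lerD2l.
  apply: (le_trans (ler_normB _ _)); rewrite mulr_natl mulr2n; apply: lerD.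
    apply: (le_trans (xX t k t01)); rewrite ler_piMr// invf_le1 ?exprn_gt0//.
    by rewrite exprn_ege1// ler1n.
  by apply: (le_trans (xX t 0%N t01)); rewrite expr0 divr1.
pose B := M * (1 + (`|x0| + 2 * C)).
have xlip : lipschitz01 B x.
  move=> s t s0 st t1; rewrite -subr_le0.
  have s01 : 0 <= s <= 1 by rewrite s0 (le_trans st t1).
  have t01 : 0 <= t <= 1 by rewrite t1 (le_trans s0 st).
  apply: (@le0_of_geometric _ _ (2 * C)) => k; rewrite lerBlDr.
  have -> : x t - x s = (X k.+1 s - x s - (X k.+1 t - x t)) +
      (X k.+1 t - X k.+1 s).
    by apply/rowP => i; rewrite !mxE; ring.
  apply: (le_trans (ler_normD _ _)); apply: lerD.
    apply: (le_trans (ler_normB _ _)); rewrite mulr_natl mulr2n mulrDl.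
    have half : C / 2 ^+ k.+1 <= C / 2 ^+ k.
      by rewrite ler_wpM2l// lef_pV2 ?posrE ?exprn_gt0// exprS ler_peMl ?exprn_ge0 ?ler1n//.
    by apply: lerD; apply: le_trans half; exact: xX.
  apply: (along_lipschitz (X_bmeasv k) _ _ s0 st t1) => [|r].
    by rewrite addr_ge0// mulr_ge0.
  exact: Xb.
exists x; split; first exact: lipschitz01_continuous xlip.
have bx : bmeasv x by move=> i; exact/bv_bmeas/(lipschitz01_bv xlip).
move=> t t01; apply/eqP; rewrite -subr_eq0 -normr_le0; have /andP[t0 t1] := t01.
apply: (@le0_of_geometric _ _ (C + K * C)) => k.
have -> : x t - (x0 + vint t (fun s => Phi s (x s))) =
    - (X k.+1 t - x t) +
    (vint t (fun s => Phi s (X k s)) - vint t (fun s => Phi s (x s))).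
  by rewrite /=; apply/rowP => i; rewrite !mxE; ring.
apply: (le_trans (ler_normD _ _)); rewrite normrN mulrDl; apply: lerD.
  apply: (le_trans (xX t k.+1 t01)).
  by rewrite ler_wpM2l// lef_pV2 ?posrE ?exprn_gt0// exprS ler_peMl ?exprn_ge0 ?ler1n//.
apply: (le_trans (vint_dist t01 (X_bmeasv k) bx)); rewrite -mulrA ler_pM2l//.
apply: (@le_trans _ _ (C / 2 ^+ k * (t - 0))).
  rewrite -intR_cst//; apply: le_intR => //.
  - by apply: bmeasv_norm; apply: bmeasvB.
  - exact: bmeas_cst.
  - by move=> s /andP[s0 st]; apply: xX; rewrite s0 (le_trans st t1).
by rewrite subr0 ler_piMr// divr_ge0// exprn_ge0.
Qed.

End Picard.

(** * Second-order remainders along segments *)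

Section Segment.
Context {R : realType} {V : lmodType R}.

Definition seg (s : R) (a b : V) := a + s *: (b - a).

Lemma segE s a b : seg s a b = (1 - s) *: a + s *: b.
Proof. by rewrite /seg scalerBr scalerBl scale1r addrAC -addrA. Qed.

Lemma seg0 a b : seg 0 a b = a.
Proof. by rewrite /seg scale0r addr0. Qed.

Lemma seg1 a b : seg 1 a b = b.
Proof. by rewrite /seg scale1r addrC subrK. Qed.

Lemma seg_sub s a b : seg s a b - a = s *: (b - a).
Proof. by rewrite /seg addrC addKr. Qed.

Lemma seg_seg s l a b : seg s a (seg l a b) = seg (s * l) a b.
Proof. by rewrite /seg addrC [a + l *: _]addrC addrK scalerA addrC. Qed.

End Segment.

Lemma convex_seg {R : realType} {k : nat} (U : set 'rV[R]_k) a b (s : R) :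
  convex_set U -> U a -> U b -> 0 <= s <= 1 -> U (seg s a b).
Proof.
move=> cU Ua Ub /andP[s0 s1].
have := cU b a (Itv01 s0 s1) (mem_set Ub) (mem_set Ua).
by move=> /set_mem h; rewrite segE addrC; exact: h.
Qed.

Section SecondOrder.
Context {R : realType} {n m q Nc : nat}.
Variables (P : problem R n m q Nc) (L : R).
Hypotheses (L0 : 0 < L) (P_ok : problem_ok P L).
Local Notation U := (inputs P).

(** Bounds the Euclidean norm by the sup norm both on states and on inputs; the
    successor makes it at least 1. *)
Definition dimc : R := (n + m).+1%:R.

Lemma dimc_ge1 : 1 <= dimc. Proof. by rewrite ler1n. Qed.
Lemma dimc_ge0 : 0 <= dimc. Proof. exact: ler0n. Qed.
Hint Resolve dimc_ge0 dimc_ge1 : core.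

Lemma enorm_len (v : 'rV[R]_n) : enorm v <= dimc * `|v|.
Proof. by apply: enorm_le_norm => //; rewrite ler_nat leqW// leq_addr. Qed.

Lemma enorm_lem (v : 'rV[R]_m) : enorm v <= dimc * `|v|.
Proof. by apply: enorm_le_norm => //; rewrite ler_nat leqW// leq_addl. Qed.

Lemma inputs_seg u0 u1 (s : R) : U u0 -> U u1 -> 0 <= s <= 1 -> U (seg s u0 u1).
Proof. by case: P_ok => -[_ cU] _ _ _; exact: convex_seg. Qed.

Lemma inputs_bounded : exists2 B : R, 0 <= B & forall u, U u -> `|u| <= B.
Proof.
case: P_ok => -[bU _] _ _ _; have [M [_ UM]] := bU.
exists (`|M| + 1); first by rewrite addr_ge0.
by move=> u Uu; apply: UM => //; rewrite (le_lt_trans (ler_norm M))// ltrDl.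
Qed.

Lemma field_lipschitz i (t1 t2 : R) x1 x2 u1 u2 :
  0 <= t1 <= 1 -> 0 <= t2 <= 1 -> U u1 -> U u2 ->
  `|vfield P i t1 x1 u1 - vfield P i t2 x2 u2| <=
  L * dimc * (`|t1 - t2| + `|x1 - x2| + `|u1 - u2|).
Proof.
move=> ht1 ht2 hu1 hu2; case: P_ok => _ /(_ i)[_ _ lip] _ _.
have [fl _ _] := lip t1 t2 x1 x2 u1 u2 ht1 ht2 hu1 hu2.
apply: (le_trans (norm_le_enorm _)); apply: (le_trans fl).
rewrite -mulrA ler_pM2l// !mulrDr; apply: lerD; [apply: lerD|].
- exact: ler_peMl.
- exact: enorm_len.
- exact: enorm_lem.
Qed.

Lemma field_dx_lipschitz i (t : R) x1 x2 u1 u2 z j : 0 <= t <= 1 -> U u1 -> U u2 ->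
  `|('d (fun y => vfield P i t y u1) x1 z
     - 'd (fun y => vfield P i t y u2) x2 z) ord0 j| <=
  L * dimc ^+ 2 * (`|x1 - x2| + `|u1 - u2|) * `|z|.
Proof.
move=> t01 hu1 hu2; case: P_ok => _ /(_ i)[dx _ lip] _ _.
have [_ opn _] := lip t t x1 x2 u1 u2 t01 t01 hu1 hu2.
apply: (le_trans (coord_le_enorm _ _)).
have := opnorm2_diff_bound (@enormZ R n) enorm_len dimc_ge0
  (dx t x1 u1) (dx t x2 u2) z.
move=> /le_trans; apply; apply: (@le_trans _ _
  (L * (dimc * `|x1 - x2| + dimc * `|u1 - u2|) * (dimc * `|z|))); last first.
  by rewrite le_eqVlt; apply/orP; left; apply/eqP; ring.
apply: ler_pM; rewrite ?enorm_ge0//; last exact: enorm_len.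
  by apply: sup_ge0 => _ [v _ <-]; exact: enorm_ge0.
apply: (le_trans opn); rewrite subrr normr0 add0r ler_pM2l//.
by apply: lerD; [exact: enorm_len|exact: enorm_lem].
Qed.

Lemma field_du_lipschitz i (t : R) x u1 u2 z j : 0 <= t <= 1 -> U u1 -> U u2 ->
  `|('d (fun v => vfield P i t x v) u1 z
     - 'd (fun v => vfield P i t x v) u2 z) ord0 j| <=
  L * dimc ^+ 2 * `|u1 - u2| * `|z|.
Proof.
move=> t01 hu1 hu2; case: P_ok => _ /(_ i)[_ du lip] _ _.
have [_ _ opn] := lip t t x x u1 u2 t01 t01 hu1 hu2.
apply: (le_trans (coord_le_enorm _ _)).
have := opnorm2_diff_bound (@enormZ R n) enorm_len dimc_ge0
  (du t x u1) (du t x u2) z.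
move=> /le_trans; apply; apply: (@le_trans _ _
  (L * (dimc * `|u1 - u2|) * (dimc * `|z|))); last first.
  by rewrite le_eqVlt; apply/orP; left; apply/eqP; ring.
apply: ler_pM; rewrite ?enorm_ge0//; last exact: enorm_lem.
  by apply: sup_ge0 => _ [v _ <-]; exact: enorm_ge0.
apply: (le_trans opn); rewrite !subrr normr0 add0r.
have -> : enorm (0 : 'rV[R]_n) = 0.
  by apply/eqP; rewrite -(scale0r (0 : 'rV[R]_n)) enormZ normr0 mul0r.
by rewrite add0r ler_pM2l// enorm_lem.
Qed.

(** The partial differentials are only controlled on U, hence the increment is
    split into an x-step and a u-step, each staying in the admissible set. *)
Lemma field_taylor i (t : R) x u dx du j : 0 <= t <= 1 -> U u -> U (u + du) ->
  `|(vfield P i t (x + dx) (u + du) - vfield P i t x u -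
     ('d (fun y => vfield P i t y u) x dx +
      'd (fun v => vfield P i t x v) u du)) ord0 j| <=
  L * dimc ^+ 2 * (`|dx| + `|du|) ^+ 2.
Proof.
move=> t01 Uu Uud; case: (P_ok) => _ /(_ i)[difx difu _] _ _.
pose f := vfield P i t.
pose Dx v y := 'd (fun y => f y v) y dx ord0 j.
pose Du v := 'd (fun v => f x v) v du ord0 j.
have A : `|f (x + 1 *: dx) (u + du) ord0 j - f (x + 0 *: dx) (u + du) ord0 j -
    Dx (u + du) (x + 0 *: dx)| <= L * dimc ^+ 2 * `|dx| * `|dx|.
  apply: (@taylor1 _ (fun r => f (x + r *: dx) (u + du) ord0 j)
    (fun r => Dx (u + du) (x + r *: dx))) => [s|s /andP[s0 s1]].
    by apply: (is_derive_line_coord (f := fun y => f y (u + du))); exact: difx.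
  have := @field_dx_lipschitz i t (x + s *: dx) (x + 0 *: dx) (u + du) (u + du)
    dx j t01 Uud Uud.
  rewrite !mxE => /le_trans; apply; rewrite subrr normr0 addr0 scale0r addr0.
  rewrite ler_wpM2r// ler_wpM2l ?mulr_ge0 ?exprn_ge0 ?(ltW L0)//.
  by rewrite addrC addKr normrZ ger0_norm// ler_piMl.
have B : `|Dx (u + du) x - Dx u x| <= L * dimc ^+ 2 * `|du| * `|dx|.
  have := @field_dx_lipschitz i t x x (u + du) u dx j t01 Uud Uu.
  rewrite !mxE => /le_trans; apply.
  by rewrite subrr normr0 add0r [u + du]addrC addrK.
have C : `|f x (u + 1 *: du) ord0 j - f x (u + 0 *: du) ord0 j -
    Du (u + 0 *: du)| <= L * dimc ^+ 2 * `|du| * `|du|.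
  apply: (@taylor1 _ (fun r => f x (u + r *: du) ord0 j)
    (fun r => Du (u + r *: du))) => [s|s /andP[s0 s1]].
    by apply: (is_derive_line_coord (f := fun v => f x v)); exact: difu.
  have Us : U (u + s *: du).
    have := @inputs_seg u (u + du) s Uu Uud; rewrite /seg [u + du]addrC addrK.
    by apply; rewrite s0.
  have U0 : U (u + 0 *: du) by rewrite scale0r addr0.
  have := @field_du_lipschitz i t x (u + s *: du) (u + 0 *: du)
    du j t01 Us U0.
  rewrite !mxE => /le_trans; apply; rewrite scale0r addr0.
  rewrite ler_wpM2r// ler_wpM2l ?mulr_ge0 ?exprn_ge0 ?(ltW L0)//.
  by rewrite addrC addKr normrZ ger0_norm// ler_piMl.
rewrite !scale1r !scale0r !addr0 in A C.
have c0 : 0 <= L * dimc ^+ 2 * (`|dx| * `|du|).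
  by rewrite !mulr_ge0 ?exprn_ge0 ?(ltW L0).
rewrite ![in leLHS]mxE -[vfield P i t]/f -[X in _ - (X + _)]/(Dx u x).
rewrite -[X in _ - (_ + X)]/(Du u).
move: (f (x + dx) (u + du) ord0 j) (f x (u + du) ord0 j) (f x u ord0 j)
  (Dx (u + du) x) (Dx u x) (Du u) A B C => a b d p r w A B C.
have -> : a - d - (r + w) = (a - b - p) + (p - r) + (b - d - w) by ring.
apply: (le_trans (ler_normD _ _)); apply: (le_trans (lerD (ler_normD _ _) C)).
apply: (le_trans (lerD (lerD A B) (lexx _))).
rewrite -subr_ge0; apply: le_trans c0 _; rewrite le_eqVlt; apply/orP; left.
by apply/eqP; ring.
Qed.

(** The first-order term is the same along the segment at s and at 1 up to the
    factor s, so it cancels against the chord. *)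
Lemma field_second i (t : R) x0 x1 u0 u1 (s : R) :
  0 <= t <= 1 -> U u0 -> U u1 -> 0 <= s <= 1 ->
  `|vfield P i t (seg s x0 x1) (seg s u0 u1) -
    seg s (vfield P i t x0 u0) (vfield P i t x1 u1)| <=
  2 * L * dimc ^+ 2 * s * (`|x1 - x0| + `|u1 - u0|) ^+ 2.
Proof.
move=> t01 hu0 hu1 /andP[s0 s1].
have c0 : 0 <= L * dimc ^+ 2 * (`|x1 - x0| + `|u1 - u0|) ^+ 2.
  by rewrite !mulr_ge0 ?exprn_ge0 ?addr_ge0 ?(ltW L0).
apply: norm_le_coord => [|j].
  by rewrite !mulr_ge0 ?exprn_ge0 ?addr_ge0 ?(ltW L0).
have hs : U (u0 + s *: (u1 - u0)) by apply: inputs_seg => //; rewrite s0.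
have h1 : U (u0 + (u1 - u0)) by rewrite addrC subrK.
have Es := @field_taylor i t x0 u0 (s *: (x1 - x0)) (s *: (u1 - u0)) j t01 hu0 hs.
have E1 := @field_taylor i t x0 u0 (x1 - x0) (u1 - u0) j t01 hu0 h1.
move: Es E1; rewrite !linearZZ ![_ + (_ - _)]addrC !subrK.
rewrite !normrZ (ger0_norm s0) -mulrDr exprMn /seg ![in X in X -> _]mxE.
rewrite ![in X in _ -> X -> _]mxE ![in X in _ -> _ -> X]mxE.
move: ('d (fun y => vfield P i t y u0) x0 (x1 - x0) ord0 j)
  ('d (fun v => vfield P i t x0 v) u0 (u1 - u0) ord0 j) => p w.
set a := vfield P i t _ _ ord0 j.
set b := vfield P i t x0 u0 ord0 j; set d := vfield P i t x1 u1 ord0 j.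
move=> Es E1.
have -> : a - (b + s * (d - b)) = (a - b - (s * p + s * w)) -
  s * (d - b - (p + w)) by ring.
apply: (le_trans (ler_normB _ _)); rewrite normrM (ger0_norm s0).
apply: (le_trans (lerD Es (ler_wpM2l s0 E1))).
have : s ^+ 2 <= s by rewrite expr2 ler_piMl.
move=> /(ler_wpM2l c0); lra.
Qed.

Lemma diff_lipschitz_lip (h : 'rV[R]_n -> R) x y : diff_lipschitz L h ->
  `|h x - h y| <= L * dimc * `|x - y|.
Proof.
move=> [_ /(_ x y)[hl _]]; apply: (le_trans hl).
by rewrite -mulrA ler_pM2l// enorm_len.
Qed.

Lemma diff_lipschitz_second (h : 'rV[R]_n -> R) x0 x1 (s : R) :
  diff_lipschitz L h -> 0 <= s <= 1 ->
  `|h (seg s x0 x1) - ((1 - s) * h x0 + s * h x1)| <=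
  2 * L * dimc ^+ 2 * s * `|x1 - x0| ^+ 2.
Proof.
move=> [dh hl] /andP[s0 s1].
have taylor dx : `|h (x0 + dx) - h x0 - 'd h x0 dx| <= L * dimc ^+ 2 * `|dx| ^+ 2.
  have := @taylor1 R (fun r => h (x0 + r *: dx))
    (fun r => 'd h (x0 + r *: dx) dx) (L * dimc ^+ 2 * `|dx| ^+ 2).
  rewrite !scale1r !scale0r !addr0; apply => [s'|s' /andP[s'0 s'1]].
    exact: is_derive_line.
  have [_ opn] := hl (x0 + s' *: dx) x0.
  have normZ (a w : R^o) : `|a *: w| = `|a| * `|w| by exact: normrM.
  have nle (w : R^o) : `|w| <= 1 * `|w| by rewrite mul1r.
  have := @opnorm2_diff_bound R n R^o Num.norm 1 h h _ _ normZ nle ler01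
    (dh (x0 + s' *: dx)) (dh x0) dx.
  move=> /le_trans; apply; apply: (@le_trans _ _
    (L * (dimc * `|dx|) * (dimc * `|dx|))); last first.
    by rewrite le_eqVlt; apply/orP; left; apply/eqP; ring.
  apply: ler_pM; rewrite ?enorm_ge0//; last exact: enorm_len.
    by apply: sup_ge0 => _ [v _ <-]; exact: normr_ge0.
  apply: (le_trans opn); rewrite ler_pM2l// addrC addKr.
  apply: (le_trans (enorm_len _)); rewrite ler_wpM2l//.
  by rewrite normrZ ger0_norm// ler_piMl.
have Es := taylor (s *: (x1 - x0)); have E1 := taylor (x1 - x0).
rewrite ['d h x0 (s *: _)]linearZZ normrZ (ger0_norm s0) exprMn in Es.
rewrite ![_ + (_ - _)]addrC !subrK in E1.
have c0 : 0 <= L * dimc ^+ 2 * `|x1 - x0| ^+ 2.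
  by rewrite !mulr_ge0 ?exprn_ge0 ?(ltW L0).
move: Es E1; rewrite /seg; set a := h (x0 + _); set p := 'd h x0 _ => Es E1.
have {}Es : `|a - h x0 - s * p| <=
  L * dimc ^+ 2 * (s ^+ 2 * `|x1 - x0| ^+ 2) := Es.
have -> : a - ((1 - s) * h x0 + s * h x1) =
  (a - h x0 - s * p) - s * (h x1 - h x0 - p) by ring.
apply: (le_trans (ler_normB _ _)); rewrite normrM (ger0_norm s0).
apply: (le_trans (lerD Es (ler_wpM2l s0 E1))).
have : s ^+ 2 <= s by rewrite expr2 ler_piMl.
move=> /(ler_wpM2l c0); lra.
Qed.

End SecondOrder.

(** * Controls, trajectories and directional derivatives *)

Section Simplex.
Context {R : realType} {q : nat}.

Lemma simplex_norm (d : 'rV[R]_q) : simplexr d -> `|d| <= 1.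
Proof.
move=> [d01 _]; apply: norm_le_coord => // i.
by have /andP[d0 d1] := d01 i; rewrite ger0_norm.
Qed.

Lemma simplex_sum (V : normedModType R) (d : 'rV[R]_q) (v : 'I_q -> V) (c : R) :
  simplexr d -> (forall i, `|v i| <= c) ->
  `|\sum_(i < q) d ord0 i *: v i| <= c.
Proof.
move=> [d01 d1] vc; apply: (le_trans (ler_norm_sum _ _ _)).
rewrite -[leRHS]mul1r -d1 mulr_suml; apply: ler_sum => i _.
have /andP[d0 _] := d01 i.
by rewrite normrZ ger0_norm// ler_wpM2l.
Qed.

Lemma simplexp_simplexr (d : 'rV[R]_q) : simplexp d -> simplexr d.
Proof.
move=> [i ->]; split=> [j|].
  by rewrite mxE eqxx; case: eqP => _ /=; rewrite lexx ler01.
rewrite (bigD1 i)//= big1 => [|j ji]; rewrite mxE ?eqxx ?addr0//.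
by rewrite (negbTE ji).
Qed.

Lemma simplex_seg (a b : 'rV[R]_q) (s : R) : simplexr a -> simplexr b ->
  0 <= s <= 1 -> simplexr (seg s a b).
Proof.
move=> [a01 a1] [b01 b1] /andP[s0 s1]; split=> [i|].
  have /andP[a0 a_1] := a01 i; have /andP[b0 b_1] := b01 i.
  rewrite segE !mxE; apply/andP; split.
    by rewrite addr_ge0// mulr_ge0// subr_ge0.
  rewrite -[leRHS](subrK s); apply: lerD; last exact: ler_piMr.
  by rewrite ler_piMr// subr_ge0.
under eq_bigr do rewrite segE !mxE.
by rewrite big_split/= -!mulr_sumr a1 b1 !mulr1 subrK.
Qed.

End Simplex.

Section BoundedVariationControls.
Context {R : realType}.

Definition bvv k (w : R -> 'rV[R]_k) := forall i, bv (fun t => w t ord0 i).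

Lemma bvv_bmeasv k (w : R -> 'rV[R]_k) : bvv w -> bmeasv w.
Proof. by move=> bw i; exact: bv_bmeas. Qed.

Lemma L2BVP k (S : set 'rV[R]_k) w :
  L2BV S w <-> (forall t, 0 <= t <= 1 -> S (w t)) /\ bvv w.
Proof.
split=> [[Sw _ _ bw]|[Sw bw]].
  by split=> // i; exact/bounded_variation_majorant.
split=> //.
- by move=> i; case: (bv_bmeas (bw i)).
- have -> : (fun t => (enorm (w t) ^+ 2)%:E) =
      EFin \o (fun t => \sum_(i < k) w t ord0 i * w t ord0 i).
    apply/funext => t /=; rewrite /enorm sqr_sqrtr; last first.
      by apply: sumr_ge0 => i _; exact: sqr_ge0.
    by congr _%:E; apply: eq_bigr => i _; rewrite expr2.
  apply: bmeas_integrable => //; apply: bmeas_sum => i.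
  by apply: bmeasM; exact: bv_bmeas.
- by move=> i; have [V wV] := bw i; exact: majorant_bounded_variation wV.
Qed.

End BoundedVariationControls.

Section Trajectories.
Context {R : realType} {n m q Nc : nat}.
Variables (P : problem R n m q Nc) (L : R).
Hypotheses (L0 : 0 < L) (P_ok : problem_ok P L).
Local Notation U := (inputs P).
Local Notation ctl := (control R m q).
Local Notation c := (@dimc R n m).
Implicit Types xi eta : ctl.

Let K := L * c.
Let K0 : 0 < K.
Proof. by rewrite mulr_gt0// ltr0n. Qed.

Definition admissible xi :=
  [/\ forall t, 0 <= t <= 1 -> U (xi.1 t),
      forall t, 0 <= t <= 1 -> simplexr (xi.2 t), bvv xi.1 & bvv xi.2].

Lemma XrP xi : Xr P xi <-> admissible xi.
Proof.
by split=> [[/L2BVP[? ?] /L2BVP[? ?]]|[? ? ? ?]]; split=> //; apply/L2BVP.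
Qed.

Lemma Xp_Xr xi : Xp P xi -> Xr P xi.
Proof.
move=> [h /L2BVP[hs hb]]; split=> //; apply/L2BVP; split=> // t t01.
exact/simplexp_simplexr/hs.
Qed.

Lemma seg_fst (s : R) xi eta t : (seg s xi eta).1 t = seg s (xi.1 t) (eta.1 t).
Proof. by []. Qed.

Lemma seg_snd (s : R) xi eta t : (seg s xi eta).2 t = seg s (xi.2 t) (eta.2 t).
Proof. by []. Qed.

Lemma bvv_seg k (v w : R -> 'rV[R]_k) (s : R) :
  bvv v -> bvv w -> bvv (fun t => seg s (v t) (w t)).
Proof.
move=> bv_ bw i; apply: (@eq_bv _ (fun t => v t ord0 i +
    s * (w t ord0 i - v t ord0 i))).
  by move=> t _; rewrite !mxE.
by apply: bvD => //; apply: bvZ; exact: bvB.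
Qed.

Lemma admissible_seg (s : R) xi eta : admissible xi -> admissible eta ->
  0 <= s <= 1 -> admissible (seg s xi eta).
Proof.
move=> [u1 d1 bu1 bd1] [u2 d2 bu2 bd2] s01; split.
- move=> t t01; rewrite seg_fst; apply: (inputs_seg P_ok) => //.
    exact: u1.
  exact: u2.
- by move=> t t01; rewrite seg_snd; apply: simplex_seg; [exact: d1|exact: d2|].
- exact: bvv_seg.
- exact: bvv_seg.
Qed.

Lemma rhs_lipschitz (t : R) x1 x2 u1 u2 d : 0 <= t <= 1 -> U u1 -> U u2 ->
  simplexr d ->
  `|rhs P t x1 u1 d - rhs P t x2 u2 d| <= K * (`|x1 - x2| + `|u1 - u2|).
Proof.
move=> t01 hu1 hu2 hd; rewrite /rhs -sumrB.
under eq_bigr do rewrite -scalerBr.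
apply: simplex_sum => // i.
have := field_lipschitz L0 P_ok i x1 x2 t01 t01 hu1 hu2.
by rewrite subrr normr0 add0r.
Qed.

Lemma rhs_lipschitz_state (t : R) x1 x2 u d : 0 <= t <= 1 -> U u -> simplexr d ->
  `|rhs P t x1 u d - rhs P t x2 u d| <= K * `|x1 - x2|.
Proof.
move=> t01 hu hd; apply: (le_trans (rhs_lipschitz _ _ t01 hu hu hd)).
by rewrite [u - u]subrr normr0 addr0.
Qed.

Lemma field_bounded : exists2 M : R, 0 < M & forall i (t : R) x u,
  0 <= t <= 1 -> U u -> `|vfield P i t x u| <= M * (1 + `|x|).
Proof.
have [B B0 UB] := inputs_bounded P_ok.
have [[u0 Uu0]|nU] := pselect (exists u, U u); last first.
  by exists 1 => // i t x u _ Uu; exfalso; apply: nU; exists u.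
pose S := \sum_(i < q) `|vfield P i 0 0 u0|.
have S0 : 0 <= S by exact: sumr_ge0.
exists (S + K * (1 + 2 * B)); first by rewrite ltr_wpDl// mulr_gt0// ltr_wpDr// mulr_ge0.
move=> i t x u t01 Uu.
have z01 : 0 <= (0 : R) <= 1 by rewrite lexx ler01.
have := field_lipschitz L0 P_ok i x 0 t01 z01 Uu Uu0.
have Si : `|vfield P i 0 0 u0| <= S.
  by rewrite /S (bigD1 i)//= lerDl sumr_ge0.
rewrite !subr0 => fl.
have -> : vfield P i t x u =
    (vfield P i t x u - vfield P i 0 0 u0) + vfield P i 0 0 u0 by rewrite subrK.
apply: (le_trans (ler_normD _ _)); apply: (le_trans (lerD fl Si)).
have tt : `|t| <= 1 by case/andP: t01 => t0 t1; rewrite ger0_norm.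
have uu : `|u - u0| <= 2 * B.
  apply: (le_trans (ler_normB _ _)).
  by rewrite mulr_natl mulr2n lerD// UB.
have x0 : 0 <= `|x| by [].
have h1 : K * (`|t| + `|x| + `|u - u0|) <= K * (1 + `|x| + 2 * B).
  by rewrite ler_pM2l// lerD// lerD.
rewrite -/K; apply: (le_trans (lerD h1 (lexx _))).
have : 0 <= S * `|x| + K * (2 * B * `|x|).
  by rewrite addr_ge0// mulr_ge0// ?mulr_ge0// ltW.
by move: (`|x|) => X; lra.
Qed.

Lemma rhs_bounded : exists2 M : R, 0 < M & forall (t : R) x u d,
  0 <= t <= 1 -> U u -> simplexr d -> `|rhs P t x u d| <= M * (1 + `|x|).
Proof.
have [M M0 fM] := field_bounded; exists M => // t x u d t01 Uu hd.
by apply: simplex_sum => // i; exact: fM.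
Qed.

Lemma field_bmeasv xi x i : admissible xi -> bmeasv x ->
  bmeasv (fun t => vfield P i t (x t) (xi.1 t)).
Proof.
move=> [Uxi _ /bvv_bmeasv bu _] bx j.
have [M M0 fM] := field_bounded; split; last first.
  have [B xB] := (bmeasv_norm bx).2; exists (M * (1 + B)) => t t01.
  apply: (le_trans (coord_le_norm _ _)); apply: (le_trans (fM i t _ _ t01 (Uxi t t01))).
  rewrite ler_pM2l// lerD2l; apply: le_trans (xB t t01).
  by rewrite normr_id.
pose w (k : (unit + 'I_n + 'I_m)%type) (t : R) : R := match k with
  | inl (inl _) => t | inl (inr k) => x t ord0 k | inr k => xi.1 t ord0 k end.
apply: (measurable_of_coordinates (w := w)) => [[[[]|k]|k]|t].
- exact: measurable_id.
- by case: (bx k).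
- by case: (bu k).
rewrite /= in_itv/= => t01 e e0.
exists (e / (4 * K)); first by rewrite divr_gt0// mulr_gt0.
move=> s; rewrite /= in_itv/= => s01 wst.
have e4 : 0 <= e / (4 * K) by rewrite divr_ge0// ?mulr_ge0// ltW.
have xst : `|x s - x t| <= e / (4 * K).
  apply: norm_le_coord => // k.
  by have := wst (inl (inr k)); rewrite !mxE => /ltW.
have ust : `|xi.1 s - xi.1 t| <= e / (4 * K).
  apply: norm_le_coord => // k.
  by have := wst (inr k); rewrite !mxE => /ltW.
have tst : `|s - t| <= e / (4 * K) by have /ltW := wst (inl (inl tt)).
have := field_lipschitz L0 P_ok i (x s) (x t) s01 t01 (Uxi s s01) (Uxi t t01).
have := coord_le_norm (vfield P i s (x s) (xi.1 s) -
  vfield P i t (x t) (xi.1 t)) j.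
rewrite !mxE => /le_trans/[apply] /le_lt_trans; apply.
apply: (@le_lt_trans _ _ (K * (e / (4 * K) * 3))).
  by rewrite -/K ler_pM2l//; lra.
have -> : K * (e / (4 * K) * 3) = e * (3 / 4) by field; rewrite gt_eqF.
by rewrite gtr_pMr//; lra.
Qed.

Lemma rhs_bmeasv xi eta x : admissible xi -> admissible eta -> bmeasv x ->
  bmeasv (fun t => rhs P t (x t) (xi.1 t) (eta.2 t)).
Proof.
move=> axi [_ _ _ bd] bx j; rewrite /rhs.
under eq_fun do rewrite summxE; under eq_fun do under eq_bigr do rewrite mxE.
apply: bmeas_sum => i; apply: bmeasM; first exact: bv_bmeas.
exact: (field_bmeasv i axi bx).
Qed.

Definition velocity xi (x : R -> 'rV[R]_n) (t : R) :=
  rhs P t (x t) (xi.1 t) (xi.2 t).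

Lemma velocity_bmeasv xi x : admissible xi -> bmeasv x -> bmeasv (velocity xi x).
Proof. by move=> axi bx; exact: rhs_bmeasv. Qed.

Local Notation traj := (trajectory P).

(** The choice made in [trajectory] is a solution because Picard's theorem
    provides one. *)
Lemma trajectory_solution xi : admissible xi -> is_solution P xi (traj xi).
Proof.
move=> axi; have [Uxi dxi _ _] := axi; have [M M0 rM] := rhs_bounded.
have [x [cx xE]] : exists x : R -> 'rV[R]_n, {within `[0, 1], continuous x} /\
    forall t, 0 <= t <= 1 -> x t = xinit P + vint t (velocity xi x).
  apply: (@picard R n (fun t x => rhs P t x (xi.1 t) (xi.2 t)) K M) => //.
  - exact: ltW.
  - move=> t t01 x y.
    exact: (rhs_lipschitz_state x y t01 (Uxi t t01) (dxi t t01)).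
  - by move=> t t01 x; apply: rM => //; [exact: Uxi|exact: dxi].
  - by move=> x; exact: velocity_bmeasv.
apply: (@xgetPex _ (fun=> 0) [set x | is_solution P xi x]).
by exists x; split=> // t t01 i; rewrite xE// !mxE.
Qed.

Lemma trajectory_bmeasv xi : admissible xi -> bmeasv (traj xi).
Proof. by move=> /trajectory_solution[cx _]; exact: continuous01_bmeasv. Qed.

Lemma trajectoryE xi (t : R) : admissible xi -> 0 <= t <= 1 ->
  traj xi t = xinit P + vint t (velocity xi (traj xi)).
Proof.
move=> /trajectory_solution[_ xE] t01; apply/rowP => i.
by rewrite xE// !mxE.
Qed.

Lemma trajectory_bounded : exists2 B : R, 0 <= B & forall xi, admissible xi ->
  forall t : R, 0 <= t <= 1 -> `|traj xi t| <= B.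
Proof.
have [M M0 rM] := rhs_bounded.
exists (2 * (`|xinit P| + M) * weight M 1).
  by rewrite !mulr_ge0 ?addr_ge0 ?(ltW M0)//; exact/ltW/weight_gt0.
move=> xi axi t t01.
have bx := trajectory_bmeasv axi; have [Uxi dxi _ _] := axi.
have bnx := bmeasv_norm bx.
have gr := @gronwall R M M0 (fun t => `|traj xi t|) (`|xinit P| + M) bnx.
apply: gr t01; first by rewrite addr_ge0// ltW.
move=> {}t t01; have /andP[t0 t1] := t01; rewrite {1}trajectoryE//.
apply: (le_trans (ler_normD _ _)); rewrite -addrA lerD2l.
apply: (le_trans (vint_le t1 (velocity_bmeasv axi bx))).
have bM : bmeas (fun s => M + M * `|traj xi s|).
  by apply: bmeasD; [exact: bmeas_cst | exact: bmeasZ].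
apply: (@le_trans _ _ (intR 0 t (fun s => M + M * `|traj xi s|))).
  apply: le_intR => //; first exact/bmeasv_norm/velocity_bmeasv.
  move=> s /andP[s0 st]; have s01 : 0 <= s <= 1 by rewrite s0 (le_trans st t1).
  apply: (le_trans (rM _ _ _ _ s01 (Uxi s s01) (dxi s s01))).
  by rewrite mulrDr mulr1.
rewrite intRD//; [|exact: bmeas_cst|exact: bmeasZ].
by rewrite intRZ// intR_cst// subr0 lerD2r ler_piMr// ltW.
Qed.

Lemma velocity_bounded : exists2 B : R, 0 <= B & forall xi eta, admissible xi ->
  admissible eta -> forall t : R, 0 <= t <= 1 ->
  `|velocity eta (traj xi) t| <= B /\
  forall i, `|vfield P i t (traj xi t) (eta.1 t)| <= B.
Proof.
have [M M0 fM] := field_bounded; have [B B0 tB] := trajectory_bounded.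
exists (M * (1 + B)); first by rewrite mulr_ge0 ?(ltW M0) ?addr_ge0.
move=> xi eta axi [Uxi dxi _ _] t t01.
have fb i : `|vfield P i t (traj xi t) (eta.1 t)| <= M * (1 + B).
  apply: (le_trans (fM i t _ _ t01 (Uxi t t01))).
  by rewrite ler_pM2l// lerD2l tB.
by split=> //; apply: simplex_sum => //; exact: dxi.
Qed.

Lemma trajectory_lipschitz : exists2 B : R, 0 <= B & forall xi, admissible xi ->
  lipschitz01 B (traj xi).
Proof.
have [B B0 vB] := velocity_bounded; exists B => // xi axi s t s0 st t1.
rewrite !trajectoryE ?s0 ?t1 ?(le_trans s0 st) ?(le_trans st t1)//.
apply: vint_lipschitz => //.
  by apply: velocity_bmeasv => //; exact: trajectory_bmeasv.
by move=> r r01; have [] := vB xi xi axi axi r r01.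
Qed.

(** Stability is measured by the integral of the perturbation of the velocity
    along a fixed trajectory, not by its size: this is what makes trajectories
    insensitive to fast switching. *)
Lemma trajectory_stable xi eta (b : R) : admissible xi -> admissible eta ->
  0 <= b ->
  (forall t, 0 <= t <= 1 ->
    `|vint t (fun s => velocity eta (traj xi) s - velocity xi (traj xi) s)| <= b) ->
  forall t, 0 <= t <= 1 -> `|traj eta t - traj xi t| <= 2 * b * weight K 1.
Proof.
move=> axi aeta b0 Eb.
have bx := trajectory_bmeasv axi; have by_ := trajectory_bmeasv aeta.
have [Ueta deta _ _] := aeta.
have bz : bmeasv (fun t => traj eta t - traj xi t) by exact: bmeasvB.
apply: (gronwall K0 (bmeasv_norm bz) b0) => t t01; have /andP[t0 t1] := t01.
rewrite (trajectoryE aeta)// (trajectoryE axi)// opprD addrACA subrr add0r.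
have tri (a d e : 'rV[R]_n) : a - d = (e - d) + (a - e).
  by rewrite [RHS]addrC addrA subrK.
rewrite (tri _ _ (vint t (velocity eta (traj xi)))).
apply: (le_trans (ler_normD _ _)).
have bv1 := velocity_bmeasv aeta by_; have bv2 := velocity_bmeasv aeta bx.
have bv3 := velocity_bmeasv axi bx.
apply: lerD; first by rewrite (vintB t1 bv2 bv3); exact: Eb.
rewrite (vintB t1 bv1 bv2).
have bd : bmeasv (fun s => velocity eta (traj eta) s - velocity eta (traj xi) s).
  exact: bmeasvB.
apply: (le_trans (vint_le t1 bd)).
rewrite -intRZ//; last exact: bmeasv_norm.
apply: le_intR => //; [exact: bmeasv_norm | by apply: bmeasZ; exact: bmeasv_norm |].
move=> s /andP[s0 st]; have s01 : 0 <= s <= 1 by rewrite s0 (le_trans st t1).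
exact: (rhs_lipschitz_state _ _ s01 (Ueta s s01) (deta s s01)).
Qed.

End Trajectories.

Section Variations.
Context {R : realType} {n m q Nc : nat}.
Variables (P : problem R n m q Nc) (L : R).
Hypotheses (L0 : 0 < L) (P_ok : problem_ok P L).
Local Notation U := (inputs P).
Local Notation ctl := (control R m q).
Local Notation c := (@dimc R n m).
Local Notation traj := (trajectory P).
Local Notation admissible := (admissible P).
Local Notation velocity := (velocity P).
Implicit Types xi eta : ctl.

Let K := L * c.
Let K0 : 0 < K.
Proof. by rewrite mulr_gt0// ltr0n. Qed.

(** The right-hand side is bilinear in d and in the fields, hence its remainder
    is d times the remainder of the fields plus a product of two first-order
    increments. *)
Lemma rhs_second (t : R) x0 x1 u0 u1 d0 d1 (s : R) :
  0 <= t <= 1 -> U u0 -> U u1 -> simplexr d0 -> simplexr d1 -> 0 <= s <= 1 ->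
  `|rhs P t (seg s x0 x1) (seg s u0 u1) (seg s d0 d1) -
    seg s (rhs P t x0 u0 d0) (rhs P t x1 u1 d1)| <=
  s * (2 * L * c ^+ 2 * (`|x1 - x0| + `|u1 - u0|) ^+ 2 +
       q%:R * (`|d1 - d0| * (K * (`|x1 - x0| + `|u1 - u0|)))).
Proof.
move=> t01 hu0 hu1 hd0 hd1 s01; have /andP[s0 s1] := s01.
pose fs i := vfield P i t (seg s x0 x1) (seg s u0 u1).
pose f0 i := vfield P i t x0 u0; pose f1 i := vfield P i t x1 u1.
have hus := inputs_seg P_ok hu0 hu1 s01.
have -> : rhs P t (seg s x0 x1) (seg s u0 u1) (seg s d0 d1) -
    seg s (rhs P t x0 u0 d0) (rhs P t x1 u1 d1) =
    \sum_(i < q) d0 ord0 i *: (fs i - seg s (f0 i) (f1 i)) +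
    s *: \sum_(i < q) (d1 - d0) ord0 i *: (fs i - f1 i).
  rewrite [seg s (rhs _ _ _ _ _) _]segE /rhs !scaler_sumr -!big_split/= -sumrB.
  apply: eq_bigr => i _; rewrite -/(fs i) -/(f0 i) -/(f1 i).
  move: (fs i) (f0 i) (f1 i) => a b e.
  by apply/rowP => j; rewrite /seg !mxE; ring.
rewrite mulrDr; apply: (le_trans (ler_normD _ _)); apply: lerD.
  apply: simplex_sum => // i; apply: (le_trans (field_second L0 P_ok i x0 x1 t01 hu0 hu1 s01)).
  by rewrite le_eqVlt; apply/orP; left; apply/eqP; ring.
rewrite normrZ (ger0_norm s0) ler_wpM2l//.
apply: (le_trans (ler_norm_sum _ _ _)).
apply: (@le_trans _ _ (\sum_(i < q) `|d1 - d0| * (K * (`|x1 - x0| + `|u1 - u0|)))).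
  apply: ler_sum => i _; rewrite normrZ; apply: ler_pM => //.
    exact: coord_le_norm.
  have := field_lipschitz L0 P_ok i (seg s x0 x1) x1 t01 t01 hus hu1.
  rewrite [t - t]subrr normr0 add0r => /le_trans; apply.
  have seg1_dist (V : normedModType R) (a b : V) : `|seg s a b - b| <= `|b - a|.
    have -> : seg s a b - b = (s - 1) *: (b - a).
      by rewrite /seg scalerBl scale1r opprB [a + _]addrC addrA.
    rewrite normrZ distrC ger0_norm ?subr_ge0// ler_piMl// gerBl//.
  by rewrite ler_pM2l//; apply: lerD; exact: seg1_dist.
by rewrite sumr_const card_ord mulr_natl.
Qed.

Lemma vint_seg (t s : R) (F G : R -> 'rV[R]_n) : t <= 1 -> bmeasv F -> bmeasv G ->
  seg s (vint t F) (vint t G) = vint t (fun r => seg s (F r) (G r)).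
Proof.
move=> t1 bF bG; apply/rowP => i; rewrite /seg !mxE -intRB// -intRZ//; last first.
  exact: bmeasB.
rewrite -intRD//; last by apply: bmeasZ; exact: bmeasB.
by apply: eq_intR => r _; rewrite !mxE.
Qed.

Lemma bmeasv_seg (s : R) (F G : R -> 'rV[R]_n) : bmeasv F -> bmeasv G ->
  bmeasv (fun r => seg s (F r) (G r)).
Proof.
by move=> bF bG; apply: bmeasvD => //; apply: bmeasvZ; exact: bmeasvB.
Qed.

Lemma control_dist : exists2 B : R, 0 <= B & forall xi eta, admissible xi ->
  admissible eta -> forall t : R, 0 <= t <= 1 ->
  `|eta.1 t - xi.1 t| <= B /\ `|eta.2 t - xi.2 t| <= 2.
Proof.
have [B B0 UB] := inputs_bounded P_ok; exists (2 * B); first exact: mulr_ge0.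
move=> xi eta [Uxi dxi _ _] [Ueta deta _ _] t t01.
split; apply: (le_trans (ler_normB _ _)).
  by rewrite mulr_natl mulr2n lerD// UB//; [exact: Ueta|exact: Uxi].
rewrite (_ : 2 = 1 + 1 :> R)//.
by rewrite lerD// simplex_norm//; [exact: deta|exact: dxi].
Qed.

Lemma trajectory_seg_dist : exists2 C : R, 0 <= C & forall xi eta,
  admissible xi -> admissible eta -> forall l t : R, 0 <= l <= 1 -> 0 <= t <= 1 ->
  `|traj (seg l xi eta) t - traj xi t| <= C * l.
Proof.
have [B B0 uB] := control_dist; have [V V0 vV] := velocity_bounded L0 P_ok.
pose b := K * B + q%:R * (2 * V).
have b0 : 0 <= b by rewrite addr_ge0// !mulr_ge0// ltW.
exists (2 * b * weight K 1).
  by rewrite !mulr_ge0//; exact/ltW/weight_gt0.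
move=> xi eta axi aeta l t l01 t01; have /andP[l0 l1] := l01.
have al := admissible_seg P_ok axi aeta l01.
have bx := trajectory_bmeasv L0 P_ok axi.
rewrite -mulrA [_ * l]mulrC mulrA -[2 * b * l]mulrA.
apply: (trajectory_stable L0 P_ok axi al) t01; first exact: mulr_ge0.
move=> {}t t01; have /andP[t0 t1] := t01.
have bv1 := velocity_bmeasv L0 P_ok al bx; have bv2 := velocity_bmeasv L0 P_ok axi bx.
have bd := bmeasvB bv1 bv2.
apply: (le_trans (vint_le t1 bd)).
apply: (@le_trans _ _ (b * l * (t - 0))); last first.
  by rewrite subr0 ler_piMr// mulr_ge0.
rewrite -intR_cst//; apply: le_intR => //; first exact: bmeasv_norm.
  exact: bmeas_cst.
move=> s /andP[s0 st]; have s01 : 0 <= s <= 1 by rewrite s0 (le_trans st t1).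
have [Uxi dxi _ _] := axi; have [Ul dl _ _] := al.
have [ub db] := uB xi eta axi aeta s s01.
have [_ fV] := vV xi xi axi axi s s01.
rewrite /velocity.
have tri (a d e : 'rV[R]_n) : a - d = (a - e) + (e - d).
  by rewrite addrA subrK.
rewrite (tri _ _ (rhs P s (traj xi s) (xi.1 s) ((seg l xi eta).2 s))).
apply: (le_trans (ler_normD _ _)); rewrite mulrDl; apply: lerD.
  apply: (le_trans (rhs_lipschitz L0 P_ok _ _ s01 (Ul s s01) (Uxi s s01) (dl s s01))).
  rewrite -/K [traj xi s - _]subrr normr0 add0r -[leRHS]mulrA ler_pM2l// seg_fst seg_sub.
  by rewrite normrZ (ger0_norm l0) mulrC ler_wpM2r.
rewrite /rhs -sumrB; apply: (le_trans (ler_norm_sum _ _ _)).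
apply: (@le_trans _ _ (\sum_(i < q) 2 * V * l)); last first.
  by rewrite sumr_const card_ord -[leRHS]mulrA mulr_natl mulr_natl -mulrnAl.
apply: ler_sum => i _; rewrite -scalerBl normrZ mulrAC.
apply: ler_pM => //.
have := coord_le_norm ((seg l xi eta).2 s - xi.2 s) i.
rewrite !mxE => /le_trans; apply; rewrite seg_snd seg_sub normrZ (ger0_norm l0).
by rewrite mulrC ler_wpM2r.
Qed.

(** The deviation from the chord solves an integral equation whose source is the
    second-order remainder of the right-hand side; Gronwall's inequality
    transfers the order s l^2 from the source to the solution. *)
Lemma trajectory_second : exists2 C : R, 0 <= C & forall xi eta,
  admissible xi -> admissible eta -> forall s l t : R,
  0 <= s <= 1 -> 0 <= l <= 1 -> 0 <= t <= 1 ->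
  `|traj (seg (s * l) xi eta) t - seg s (traj xi t) (traj (seg l xi eta) t)| <=
  C * s * l ^+ 2.
Proof.
have [B B0 uB] := control_dist; have [C C0 tC] := trajectory_seg_dist.
pose b := 2 * L * c ^+ 2 * (C + B) ^+ 2 + q%:R * (2 * (K * (C + B))).
have c0 : 0 <= c := dimc_ge0.
have b0 : 0 <= b.
  by rewrite addr_ge0// ?mulr_ge0// ?exprn_ge0 ?addr_ge0 ?(ltW L0) ?(ltW K0).
exists (2 * b * weight K 1).
  by rewrite !mulr_ge0//; exact/ltW/weight_gt0.
move=> xi eta axi aeta s l t s01 l01 t01.
have /andP[l0 l1] := l01; have /andP[s0 s1] := s01.
have al := admissible_seg P_ok axi aeta l01.
rewrite -seg_seg; have as_ := admissible_seg P_ok axi al s01.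
set xs := seg s xi (seg l xi eta).
have bx := trajectory_bmeasv L0 P_ok axi.
have bxl := trajectory_bmeasv L0 P_ok al.
have bxs := trajectory_bmeasv L0 P_ok as_.
have bsg := bmeasv_seg s bx bxl.
pose r := b * s * l ^+ 2.
have r0 : 0 <= r by rewrite !mulr_ge0// exprn_ge0.
have -> : 2 * b * weight K 1 * s * l ^+ 2 = 2 * r * weight K 1.
  by rewrite /r; ring.
have bz := bmeasvB bxs bsg.
apply: (gronwall K0 (bmeasv_norm bz) r0) t01 => {}t t01; have /andP[t0 t1] := t01.
have v0 := velocity_bmeasv L0 P_ok axi bx.
have vl := velocity_bmeasv L0 P_ok al bxl.
have vs := velocity_bmeasv L0 P_ok as_ bxs.
have vsg := bmeasv_seg s v0 vl.
have combine (a d e x a' d' e' : 'rV[R]_n) : a = x + a' -> d = x + d' ->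
    e = x + e' -> a - seg s d e = a' - seg s d' e'.
  by move=> -> -> ->; apply/rowP => i; rewrite /seg !mxE; ring.
rewrite [leLHS](congr1 Num.norm (combine _ _ _ _ _ _ _
  (trajectoryE L0 P_ok as_ t01) (trajectoryE L0 P_ok axi t01)
  (trajectoryE L0 P_ok al t01))).
rewrite (vint_seg s t1 v0 vl) (vintB t1 vs vsg).
have bd := bmeasvB vs vsg.
apply: (le_trans (vint_le t1 bd)).
apply: (@le_trans _ _ (intR 0 t (fun s' => r + K *
    `|traj xs s' - seg s (traj xi s') (traj (seg l xi eta) s')|))); last first.
  rewrite intRD//; [|exact: bmeas_cst|by apply: bmeasZ; exact: bmeasv_norm].
  rewrite intRZ//; last exact: bmeasv_norm.
  by rewrite lerD2r intR_cst// subr0 ler_piMr.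
apply: le_intR => //; first exact: bmeasv_norm.
  by apply: bmeasD; [exact: bmeas_cst|apply: bmeasZ; exact: bmeasv_norm].
move=> s' /andP[s'0 s't]; have s'01 : 0 <= s' <= 1 by rewrite s'0 (le_trans s't t1).
have [Uxi dxi _ _] := axi; have [Ul dl _ _] := al; have [Us ds _ _] := as_.
have [ub db] := uB xi eta axi aeta s' s'01.
have tri (a d e : 'rV[R]_n) : a - d = (e - d) + (a - e).
  by rewrite [RHS]addrC addrA subrK.
rewrite (tri _ _ (velocity xs (fun r => seg s (traj xi r) (traj (seg l xi eta) r)) s')).
apply: (le_trans (ler_normD _ _)); apply: lerD; last first.
  exact: (rhs_lipschitz_state L0 P_ok _ _ s'01 (Us s' s'01) (ds s' s'01)).
apply: (le_trans (rhs_second _ _ s'01 (Uxi s' s'01) (Ul s' s'01) (dxi s' s'01)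
  (dl s' s'01) s01)).
have xb := tC xi eta axi aeta l s' l01 s'01.
have {}ub : `|(seg l xi eta).1 s' - xi.1 s'| <= B * l.
  by rewrite seg_fst seg_sub normrZ (ger0_norm l0) mulrC ler_wpM2r.
have {}db : `|(seg l xi eta).2 s' - xi.2 s'| <= 2 * l.
  by rewrite seg_snd seg_sub normrZ (ger0_norm l0) mulrC ler_wpM2r.
have -> : r = s * (2 * L * c ^+ 2 * (C * l + B * l) ^+ 2 +
    q%:R * (2 * l * (K * (C * l + B * l)))).
  by rewrite /r /b; ring.
have sum := lerD xb ub.
rewrite ler_wpM2l// lerD//.
  rewrite ler_wpM2l ?mulr_ge0 ?exprn_ge0 ?(ltW L0)//.
  rewrite lerXn2r// nnegrE ?addr_ge0//; exact: mulr_ge0.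
rewrite ler_wpM2l// ler_pM// ?ler_pM2l//.
by rewrite mulr_ge0 ?addr_ge0 ?(ltW K0).
Qed.

(** The second-order part of G along segments of controls, without naming its
    derivative.  From such a bound alone the difference quotients form a Cauchy
    family as the step decreases to 0, so that the directional derivative
    exists and comes with a uniform error; this replaces the analysis of the
    linearised equation. *)
Definition second_order (C : R) (G : ctl -> R) := forall xi eta,
  admissible xi -> admissible eta -> forall s l : R, 0 <= s <= 1 -> 0 <= l <= 1 ->
  `|G (seg (s * l) xi eta) - ((1 - s) * G xi + s * G (seg l xi eta))| <=
  C * s * l ^+ 2.

Lemma functional_second : exists2 C : R, 0 < C & forall h t,
  diff_lipschitz L h -> 0 <= t <= 1 -> second_order C (fun xi => h (phi P t xi)).
Proof.
have [C C0 tC] := trajectory_seg_dist; have [D D0 tD] := trajectory_second.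
have c0 : 0 <= c := dimc_ge0.
exists (K * D + 2 * L * c ^+ 2 * C ^+ 2 + 1).
  by rewrite ltr_wpDl// addr_ge0// !mulr_ge0// ?exprn_ge0 ?(ltW L0) ?(ltW K0).
move=> h t hh t01 xi eta axi aeta s l s01 l01; have /andP[s0 s1] := s01.
pose x := traj (seg (s * l) xi eta) t; pose x0 := traj xi t.
pose x1 := traj (seg l xi eta) t.
have e1 : `|x - seg s x0 x1| <= D * s * l ^+ 2.
  exact: (tD xi eta axi aeta s l t s01 l01 t01).
have e2 : `|x1 - x0| <= C * l by exact: (tC xi eta axi aeta l t l01 t01).
change (`|h x - ((1 - s) * h x0 + s * h x1)| <=
  (K * D + 2 * L * c ^+ 2 * C ^+ 2 + 1) * s * l ^+ 2).
have tri (a d e : R) : a - d = (a - e) + (e - d) by rewrite addrA subrK.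
rewrite (tri _ _ (h (seg s x0 x1))); apply: (le_trans (ler_normD _ _)).
have h1 := @diff_lipschitz_lip R n m L L0 h x (seg s x0 x1) hh.
have h2 := @diff_lipschitz_second R n m L L0 h x0 x1 s hh s01.
apply: (le_trans (lerD h1 h2)).
have k1 := ler_wpM2l (ltW K0) e1.
have k2 : `|x1 - x0| ^+ 2 <= (C * l) ^+ 2.
  by rewrite lerXn2r// nnegrE// mulr_ge0//; case/andP: l01.
have k3 : 0 <= 2 * L * c ^+ 2 * s.
  by rewrite !mulr_ge0 ?exprn_ge0 ?(ltW L0).
apply: (le_trans (lerD k1 (ler_wpM2l k3 k2))).
have : 0 <= s * l ^+ 2 by rewrite mulr_ge0// exprn_ge0//; case/andP: l01.
rewrite exprMn; move: (l ^+ 2) (C ^+ 2) => l2 C2; lra.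
Qed.

Lemma functional_bounded h : diff_lipschitz L h -> exists B : R,
  forall xi (t : R), admissible xi -> 0 <= t <= 1 -> `|h (phi P t xi)| <= B.
Proof.
move=> hh; have [B B0 tB] := trajectory_bounded L0 P_ok.
exists (K * B + `|h 0|) => xi t axi t01.
have -> : h (phi P t xi) = (h (phi P t xi) - h 0) + h 0 by rewrite subrK.
apply: (le_trans (ler_normD _ _)); rewrite lerD2r.
apply: (le_trans (@diff_lipschitz_lip R n m L L0 h _ _ hh)).
by rewrite subr0 ler_pM2l// tB.
Qed.

(** All the intervals with centre the slope at l and radius C l meet; their common
    point is the derivative. *)
Lemma directional_derivative (C : R) (G : ctl -> R) xi eta : 0 <= C ->
  second_order C G -> admissible xi -> admissible eta -> forall l : R, 0 <= l <= 1 ->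
  `|G (seg l xi eta) - G xi - l * DD G xi (eta - xi)| <= C * l ^+ 2.
Proof.
move=> C0 GC axi aeta.
pose sl (l : R) := (G (xi + l *: (eta - xi)) - G xi) / l.
have slope (s l : R) : 0 < s -> s <= l -> l <= 1 -> `|sl s - sl l| <= C * l.
  move=> s0 sl_ l1; have l0 := lt_le_trans s0 sl_.
  have sl01 : 0 <= s / l <= 1.
    by rewrite divr_ge0 ?(ltW s0) ?(ltW l0)//= ler_pdivrMr// mul1r.
  have l01 : 0 <= l <= 1 by rewrite ltW.
  have := GC xi eta axi aeta (s / l) l sl01 l01.
  rewrite divfK ?gt_eqF//.
  have -> : G (seg s xi eta) - ((1 - s / l) * G xi + s / l * G (seg l xi eta)) =
      s * (sl s - sl l).
    by rewrite /sl /seg; field; rewrite !gt_eqF.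
  rewrite normrM (gtr0_norm s0).
  have -> : C * (s / l) * l ^+ 2 = s * (C * l) by field; rewrite gt_eqF.
  by rewrite ler_pM2l.
pose Q := [set sl l - C * l | l in [set l : R | 0 < l <= 1]].
have cross (l k : R) : 0 < l <= 1 -> 0 < k <= 1 -> sl l - C * l <= sl k + C * k.
  move=> /andP[l0 l1] /andP[k0 k1]; have [lk|/ltW kl] := leP l k.
    have := slope l k l0 lk k1; rewrite ler_norml => /andP[_].
    have : 0 <= C * l by rewrite mulr_ge0// ltW.
    by move: (sl l) (sl k) (C * l) (C * k) => *; lra.
  have := slope k l k0 kl l1; rewrite ler_norml => /andP[+ _].
  have : 0 <= C * k by rewrite mulr_ge0// ltW.
  by move: (sl l) (sl k) (C * l) (C * k) => *; lra.
have one01 : 0 < (1 : R) <= 1 by rewrite ltr01 lexx.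
have hQ : has_sup Q.
  split; first by exists (sl 1 - C * 1), 1.
  by exists (sl 1 + C * 1) => _ [l l01 <-]; exact: cross.
have close (l : R) : 0 < l <= 1 -> `|sl l - sup Q| <= C * l.
  move=> l01; rewrite distrC ler_distl; apply/andP; split.
    by apply: (ub_le_sup hQ.2); exists l.
  by apply: (ge_sup hQ.1) => _ [k k01 <-]; exact: cross.
have -> : DD G xi (eta - xi) = sup Q.
  apply: cvg_lim => //; apply/cvgrPdist_le => e e0.
  have C1 : 0 < C + 1 by rewrite ltr_wpDl.
  near=> l.
  have l0 : 0 < l by near: l; exact: nbhs_right_gt.
  have l1 : l <= 1 by near: l; exact: nbhs_right_le.
  have le_ : l <= e / (C + 1) by near: l; apply: nbhs_right_le; exact: divr_gt0.
  rewrite distrC; apply: (le_trans (close l _)); first by rewrite l0.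
  apply: (@le_trans _ _ ((C + 1) * l)); first by rewrite ler_pM2r// lerDl.
  by rewrite mulrC -ler_pdivlMr.
move=> l /andP[]; rewrite le_eqVlt => /predU1P[<- _|l0 l1].
  by rewrite seg0 subrr mul0r subrr normr0 expr0n mulr0.
have -> : G (seg l xi eta) - G xi - l * sup Q = l * (sl l - sup Q).
  by rewrite /sl /seg; field; rewrite gt_eqF.
rewrite normrM (gtr0_norm l0).
have -> : C * l ^+ 2 = l * (C * l) by ring.
by rewrite ler_pM2l// close// l0.
Unshelve. all: by end_near. Qed.

End Variations.

(** * The mean of a function with values in a convex set *)

Section Barycenter.
Context {R : realType} {m : nat}.
Local Notation mu := (@lebesgue_measure R).

Lemma bmeas_lt0 (a : R -> R) : bmeas a -> bmeas (fun t => if a t < 0 then 1 else 0).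
Proof.
move=> [ma _]; split; last first.
  by exists 1 => t _; case: ifP => _; rewrite ?normr1 ?normr0.
have mD : measurable (`[0 : R, 1] `&` a @^-1` `]-oo, 0[).
  exact: (ma (measurable_itv _) _ (measurable_itv _)).
apply: (eq_measurable_fun (\1_(`[0 : R, 1] `&` a @^-1` `]-oo, 0[) : R -> R)).
  move=> t tD; rewrite indicE in_setI tD/=.
  have -> : (t \in a @^-1` `]-oo, 0[) = (a t < 0).
    by apply/idP/idP; rewrite inE/= in_itv.
  by case: ifP.
exact: measurable_indic.
Qed.

(** The set where g is nonzero is contained in the null set where f is. *)
Lemma intR_null (f g : R -> R) : bmeas f -> bmeas g ->
  intR 0 1 (fun t => `|f t|) = 0 -> (forall t, f t = 0 -> g t = 0) ->
  intR 0 1 g = 0.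
Proof.
move=> bf bg f0 fg; have [mf _] := bf; have [mg _] := bg.
have fin : (\int[mu]_(t in `[0%R, 1%R]) (`|f t|%R)%:E)%E \is a fin_num.
  apply: integrable_fin_num => //.
  exact: (bmeas_integrable (lexx 0) (lexx 1) (bmeas_norm bf)).
have if0 : (\int[mu]_(t in `[0%R, 1%R]) `|(f t)%:E| = 0)%E.
  by rewrite -[LHS]fineK// -[RHS]/(0%R%:E); congr (_%:E); exact: f0.
have aef : ae_eq mu [set` `[0 : R, 1]] (EFin \o f) (cst 0%E).
  by apply/ae_eq_integral_abs => //; exact/measurable_EFinP.
have aeg : ae_eq mu [set` `[0 : R, 1]] (EFin \o g) (cst 0%E).
  by apply: filterS aef => t /[apply] -[] /fg /= ->.
rewrite /intR /Rintegral.
have -> : (\int[mu]_(t in `[0%R, 1%R]) (g t)%:E = \int[mu]_(t in `[0%R, 1%R]) cst 0 t)%E.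
  by apply: ae_eq_integral => //; exact/measurable_EFinP.
by rewrite integral0.
Qed.

Lemma intR_gt0_exists (c : R -> R) : bmeas c -> 0 < intR 0 1 c ->
  exists2 t, 0 <= t <= 1 & 0 < c t.
Proof.
move=> bc c0; apply: contrapT => nex; have : intR 0 1 c <= intR 0 1 (fun=> 0).
  apply: le_intR => //; first exact: bmeas_cst.
  by move=> t t01; rewrite leNgt; apply/negP => ct; apply: nex; exists t.
by rewrite intR_cst// mul0r leNgt c0.
Qed.

(** The pair (c, y) takes its values in the cone over K (the cone lives in one
    dimension more), and homogeneity dispenses with quotients of measurable
    functions.  Induction on the number k of coordinates of y that may be
    nonzero; let a be the last one.  Pairing s in {a >= 0} with t in {a < 0}, the
    combination a(s) y(t) - a(t) y(s) has one zero coordinate more and stays in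
    the cone.  Integrating it in t puts, for each s, the pair (gamma s, b s) in
    the cone; integrating that in s recovers a positive multiple of the
    integral of y.  Each integration is an instance of the induction
    hypothesis.  A limiting argument would only reach the closure of K. *)
Lemma convex_mean_zero (k : nat) (K : set 'rV[R]_m) (c : R -> R)
    (y : R -> 'rV[R]_m) :
  (forall v w (s : R), K v -> K w -> 0 <= s <= 1 -> K (seg s v w)) ->
  bmeas c -> bmeasv y ->
  (forall t, 0 <= t <= 1 -> c t = 0 -> y t = 0) ->
  (forall t, 0 <= t <= 1 -> 0 <= c t) ->
  (forall t, 0 <= t <= 1 -> 0 < c t -> K ((c t)^-1 *: y t)) ->
  0 < intR 0 1 c -> (forall i, intR 0 1 (fun t => y t ord0 i) = 0) ->
  (forall i : 'I_m, (k <= i)%N -> forall t, 0 <= t <= 1 -> y t ord0 i = 0) ->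
  K 0.
Proof.
elim: k K c y => [|k IH] K c y Kc bc by_ y0 c0 Ky ic iy yk.
  have [t t01 ct] := intR_gt0_exists bc ic.
  have -> : 0 = (c t)^-1 *: y t; last exact: Ky.
  have -> : y t = 0 by apply/rowP => i; rewrite yk// mxE.
  by rewrite scaler0.
have [mk|km] := leqP m k.
  apply: (IH K c y) => // i ki; exfalso.
  by have := leq_trans mk ki; rewrite leqNgt ltn_ord.
pose j := Ordinal km; pose a t := y t ord0 j.
have ba : bmeas a := by_ j.
pose neg t : R := if a t < 0 then 1 else 0.
have bneg : bmeas neg := bmeas_lt0 ba.
pose A := - intR 0 1 (fun t => neg t * a t).
have bna : bmeas (fun t => neg t * a t) by exact: bmeasM.
have iAa : intR 0 1 (fun t => (1 - neg t) * a t) = A.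
  rewrite (@eq_intR _ _ _ _ (fun t => a t - neg t * a t)); last first.
    by move=> t _; rewrite mulrBl mul1r.
  by rewrite intRB// [intR 0 1 a]iy sub0r.
have yjk (i : 'I_m) : (k <= i)%N -> i != j -> (k < i)%N.
  by move=> ki ij; rewrite ltn_neqAle ki andbT; apply: contra ij => /eqP e;
    apply/eqP/val_inj; rewrite /= e.
have A0 : 0 <= A.
  rewrite /A -mulN1r -intRZ//; apply: intR_ge0 => t _.
  rewrite mulN1r oppr_ge0 /neg.
  by case: ltP => [/ltW|_]; rewrite ?mul1r ?mul0r.
have [A_eq0|A_neq0] := eqVneq A 0.
  (* a vanishes almost everywhere, and may be cut off to 0 *)
  pose z t : R := (1 - neg t) * (1 - (if - a t < 0 then 1 else 0)).
  have bz : bmeas z.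
    apply: bmeasM; apply: bmeasB; try exact: bmeas_cst; first exact: bneg.
    exact/bmeas_lt0/bmeasN.
  have zE t : z t = if a t == 0 then 1 else 0.
    rewrite /z /neg oppr_lt0; case: ltgtP => _;
    by rewrite ?subrr ?mul0r ?mulr0 ?subr0 ?mulr1.
  have ia : intR 0 1 (fun t => `|a t|) = 0.
    rewrite (@eq_intR _ _ _ _ (fun t => (1 - neg t) * a t - neg t * a t)).
      rewrite intRB// ?iAa; last by apply: bmeasM => //; apply: bmeasB => //; exact: bmeas_cst.
      by rewrite -/A A_eq0 add0r.
    move=> t _; rewrite /neg; case: (ltP (a t) 0) => [/ltW/ler0_norm|/ger0_norm] ->.
      by rewrite subrr mul0r mul1r sub0r.
    by rewrite subr0 mul0r mul1r subr0.
  have cut f : bmeas f -> intR 0 1 (fun t => z t * f t) = intR 0 1 f.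
    move=> bf; apply/eqP; rewrite -subr_eq0 -intRB//; last exact: bmeasM.
    apply/eqP; apply: (intR_null ba) => //.
      by apply: bmeasB => //; exact: bmeasM.
    by move=> t at0; rewrite zE at0 eqxx mul1r subrr.
  apply: (IH K (fun t => z t * c t) (fun t => z t *: y t)) => //.
  - exact: bmeasM.
  - by move=> i; under eq_fun do rewrite mxE; exact: bmeasM.
  - move=> t t01 /eqP; rewrite mulf_eq0 => /orP[/eqP->|/eqP/(y0 t t01)->].
      by rewrite scale0r.
    by rewrite scaler0.
  - by move=> t t01; rewrite mulr_ge0 ?c0// zE; case: eqP.
  - move=> t t01; rewrite zE; case: eqP => _; last by rewrite mul0r ltxx.
    by rewrite mul1r scale1r; exact: Ky.
  - by rewrite cut.
  - by move=> i; under eq_fun do rewrite mxE; rewrite cut.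
  - move=> i ki t t01; rewrite mxE zE; have [-> |ij] := eqVneq i j.
      by rewrite -/(a t); case: eqP => [->|_]; rewrite ?mulr0 ?mul0r.
    by rewrite yk ?yjk// mulr0.
have A_gt0 : 0 < A by rewrite lt_neqAle eq_sym A_neq0.
pose CN := intR 0 1 (fun t => neg t * c t).
pose YN : 'rV[R]_m := \row_i intR 0 1 (fun t => neg t * y t ord0 i).
have bnc : bmeas (fun t => neg t * c t) by exact: bmeasM.
have bny i : bmeas (fun t => neg t * y t ord0 i) by exact: bmeasM.
have neg0 t : 0 <= neg t by rewrite /neg; case: (ltP (a t) 0).
have CN0 : 0 <= CN by apply: intR_ge0 => t t01; rewrite mulr_ge0// c0.
pose gam s := a s * CN + A * c s; pose b s : 'rV[R]_m := a s *: YN + A *: y s.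
have Kb s : 0 <= s <= 1 -> 0 <= a s -> 0 < c s -> K ((gam s)^-1 *: b s).
  move=> s01 as0 cs0.
  have gam0 : 0 < gam s.
    by rewrite /gam; apply: ltr_wpDl; [exact: mulr_ge0|exact: mulr_gt0].
  pose q := (gam s)^-1 *: b s.
  pose cs t := neg t * (a s * c t - a t * c s).
  pose ys t : 'rV[R]_m := neg t *: (a s *: y t - a t *: y s) - cs t *: q.
  have csE t : cs t = a s * (neg t * c t) - c s * (neg t * a t) by rewrite /cs; ring.
  have ics : intR 0 1 cs = gam s.
    rewrite (eq_intR (fun t _ => csE t)) intRB ?intRZ//; try exact: bmeasZ.
    by rewrite /gam /CN /A; ring.
  have bcs : bmeas cs.
    rewrite (funext csE).
    by apply: bmeasB; exact: bmeasZ.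
  have ysE t i : ys t ord0 i = (a s * (neg t * y t ord0 i) -
      y s ord0 i * (neg t * a t)) - q ord0 i * cs t.
    by rewrite !mxE; ring.
  have bys i : bmeas (fun t => a s * (neg t * y t ord0 i) - y s ord0 i * (neg t * a t)).
    by apply: bmeasB; exact: bmeasZ.
  suff : (fun v => K (v + q)) 0 by rewrite /= add0r.
  apply: (IH (fun v => K (v + q)) cs ys) => //.
  - move=> v w r Kv Kw r01; have -> : seg r v w + q = seg r (v + q) (w + q).
      by apply/rowP => i; rewrite !mxE; ring.
    exact: Kc.
  - move=> i; rewrite (funext (ysE^~ i)).
    by apply: bmeasB => //; exact: bmeasZ.
  - move=> t t01 cst0; rewrite /ys cst0 scale0r subr0.
    move: cst0; rewrite /cs /neg; case: (ltP (a t) 0) => [at0|_ _]; last by rewrite scale0r.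
    rewrite mul1r scale1r => /eqP; rewrite subr_eq0 => /eqP e.
    have := mulr_ge0 as0 (c0 t t01); rewrite e leNgt => /negP; case.
    by rewrite pmulr_llt0.
  - move=> t t01; rewrite /cs /neg; case: (ltP (a t) 0) => [at0|_]; last by rewrite mul0r.
    by rewrite mul1r addr_ge0 ?mulr_ge0 ?c0// -mulNr mulr_ge0 ?oppr_ge0 ?ltW.
  - move=> t t01 cst0; rewrite /ys scalerBr [X in _ - X]scalerA mulVf ?gt_eqF// scale1r subrK.
    move: cst0; rewrite /cs /neg; case: (ltP (a t) 0) => [at0|_]; last by rewrite mul0r ltxx.
    rewrite mul1r scale1r => D0; set D := a s * c t - a t * c s in D0 *.
    have ct0 : 0 < c t.
      rewrite lt_neqAle c0// andbT; apply/eqP => e; move: at0.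
      by rewrite /a y0// mxE ltxx.
    have -> : D^-1 *: (a s *: y t - a t *: y s) =
        seg (a s * c t / D) ((c s)^-1 *: y s) ((c t)^-1 *: y t).
      apply/rowP => i; rewrite !mxE; rewrite /D in D0 *.
      by field; rewrite !gt_eqF.
    apply: Kc; [exact: Ky|exact: Ky|].
    apply/andP; split; first by apply: divr_ge0; [exact: mulr_ge0 (ltW _)|exact: ltW].
    rewrite ler_pdivrMr// mul1r /D lerBrDr gerDl.
    by apply: mulr_le0_ge0; exact: ltW.
  - by rewrite ics.
  - move=> i; rewrite (eq_intR (fun t _ => ysE t i)) intRB ?intRZ ?ics//; last first.
      exact: bmeasZ.
    rewrite intRB ?intRZ//; try exact: bmeasZ.
    rewrite /q !mxE -[intR 0 1 (fun t => neg t * a t)]opprK -/A.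
    by field; rewrite gt_eqF.
  - move=> i ki t t01; rewrite ysE; have [->|ij] := eqVneq i j.
      have -> : q ord0 j = 0.
        by rewrite !mxE -/(a s) -[intR 0 1 _]opprK -/A; ring.
      by rewrite -/(a t) -/(a s); ring.
    have kil := yjk i ki ij.
    have -> : q ord0 i = 0.
      rewrite !mxE (yk i kil s s01) (@eq_intR _ _ _ _ (fun=> 0)).
        by rewrite intR_cst// !(mul0r, mulr0) addr0 mulr0.
      by move=> r r01; rewrite yk// mulr0.
    by rewrite !yk// !(mul0r, mulr0) subr0 subrr.
pose pos t := 1 - neg t.
have bpos : bmeas pos by apply: bmeasB => //; exact: bmeas_cst.
have posE t : pos t = if 0 <= a t then 1 else 0.
  by rewrite /pos /neg; case: (ltP (a t) 0) => _; rewrite ?subrr ?subr0.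
have bpa : bmeas (fun t => pos t * a t) by exact: bmeasM.
have bpc : bmeas (fun t => pos t * c t) by exact: bmeasM.
have pgE t : pos t * gam t = CN * (pos t * a t) + A * (pos t * c t).
  by rewrite /gam; ring.
have pbE t i : pos t * b t ord0 i = YN ord0 i * (pos t * a t) +
    A * (pos t * y t ord0 i).
  by rewrite /b; rewrite ![in LHS]mxE [in RHS]mxE; ring.
have bpy i : bmeas (fun t => pos t * y t ord0 i) by exact: bmeasM.
apply: (IH K (fun t => pos t * gam t) (fun t => pos t *: b t)) => //.
- by rewrite (funext pgE); apply: bmeasD; exact: bmeasZ.
- move=> i; under eq_fun do rewrite mxE.
  by rewrite (funext (pbE^~ i)); apply: bmeasD; exact: bmeasZ.
- move=> t t01; rewrite posE; case: (leP 0 (a t)) => [at0|_ _]; last by rewrite scale0r.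
  rewrite mul1r scale1r => g0; have ct0 : c t = 0.
    have h1 := mulr_ge0 at0 CN0; have h2 := mulr_ge0 A0 (c0 t t01).
    apply/eqP; have : A * c t == 0 by move: g0; rewrite /gam; lra.
    by rewrite mulf_eq0 (negbTE A_neq0).
  by rewrite /b /a y0// mxE scale0r scaler0 addr0.
- move=> t t01; rewrite posE; case: (leP 0 (a t)) => [at0|_]; last by rewrite mul0r.
  by rewrite mul1r addr_ge0// mulr_ge0// c0.
- move=> t t01; rewrite posE; case: (leP 0 (a t)) => [at0|_]; last by rewrite mul0r ltxx.
  rewrite mul1r scale1r => g0; apply: Kb => //.
  rewrite lt_neqAle c0// andbT; apply/eqP => ct0; move: g0.
  by rewrite /gam /a y0// mxE -ct0 mul0r mulr0 addr0 ltxx.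
- rewrite (eq_intR (fun t _ => pgE t)) intRD ?intRZ//; try exact: bmeasZ.
  rewrite iAa mulrC -mulrDr mulr_gt0//.
  have -> : CN + intR 0 1 (fun t => pos t * c t) = intR 0 1 c; last by [].
  rewrite /CN -intRD//; apply: eq_intR => t _; rewrite /pos; ring.
- move=> i; under eq_fun do rewrite mxE.
  rewrite (eq_intR (fun t _ => pbE t i)) intRD ?intRZ//; try exact: bmeasZ.
  rewrite iAa mulrC -mulrDr.
  have -> : YN ord0 i + intR 0 1 (fun t => pos t * y t ord0 i) = 0.
    transitivity (intR 0 1 (fun t => y t ord0 i)); last exact: iy.
    by rewrite mxE -intRD//; apply: eq_intR => t _; rewrite /pos; ring.
  by rewrite mulr0.
- move=> i ki t t01; rewrite mxE pbE; have [->|ij] := eqVneq i j.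
    have -> : YN ord0 j = - A by rewrite mxE /A opprK.
    by rewrite -/(a t); ring.
  have kil := yjk i ki ij.
  have -> : YN ord0 i = 0.
    rewrite mxE (@eq_intR _ _ _ _ (fun=> 0)) ?intR_cst ?mul0r//.
    by move=> r r01; rewrite yk// mulr0.
  by rewrite yk// !(mulr0, mul0r, addr0).
Qed.

Lemma convex_mean (U : set 'rV[R]_m) (u : R -> 'rV[R]_m) (a b : R) :
  convex_set U -> 0 <= a -> a < b -> b <= 1 -> bmeasv u ->
  (forall t, 0 <= t <= 1 -> U (u t)) ->
  U (\row_i ((b - a)^-1 * intR a b (fun t => u t ord0 i))).
Proof.
move=> cU a0 ab b1 bu Uu; set z := \row_i _.
have ba0 : 0 < b - a by rewrite subr_gt0.
pose c (t : R) : R := (if t - b < 0 then 1 else 0) * (if a - t < 0 then 1 else 0).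
have bid : bmeas (fun t : R => t) by apply/bv_bmeas/bv_mono.
have bc : bmeas c.
  by apply: bmeasM; apply/bmeas_lt0/bmeasB => //; exact: bmeas_cst.
have a1 : a <= 1 by rewrite (le_trans (ltW ab)).
have b0 : 0 <= b by rewrite (le_trans a0)// ltW.
have cut f : bmeas f -> intR 0 1 (fun t => c t * f t) = intR a b f.
  move=> bf; have bcf : bmeas (fun t => c t * f t) by exact: bmeasM.
  rewrite (intR_cat _ a0 a1 _ bcf)// (intR_cat a0 (ltW ab) b1 _ bcf)//.
  have -> : intR 0 a (fun t => c t * f t) = 0.
    rewrite (@eq_intR _ _ _ _ (fun=> 0)) ?intR_cst ?mul0r// => t /andP[_ ta].
    by rewrite /c !subr_lt0 (ltNge a) ta/= mulr0 mul0r.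
  have -> : intR b 1 (fun t => c t * f t) = 0.
    rewrite (@eq_intR _ _ _ _ (fun=> 0)) ?intR_cst ?mul0r// => t /andP[bt _].
    by rewrite /c !subr_lt0 (ltNge t) bt/= !mul0r.
  rewrite add0r addr0; apply: eq_intR_oo => // t /andP[at_ tb].
  by rewrite /c !subr_lt0 at_ tb !mul1r.
have c01 t : c t = 0 \/ c t = 1.
  by rewrite /c; do 2 case: ifP => _; rewrite ?mulr0 ?mul0r ?mulr1; tauto.
have by_ i : bmeas (fun t => u t ord0 i - z ord0 i).
  by apply: bmeasB => //; exact: bmeas_cst.
suff : (fun v => U (v + z)) 0 by rewrite /= add0r.
apply: (@convex_mean_zero m (fun v => U (v + z)) c (fun t => c t *: (u t - z))) => //.
- move=> v w s Uv Uw s01; have -> : seg s v w + z = seg s (v + z) (w + z).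
    by apply/rowP => i; rewrite !mxE; ring.
  exact: convex_seg.
- move=> i; have -> : (fun t => (c t *: (u t - z)) ord0 i) =
      (fun t => c t * (u t ord0 i - z ord0 i)) by apply/funext => t; rewrite !mxE.
  exact: bmeasM.
- by move=> t _ ->; rewrite scale0r.
- by move=> t _; case: (c01 t) => ->.
- move=> t t01; case: (c01 t) => ->; first by rewrite ltxx.
  by rewrite invr1 !scale1r subrK => _; exact: Uu.
- have -> : intR 0 1 c = intR 0 1 (fun t => c t * 1).
    by apply: eq_intR => t _; rewrite mulr1.
  by rewrite cut ?intR_cst ?mul1r ?ltW//; exact: bmeas_cst.
- move=> i; rewrite (@eq_intR _ _ _ _ (fun t => c t * (u t ord0 i - z ord0 i))).
    rewrite cut// intRB//; last exact: bmeas_cst.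
    by rewrite intR_cst ?ltW// mxE mulrAC mulVf ?gt_eqF// mul1r subrr.
  by move=> t _; rewrite !mxE.
- by move=> i; rewrite leqNgt ltn_ord.
Qed.

End Barycenter.

(** * Haar averages *)

Section StepFunctions.
Context {R : realType}.

(** Every step function below is a combination of translates and dilates of
    this one. *)
Definition lt0 (x : R) : R := if x < 0 then 1 else 0.

Lemma lt0_bv (s a : R) : 0 <= s -> bv (fun t => lt0 (s * t - a)).
Proof.
move=> s0; have : bv (fun t => - lt0 (s * t - a)).
  apply: bv_mono => x y xy; rewrite lerN2 /lt0.
  case: (ltP (s * y - a)) => [ya|_]; last by case: ifP.
  by rewrite ifT// (le_lt_trans _ ya)// lerD2r ler_wpM2l.
move=> /(bvZ (-1)); apply: eq_bv => t _; by rewrite mulN1r opprK.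
Qed.

Lemma intR_lt0 (a b h : R) : 0 <= a -> a <= h -> h <= b -> b <= 1 ->
  intR a b (fun t => lt0 (1 * t - h)) = h - a.
Proof.
move=> a0 ah hb b1; have bl : bmeas (fun t => lt0 (1 * t - h)).
  by apply: bv_bmeas; apply: lt0_bv.
rewrite (intR_cat a0 ah hb b1 bl).
rewrite (@eq_intR_oo _ _ (fun=> 1) a h)//; last 3 first.
- exact: le_trans b1.
- exact: bmeas_cst.
- by move=> t /andP[_ th]; rewrite /lt0 mul1r subr_lt0 th.
rewrite (@eq_intR_oo _ _ (fun=> 0) h b)//; last 3 first.
- exact: le_trans ah.
- exact: bmeas_cst.
- by move=> t /andP[ht _]; rewrite /lt0 mul1r subr_lt0 ltNge (ltW ht).
by rewrite !intR_cst// mul1r mul0r addr0.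
Qed.

(** Left limits at 1 of functions that are constant just before 1 are values at
    earlier times, so the extension to t = 1 adds no new value. *)
Definition left_const (f : R -> R) :=
  exists v, \forall t \near (1 : R)^'-, f t = v.

Lemma left_const_cst (k : R) : left_const (fun=> k).
Proof. by exists k; exact: nearW. Qed.

Lemma left_constD f g : left_const f -> left_const g ->
  left_const (fun t => f t + g t).
Proof.
move=> [v fv] [w gw]; exists (v + w).
by apply: filterS2 fv gw => t -> ->.
Qed.

Lemma left_constZ (k : R) f : left_const f -> left_const (fun t => k * f t).
Proof. by move=> [v fv]; exists (k * v); apply: filterS fv => t ->. Qed.

Lemma left_const_sum (I : Type) (r : seq I) (F : I -> R -> R) :
  (forall i, left_const (F i)) -> left_const (fun t => \sum_(i <- r) F i t).
Proof.
move=> lF; elim: r => [|i r IH].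
  by under eq_fun do rewrite big_nil; exact: left_const_cst.
by under eq_fun do rewrite big_cons; exact: left_constD.
Qed.

Lemma left_const_lt0 (s a : R) : 0 < s -> left_const (fun t => lt0 (s * t - a)).
Proof.
move=> s0; have [as_|sa] := ltP a s.
  exists 0; near=> t; rewrite /lt0 ifF//; apply/negbTE; rewrite -leNgt subr_ge0.
  rewrite -ler_pdivrMl// mulrC; near: t; apply: nbhs_left_ge.
  by rewrite ltr_pdivrMr// mul1r.
exists 1; near=> t; rewrite /lt0 ifT// subr_lt0; apply: (lt_le_trans _ sa).
by rewrite gtr_pMr//; near: t; exact: nbhs_left_lt.
Unshelve. all: by end_near. Qed.

Lemma left_ext_lt (f : R -> R) (t : R) : t < 1 -> left_ext f t = f t.
Proof. by move=> t1; rewrite /left_ext lt_eqF//. Qed.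

Lemma left_ext_sample (I : finType) (f : I -> R -> R) (e : R) :
  (forall i, left_const (f i)) -> e < 1 ->
  exists2 s, e < s < 1 & forall i, left_ext (f i) 1 = f i s.
Proof.
move=> lf e1; have /choice[v fv] := lf.
have fall : \forall t \near (1 : R)^'-, forall i, f i t = v i.
  by apply: filter_forall => i; exact: fv.
have : \forall t \near (1 : R)^'-, (e < t < 1) /\ (forall i, f i t = v i).
  near=> t; split; last by near: t.
    apply/andP; split; near: t; first exact: nbhs_left_gt.
    exact: nbhs_left_lt.
move=> /filter_ex[s [es fs]]; exists s => // i; rewrite /left_ext eqxx fs.
apply: cvg_lim => //.
have cvg_v : (fun=> v i) @ (1 : R)^'- --> v i by exact: cvg_cst.
apply: cvg_trans cvg_v; apply: near_eq_cvg.
by apply: filterS (fv i) => t ->.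
Unshelve. all: by end_near. Qed.

Lemma left_ext_bv (f : R -> R) : bv f -> bv (left_ext f).
Proof.
move=> bf; apply: (@eq_bv _ (fun t => f t +
    (left_ext f 1 - f 1) * (1 - lt0 (1 * t - 1)))).
  move=> t /andP[_ t1]; rewrite /lt0 mul1r subr_lt0; have [tlt|t1'] := ltP t 1.
    by rewrite (left_ext_lt f tlt)// subrr mulr0 addr0.
  have -> : t = 1 by apply/eqP; rewrite eq_le t1.
  by rewrite subr0 mulr1 addrC subrK.
by apply: bvD => //; apply: bvZ; apply: bvB; [exact: bv_cst | exact: lt0_bv].
Qed.

End StepFunctions.

Section Haar.
Context {R : realType}.
Implicit Types (c : R -> R) (t : R).

Lemma haar_lt0 (x : R) : haar x = - lt0 x + 2 * lt0 (x - 2^-1) - lt0 (x - 1).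
Proof.
rewrite /haar /lt0 !subr_lt0.
have h0 : 0 < 2^-1 :> R by rewrite invr_gt0.
have h1 : 2^-1 < 1 :> R by rewrite invf_lt1// ltr1n.
have [x0|x0] /= := ltP x 0.
  have xh := lt_trans x0 h0; rewrite xh (lt_trans xh h1).
  by rewrite leNgt xh/=; ring.
have [xh|xh] /= := ltP x 2^-1.
  by rewrite (lt_trans xh h1); ring.
by case: ltP => _; ring.
Qed.

Lemma haarb_lt0 (k j : nat) t : haarb k j t = - lt0 (2 ^+ k * t - j%:R) +
  2 * lt0 (2 ^+ k * t - (j%:R + 2^-1)) - lt0 (2 ^+ k * t - (j%:R + 1)).
Proof. by rewrite /haarb haar_lt0 !opprD !addrA. Qed.

Lemma haarb_bv (k j : nat) : bv (@haarb R k j).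
Proof.
have p0 : 0 <= 2 ^+ k :> R by rewrite exprn_ge0.
apply: (@eq_bv _ (fun t => -1 * lt0 (2 ^+ k * t - j%:R) +
  2 * lt0 (2 ^+ k * t - (j%:R + 2^-1)) - lt0 (2 ^+ k * t - (j%:R + 1)))).
  by move=> t _; rewrite haarb_lt0 mulN1r.
by apply: bvB; [apply: bvD; apply: bvZ|]; exact: lt0_bv.
Qed.

Lemma haarb_left_const (k j : nat) : left_const (@haarb R k j).
Proof.
have p0 : 0 < 2 ^+ k :> R by rewrite exprn_gt0.
have -> : @haarb R k j = (fun t => -1 * lt0 (2 ^+ k * t - j%:R) +
  2 * lt0 (2 ^+ k * t - (j%:R + 2^-1)) + -1 * lt0 (2 ^+ k * t - (j%:R + 1))).
  by apply/funext => t; rewrite haarb_lt0 !mulN1r.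
by apply: left_constD; [apply: left_constD|]; apply: left_constZ;
  exact: left_const_lt0.
Qed.

Lemma haar_sumE (N : nat) c : haar_sum N c = fun t => ip c (fun=> 1) +
  \sum_(k <- index_iota 0 N.+1) \sum_(j <- index_iota 0 (2 ^ k))
   ip c (haarb k j) / ip (haarb k j) (haarb k j) * haarb k j t.
Proof.
apply/funext => t; rewrite /haar_sum; congr (_ + _).
by apply: eq_bigr => k _; apply: eq_bigr => j _; rewrite mulrAC.
Qed.

Lemma haar_sum_bv (N : nat) c : bv (haar_sum N c).
Proof.
rewrite haar_sumE; apply: bvD; first exact: bv_cst.
by apply: bv_sum => k; apply: bv_sum => j; apply: bvZ; exact: haarb_bv.
Qed.

Lemma haar_sum_left_const (N : nat) c : left_const (haar_sum N c).
Proof.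
rewrite haar_sumE; apply: left_constD; first exact: left_const_cst.
apply: left_const_sum => k; apply: left_const_sum => j; apply: left_constZ.
exact: haarb_left_const.
Qed.

Definition dyadic (K j : nat) : R := j%:R / 2 ^+ K.

Lemma dyadic_ge0 K j : 0 <= dyadic K j.
Proof. by rewrite divr_ge0// exprn_ge0. Qed.

Lemma dyadic_le1 K j : (j <= 2 ^ K)%N -> dyadic K j <= 1.
Proof. by move=> jK; rewrite ler_pdivrMr ?exprn_gt0// mul1r -natrX ler_nat. Qed.

Lemma le_dyadic K i j : (i <= j)%N -> dyadic K i <= dyadic K j.
Proof. by move=> ij; rewrite ler_pM2r ?invr_gt0 ?exprn_gt0// ler_nat. Qed.

Lemma lt_dyadic K i j : (i < j)%N -> dyadic K i < dyadic K j.
Proof. by move=> ij; rewrite ltr_pM2r ?invr_gt0 ?exprn_gt0// ltr_nat. Qed.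

Lemma dyadicS K j : dyadic K j = dyadic K.+1 j.*2.
Proof.
rewrite /dyadic exprS -muln2 natrM invfM mulrA mulfK//.
Qed.

Lemma dyadic_step K j : dyadic K j.+1 - dyadic K j = (2 ^+ K)^-1.
Proof. by rewrite /dyadic -mulrBl -natrB// subSnn mul1r. Qed.

Definition avg (K : nat) c (j : nat) : R :=
  2 ^+ K * intR (dyadic K j) (dyadic K j.+1) c.

Lemma haarb_pos (k j : nat) t : dyadic k.+1 j.*2 <= t < dyadic k.+1 j.*2.+1 ->
  haarb k j t = 1.
Proof.
move=> /andP[]; rewrite ler_pdivrMr ?exprn_gt0// ltr_pdivlMr ?exprn_gt0//.
rewrite -natr1 -muln2 natrM exprS => h1 h2; rewrite /haarb /haar ifT//.
by apply/andP; split; lra.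
Qed.

Lemma haarb_neg (k j : nat) t : dyadic k.+1 j.*2.+1 <= t < dyadic k.+1 j.*2.+2 ->
  haarb k j t = -1.
Proof.
move=> /andP[]; rewrite ler_pdivrMr ?exprn_gt0// ltr_pdivlMr ?exprn_gt0//.
have -> : j.*2.+1%:R = 2 * j%:R + 1 :> R by rewrite -natr1 -muln2 natrM mulrC.
have -> : j.*2.+2%:R = 2 * j%:R + 2 :> R by rewrite -addn2 natrD -muln2 natrM mulrC.
rewrite exprS => h1 h2; rewrite /haarb /haar ifF.
  by rewrite ifT//; apply/andP; split; lra.
by apply/negbTE/negP => /andP[_]; lra.
Qed.

Lemma haarb_out (k j : nat) t : (t < dyadic k j) || (dyadic k j.+1 <= t) -> haarb k j t = 0.
Proof.
rewrite ltr_pdivlMr ?exprn_gt0// ler_pdivrMr ?exprn_gt0// -natr1 => h.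
rewrite /haarb /haar ifF; last first.
  by apply/negbTE/negP => /andP[? ?]; case/orP: h => ?; lra.
rewrite ifF//; apply/negbTE/negP => /andP[? ?].
by case/orP: h => ?; lra.
Qed.

Lemma intR_haarb (f : R -> R) (k j : nat) : bmeas f -> (j < 2 ^ k)%N ->
  ip f (haarb k j) = intR (dyadic k.+1 j.*2) (dyadic k.+1 j.*2.+1) f -
                     intR (dyadic k.+1 j.*2.+1) (dyadic k.+1 j.*2.+2) f.
Proof.
move=> bf jk; pose h t := f t * haarb k j t.
have bh : bmeas h by apply: bmeasM => //; exact/bv_bmeas/haarb_bv.
have p1 : dyadic k.+1 j.*2.+2 <= 1 by rewrite -doubleS -dyadicS dyadic_le1.
have l1 := le_dyadic k.+1 (leqnSn j.*2); have l2 := le_dyadic k.+1 (leqnSn j.*2.+1).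
have c1 := le_trans l2 p1; have c0 := le_trans l1 c1.
rewrite -[LHS]/(intR 0 1 h).
rewrite (intR_cat (lexx 0) (dyadic_ge0 k.+1 j.*2) c0 (lexx 1) bh).
rewrite (intR_cat (dyadic_ge0 _ _) l1 c1 (lexx 1) bh).
rewrite (intR_cat (dyadic_ge0 _ _) l2 p1 (lexx 1) bh).
have z := bmeas_cst (0 : R).
rewrite (@eq_intR_oo _ h (fun=> 0) 0 (dyadic k.+1 j.*2))//; last first.
  by move=> t /andP[_ tj]; rewrite /h haarb_out ?mulr0// dyadicS tj.
rewrite (@eq_intR_oo _ h (fun=> 0) (dyadic k.+1 j.*2.+2) 1)//; last 2 first.
- exact: dyadic_ge0.
- move=> t /andP[tj _]; rewrite /h haarb_out ?mulr0//.
  by rewrite [dyadic k j.+1]dyadicS doubleS (ltW tj) orbT.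
rewrite (@eq_intR_oo _ h f (dyadic k.+1 j.*2) (dyadic k.+1 j.*2.+1))//; last 2 first.
- exact: dyadic_ge0.
- by move=> t /andP[t0 t1]; rewrite /h haarb_pos ?mulr1// (ltW t0).
rewrite (@eq_intR_oo _ h (fun t => -1 * f t) (dyadic k.+1 j.*2.+1)
  (dyadic k.+1 j.*2.+2))//; last 3 first.
- exact: dyadic_ge0.
- exact: bmeasZ.
- by move=> t /andP[t0 t1]; rewrite /h haarb_neg ?mulrN1 ?mulN1r// (ltW t0).
rewrite intRZ ?dyadic_ge0// !intR_cst ?dyadic_ge0// !mul0r add0r addr0.
by rewrite mulN1r.
Qed.

Lemma ip_haarb (k j : nat) : (j < 2 ^ k)%N ->
  ip (haarb k j) (haarb k j) = (2 ^+ k)^-1 :> R.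
Proof.
move=> jk; have bh := bv_bmeas (haarb_bv k j).
have p1 : dyadic k.+1 j.*2.+2 <= 1 by rewrite -doubleS -dyadicS dyadic_le1.
have l1 := le_dyadic k.+1 (leqnSn j.*2); have l2 := le_dyadic k.+1 (leqnSn j.*2.+1).
rewrite intR_haarb//.
rewrite (@eq_intR_oo _ _ (fun=> 1) (dyadic k.+1 j.*2) (dyadic k.+1 j.*2.+1))//; last 4 first.
- exact: dyadic_ge0.
- exact: le_trans p1.
- exact: bmeas_cst.
- by move=> t /andP[t0 t1]; rewrite haarb_pos// (ltW t0).
rewrite (@eq_intR_oo _ _ (fun=> -1) (dyadic k.+1 j.*2.+1) (dyadic k.+1 j.*2.+2))//; last 3 first.
- exact: dyadic_ge0.
- exact: bmeas_cst.
- by move=> t /andP[t0 t1]; rewrite haarb_neg// (ltW t0).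
rewrite !intR_cst// mul1r mulN1r opprK addrC subrKA -doubleS -(dyadicS k j) -(dyadicS k j.+1).
exact: dyadic_step.
Qed.

Definition haar_partial (K : nat) c t : R := ip c (fun=> 1) +
  \sum_(0 <= k < K) \sum_(0 <= j < 2 ^ k)
    ip c (haarb k j) * haarb k j t / ip (haarb k j) (haarb k j).

(** Adding level K to an average over a cell of length 2^-K replaces it by the
    average over the half of the cell that contains t. *)
Lemma haar_partial_avg (K : nat) c t (j : nat) : bmeas c -> (j < 2 ^ K)%N ->
  dyadic K j <= t < dyadic K j.+1 -> haar_partial K c t = avg K c j.
Proof.
move=> bc; elim: K j => [|K IH] j.
  rewrite expn0 ltnS leqn0 => /eqP -> _.
  rewrite /haar_partial big_nil addr0 /avg /dyadic expr0 !divr1 mul1r.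
  by apply: eq_intR => s _; rewrite mulr1.
move=> jK tj; pose i := j./2.
have iK : (i < 2 ^ K)%N by rewrite ltn_half_double -mul2n -expnS.
have jE : j = (odd j + i.*2)%N by rewrite odd_double_half.
have ti : dyadic K i <= t < dyadic K i.+1.
  case/andP: tj => t1 t2; rewrite (dyadicS K i) (dyadicS K i.+1) doubleS; apply/andP; split.
    by apply: le_trans t1; apply: le_dyadic; rewrite [X in (_ <= X)%N]jE leq_addl.
  apply: (lt_le_trans t2); apply: le_dyadic; rewrite [X in (X < _)%N]jE.
  by case: (odd j).
have step : haar_partial K.+1 c t =
    haar_partial K c t + ip c (haarb K i) * haarb K i t * 2 ^+ K.
  rewrite /haar_partial big_nat_recr//= addrA; congr (_ + _).
  rewrite (bigD1_seq i)/= ?mem_index_iota ?iota_uniq//.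
  rewrite big1_seq ?addr0; last first.
    move=> i' /andP[ii']; rewrite mem_index_iota => /andP[_ i'K].
    rewrite haarb_out ?mulr0 ?mul0r//; case/andP: ti => t1 t2.
    have [lt_|gt_|e] := ltngtP i' i; last by rewrite e eqxx in ii'.
      by apply/orP; right; apply: le_trans t1; exact: le_dyadic.
    by apply/orP; left; apply: (lt_le_trans t2); exact: le_dyadic.
  by rewrite ip_haarb// invrK.
have p1 : dyadic K.+1 i.*2.+2 <= 1 by rewrite -doubleS -dyadicS dyadic_le1.
have l1 := le_dyadic K.+1 (leqnSn i.*2); have l2 := le_dyadic K.+1 (leqnSn i.*2.+1).
have Iu : haar_partial K c t = 2 ^+ K * (intR (dyadic K.+1 i.*2) (dyadic K.+1 i.*2.+1) c +
    intR (dyadic K.+1 i.*2.+1) (dyadic K.+1 i.*2.+2) c).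
  by rewrite (IH i iK ti) /avg (dyadicS K i) (dyadicS K i.+1) doubleS -(intR_cat (dyadic_ge0 _ _) l1 l2 p1 bc).
rewrite step Iu intR_haarb// /avg.
move: jE tj; case: (odd j); rewrite ?add1n ?add0n => jE; rewrite jE => tj.
  by rewrite haarb_neg// exprS; ring.
by rewrite haarb_pos// exprS; ring.
Qed.

Lemma haar_sum_avg (N : nat) c t (j : nat) : bmeas c -> (j < 2 ^ N.+1)%N ->
  dyadic N.+1 j <= t < dyadic N.+1 j.+1 -> haar_sum N c t = avg N.+1 c j.
Proof. exact: haar_partial_avg. Qed.

Lemma cell_exists (K : nat) t : 0 <= t < 1 ->
  exists2 j, (j < 2 ^ K)%N & dyadic K j <= t < dyadic K j.+1.
Proof.
move=> /andP[t0 t1]; have K0 : 0 < 2 ^+ K :> R by rewrite exprn_gt0.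
have tK : 0 <= t * 2 ^+ K by rewrite mulr_ge0// ltW.
have /andP[h1 h2] := truncn_itv tK.
exists (Num.truncn (t * 2 ^+ K)).
  rewrite -(ltr_nat R); apply: (le_lt_trans h1).
  by rewrite natrX gtr_pMl.
by rewrite ler_pdivrMr// ltr_pdivlMr// h1.
Qed.

(** The averaging cell may be a proper part of [a, b]: the pulses of a cell are
    set by the average over its first half. *)
Lemma avg_dist (K j : nat) c (V : R -> R) (a b : R) : (j < 2 ^ K)%N ->
  majorant c V -> 0 <= a -> a <= dyadic K j -> dyadic K j.+1 <= b -> b <= 1 ->
  forall t, a <= t <= b -> `|avg K c j - c t| <= V b - V a.
Proof.
move=> jK cV a0 aj jb b1 t /andP[at_ tb]; have bc := majorant_bmeas cV.
have K0 : 0 < 2 ^+ K :> R by rewrite exprn_gt0.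
have j01 := le_dyadic K (leqnSn j).
have j1 : dyadic K j.+1 <= 1 by apply: le_trans b1.
have len : 2 ^+ K * (dyadic K j.+1 - dyadic K j) = 1 by rewrite dyadic_step divff ?gt_eqF.
have -> : avg K c j - c t = 2 ^+ K * intR (dyadic K j) (dyadic K j.+1) (fun s => c s - c t).
  rewrite intRB ?dyadic_ge0//; last exact: bmeas_cst.
  rewrite intR_cst// mulrBr; congr (_ - _).
  by rewrite mulrCA len mulr1.
rewrite normrM (gtr0_norm K0).
apply: (@le_trans _ _ (2 ^+ K * ((V b - V a) * (dyadic K j.+1 - dyadic K j)))); last first.
  by rewrite mulrCA len mulr1.
rewrite ler_pM2l//; apply: intR_bound => //; first exact: dyadic_ge0.
  by apply: bmeasB => //; exact: bmeas_cst.
move=> s /andP[js sj].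
have Vm := majorant_mono cV.
have as_ : a <= s by apply: le_trans js.
have sb : s <= b by apply: le_trans sj _.
have [st|/ltW ts] := leP s t.
  rewrite distrC; apply: (le_trans (cV s t (le_trans a0 as_) st (le_trans tb b1))).
  by apply: lerB; apply: Vm => //; [exact: le_trans at_|exact: le_trans b1].
apply: (le_trans (cV t s (le_trans a0 at_) ts (le_trans sb b1))).
by apply: lerB; apply: Vm => //; [exact: le_trans as_|exact: le_trans b1].
Qed.

End Haar.

(** * Pulse-width modulation and the projection rho *)

Section FN.
Context {R : realType}.

Lemma FN_row k (N : nat) (w : R -> 'rV[R]_k) (t : R) (j : nat) : bvv w -> t < 1 ->
  (j < 2 ^ N.+1)%N -> dyadic N.+1 j <= t < dyadic N.+1 j.+1 ->
  FN N w t = \row_i avg N.+1 (fun s => w s ord0 i) j.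
Proof.
move=> bw t1 jN tj; apply/rowP => i; rewrite !mxE left_ext_lt//.
by apply: haar_sum_avg => //; exact: bv_bmeas.
Qed.

Lemma FN_bvv k (N : nat) (w : R -> 'rV[R]_k) : bvv (FN N w).
Proof.
move=> i; have -> : (fun t => FN N w t ord0 i) =
    left_ext (haar_sum N (fun s => w s ord0 i)).
  by apply/funext => t; rewrite mxE.
exact/left_ext_bv/haar_sum_bv.
Qed.

Lemma FN_one k (N : nat) (w : R -> 'rV[R]_k) (e : R) : e < 1 ->
  exists2 s, e < s < 1 & FN N w 1 = FN N w s.
Proof.
move=> e1; have [s es ws] := @left_ext_sample R 'I_k
  (fun i => haar_sum N (fun r => w r ord0 i)) e
  (fun i => haar_sum_left_const N _) e1.
exists s => //; apply/rowP => i; rewrite !mxE ws left_ext_lt//.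
by case/andP: es.
Qed.

(** The Haar partial sum is an average over a dyadic cell, hence a mean of values
    in S. *)
Lemma FN_values k (S : set 'rV[R]_k) (N : nat) (w : R -> 'rV[R]_k) :
  convex_set S -> bvv w -> (forall t, 0 <= t <= 1 -> S (w t)) ->
  forall t, 0 <= t <= 1 -> S (FN N w t).
Proof.
move=> cS bw Sw.
have lt1 (t : R) : 0 <= t -> t < 1 -> S (FN N w t).
  move=> t0 t1; have t01 : 0 <= t < 1 by rewrite t0.
  have [j jN tj] := cell_exists N.+1 t01.
  rewrite (FN_row bw t1 jN tj).
  have := @convex_mean R k S w (dyadic N.+1 j) (dyadic N.+1 j.+1) cS (dyadic_ge0 _ _)
    (lt_dyadic _ (ltnSn j)) (dyadic_le1 jN) (bvv_bmeasv bw) Sw.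
  by rewrite dyadic_step invrK.
move=> t /andP[t0]; rewrite le_eqVlt => /predU1P[->|]; last exact: lt1.
have [s /andP[s0 s1] ->] := FN_one N w ltr01.
by apply: lt1 => //; exact: ltW.
Qed.

Lemma convex_simplex q : convex_set (@simplexr R q).
Proof.
move=> a b l /set_mem Sa /set_mem Sb; apply: mem_set.
have := @simplex_seg R q b a l%:inum Sb Sa.
rewrite segE addrC; apply.
by apply/andP; split; [exact: ge0|exact: le1].
Qed.

End FN.

Section Pulses.
Context {R : realType} {q : nat}.
Implicit Types (d : R -> 'rV[R]_q) (v : 'rV[R]_q).

Definition cum v (i : nat) : R := \sum_(j < q | (j < i)%N) v ord0 j.

Lemma cum0 v : cum v 0 = 0.
Proof. by rewrite /cum big_pred0. Qed.

Lemma cumS v (i : 'I_q) : cum v i.+1 = cum v i + v ord0 i.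
Proof.
rewrite /cum (bigD1 i) ?ltnSn//= addrC; congr (_ + _).
by apply: eq_bigl => j; rewrite ltnS [RHS]ltn_neqAle andbC.
Qed.

Lemma cum_q v : simplexr v -> cum v q = 1.
Proof. by move=> [_ <-]; apply: eq_bigl => j; rewrite ltn_ord. Qed.

Lemma le_cum v (i j : nat) : simplexr v -> (i <= j)%N -> cum v i <= cum v j.
Proof.
move=> [v01 _] ij; rewrite /cum [leRHS](bigID (fun k : 'I_q => (k < i)%N))/=.
rewrite (eq_bigl (fun k : 'I_q => (k < j)%N && (k < i)%N)).
  by rewrite lerDl sumr_ge0// => k _; have /andP[] := v01 k.
move=> k /=; case: (ltnP k i) => ki; last by rewrite andbF.
by rewrite (leq_trans ki ij).
Qed.

Lemma cum_ge0 v i : simplexr v -> 0 <= cum v i.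
Proof. by move=> [v01 _]; apply: sumr_ge0 => k _; have /andP[] := v01 k. Qed.

Lemma cum_le1 v i : simplexr v -> cum v i <= 1.
Proof.
move=> [v01 <-]; rewrite [leRHS](bigID (fun k : 'I_q => (k < i)%N))/= lerDl.
by apply: sumr_ge0 => k _; have /andP[] := v01 k.
Qed.

(** The partial sums of v cut [0, 1) into intervals, so that exactly one mode is
    active at each time. *)
Lemma cum_between v (x : R) : simplexr v -> 0 <= x < 1 ->
  exists i : 'I_q, forall j : 'I_q, (cum v j <= x < cum v j.+1) = (j == i).
Proof.
move=> sv /andP[x0 x1]; have ex : exists k, x < cum v k by exists q; rewrite cum_q.
case: (ex_minnP ex) => -[|k] xk kmin; first by move: xk; rewrite cum0 ltNge x0.
have kq : (k < q)%N by apply: kmin; rewrite cum_q.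
exists (Ordinal kq) => j; apply/andP/eqP => [[jx xj]|->]; last first.
  by split=> //=; rewrite leNgt; apply/negP => /kmin; rewrite ltnn.
apply/val_inj => /=; apply/eqP; rewrite eqn_leq; apply/andP; split.
  rewrite leqNgt; apply/negP => kj; move: jx; rewrite leNgt => /negP; apply.
  exact: (lt_le_trans xk (le_cum sv kj)).
by rewrite -ltnS; exact: kmin.
Qed.

Variables (N : nat) (d : R -> 'rV[R]_q).
Hypothesis sd : forall k : nat, (k < 2 ^ N)%N -> simplexr (d (dyadic N k)).

Definition pulse_lo (i k : nat) : R := 2 ^- N * (k%:R + cum (d (dyadic N k)) i).

Lemma pulse_lo_ge k i : (k < 2 ^ N)%N -> dyadic N k <= pulse_lo i k.
Proof.
move=> kN; rewrite /dyadic mulrC ler_pM2l ?invr_gt0 ?exprn_gt0//.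
by rewrite lerDl cum_ge0//; exact: sd.
Qed.

Lemma pulse_lo_le k i : (k < 2 ^ N)%N -> pulse_lo i k <= dyadic N k.+1.
Proof.
move=> kN; rewrite /dyadic [leRHS]mulrC ler_pM2l ?invr_gt0 ?exprn_gt0//.
by rewrite -natr1 lerD2l cum_le1//; exact: sd.
Qed.

Lemma pulse_lo_mono k i j : (k < 2 ^ N)%N -> (i <= j)%N ->
  pulse_lo i k <= pulse_lo j k.
Proof.
move=> kN ij; rewrite ler_pM2l ?invr_gt0 ?exprn_gt0//.
by rewrite lerD2l le_cum//; exact: sd.
Qed.

Lemma dyadic_cell_uniq (K k j : nat) (t : R) : dyadic K k <= t < dyadic K k.+1 ->
  dyadic K j <= t < dyadic K j.+1 -> k = j.
Proof.
move=> /andP[k1 k2] /andP[j1 j2]; apply/eqP; rewrite eqn_leq.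
have lt_of a b : dyadic (R := R) K a < dyadic K b -> (a < b)%N.
  move=> ab; rewrite ltnNge; apply/negP => /(le_dyadic (R := R) K).
  by rewrite leNgt ab.
apply/andP; split; rewrite -ltnS; apply: lt_of.
  exact: le_lt_trans j2.
exact: le_lt_trans k2.
Qed.

Lemma pulseE (i : 'I_q) (t : R) : pulse N d i t =
  [exists k : 'I_(2 ^ N), pulse_lo i k <= t < pulse_lo i.+1 k]%:R.
Proof. by []. Qed.

Lemma pulse_in_cell (i : 'I_q) (t : R) (k : nat) : (k < 2 ^ N)%N ->
  pulse_lo i k <= t < pulse_lo i.+1 k -> dyadic N k <= t < dyadic N k.+1.
Proof.
move=> kN /andP[t1 t2]; rewrite (le_trans _ t1) ?pulse_lo_ge//=.
by apply: (lt_le_trans t2); exact: pulse_lo_le.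
Qed.

Lemma pulse_cell (i : 'I_q) (t : R) (k : nat) : (k < 2 ^ N)%N ->
  dyadic N k <= t < dyadic N k.+1 ->
  pulse N d i t = if pulse_lo i k <= t < pulse_lo i.+1 k then 1 else 0.
Proof.
move=> kN tk; rewrite pulseE; case: existsP => [[k' tin]|nex].
  by rewrite ifT// -(dyadic_cell_uniq (pulse_in_cell (ltn_ord k') tin) tk).
by rewrite ifF//; apply/negP => tin; apply: nex; exists (Ordinal kN).
Qed.

(** The sum over the cells has at most one nonzero term, since the pulses of a
    cell stay inside it. *)
Lemma pulse_lt0 (i : 'I_q) (t : R) : pulse N d i t =
  \sum_(k < 2 ^ N) (lt0 (1 * t - pulse_lo i.+1 k) + -1 * lt0 (1 * t - pulse_lo i k)).
Proof.
have term (k : 'I_(2 ^ N)) : lt0 (1 * t - pulse_lo i.+1 k) +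
    -1 * lt0 (1 * t - pulse_lo i k) =
    if pulse_lo i k <= t < pulse_lo i.+1 k then 1 else 0.
  have lh := pulse_lo_mono (ltn_ord k) (leqnSn i).
  rewrite /lt0 !mul1r !subr_lt0; have [tl|lt_] /= := ltP t (pulse_lo i k).
    by rewrite (lt_le_trans tl lh) mulr1 subrr.
  by rewrite mulr0 addr0; case: ifP.
rewrite (eq_bigr _ (fun k _ => term k)) pulseE.
case: existsP => [[k tin]|nex].
  rewrite (bigD1 k)//= tin big1 ?addr0// => k' kk'; case: ifP => // tin'.
  case/eqP: kk'; apply/val_inj/(dyadic_cell_uniq (pulse_in_cell (ltn_ord k') tin')).
  exact: pulse_in_cell tin.
rewrite big1// => k _; case: ifP => // tin.
by case: nex; exists k.
Qed.

Lemma pulse_bv (i : 'I_q) : bv (pulse N d i).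
Proof.
rewrite (funext (pulse_lt0 i)); apply: bv_sum => k.
by apply: bvD; [|apply: bvZ]; exact: lt0_bv.
Qed.

Lemma pulse_left_const (i : 'I_q) : left_const (pulse N d i).
Proof.
rewrite (funext (pulse_lt0 i)); apply: left_const_sum => k.
by apply: left_constD; [|apply: left_constZ]; exact: left_const_lt0.
Qed.

Lemma PN_bvv : bvv (PN N d).
Proof.
move=> i; have -> : (fun t => PN N d t ord0 i) = left_ext (pulse N d i).
  by apply/funext => t; rewrite mxE.
exact/left_ext_bv/pulse_bv.
Qed.

Lemma PN_simplexp (t : R) : 0 <= t <= 1 -> simplexp (PN N d t).
Proof.
have lt1 (s : R) : 0 <= s -> s < 1 -> simplexp (PN N d s).
  move=> s0 s1; have s01 : 0 <= s < 1 by rewrite s0.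
  have [k kN sk] := cell_exists N s01.
  have [||i iP] := @cum_between (d (dyadic N k)) (s * 2 ^+ N - k%:R); first exact: sd.
    case/andP: sk; rewrite ler_pdivrMr ?exprn_gt0// ltr_pdivlMr ?exprn_gt0//.
    rewrite -natr1 => h1 h2; apply/andP; split; lra.
  exists i; apply/rowP => j; rewrite !mxE eqxx/= left_ext_lt// (pulse_cell _ kN sk).
  have -> : (pulse_lo j k <= s < pulse_lo j.+1 k) = (j == i).
    rewrite -iP /pulse_lo ler_pdivrMl ?exprn_gt0// ltr_pdivlMl ?exprn_gt0//.
    by rewrite mulrC lerBrDl ltrBlDl.
  by case: eqP.
move=> /andP[t0]; rewrite le_eqVlt => /predU1P[->|]; last exact: lt1.
have [s /andP[s0 s1] ps] := left_ext_sample pulse_left_const ltr01.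
have -> : PN N d 1 = PN N d s.
  by apply/rowP => i; rewrite !mxE ps left_ext_lt.
by apply: lt1 => //; exact: ltW.
Qed.

Lemma intR_PN (i : 'I_q) (k : nat) : (k < 2 ^ N)%N ->
  intR (dyadic N k) (dyadic N k.+1) (fun t => PN N d t ord0 i) =
  2 ^- N * d (dyadic N k) ord0 i.
Proof.
move=> kN; have bl a : bmeas (fun t : R => lt0 (1 * t - a)) by exact/bv_bmeas/lt0_bv.
have k1 := @dyadic_le1 R _ _ kN; have lh := pulse_lo_mono kN (leqnSn i).
rewrite (@eq_intR_oo _ _ (fun t => lt0 (1 * t - pulse_lo i.+1 k) -
  lt0 (1 * t - pulse_lo i k)))//; first last.
- move=> t /andP[t1 t2]; have tk : dyadic N k <= t < dyadic N k.+1 by rewrite (ltW t1).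
  rewrite mxE left_ext_lt ?(lt_le_trans t2 k1)// (pulse_cell _ kN tk).
  rewrite /lt0 !mul1r !subr_lt0; have [tl|lt_] /= := ltP t (pulse_lo i k).
    by rewrite (lt_le_trans tl lh) subrr.
  by rewrite subr0.
- exact: bmeasB.
- exact/bv_bmeas/PN_bvv.
- exact: dyadic_ge0.
rewrite intRB ?dyadic_ge0// !intR_lt0 ?dyadic_ge0 ?pulse_lo_ge ?pulse_lo_le//.
by rewrite /pulse_lo cumS; ring.
Qed.

End Pulses.

(** * The projection preserves trajectories up to O(2^-N) *)

Section Rho.
Context {R : realType} {n m q Nc : nat}.
Variables (P : problem R n m q Nc) (L : R).
Hypotheses (L0 : 0 < L) (P_ok : problem_ok P L).
Local Notation U := (inputs P).
Local Notation ctl := (control R m q).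
Local Notation c := (@dimc R n m).
Local Notation traj := (trajectory P).
Local Notation admissible := (admissible P).
Local Notation velocity := (velocity P).
Implicit Types xi eta : ctl.

Let K := L * c.
Let K0 : 0 < K.
Proof. by rewrite mulr_gt0// ltr0n. Qed.

Let convex_inputs : convex_set U.
Proof. by case: P_ok => -[]. Qed.

Lemma FN_sample_simplex xi N : admissible xi ->
  forall k, (k < 2 ^ N)%N -> simplexr (FN N xi.2 (dyadic N k)).
Proof.
move=> [_ sxi _ bd] k kN; apply: (FN_values N (@convex_simplex R q) bd sxi).
by rewrite dyadic_ge0 dyadic_le1// ltnW.
Qed.

Lemma rho_Xp xi N : admissible xi -> Xp P (rho N xi).
Proof.
move=> axi; have [Uxi sxi bu bd] := axi; split; apply/L2BVP; split.
- exact: FN_values.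
- exact: FN_bvv.
- by move=> t; apply: PN_simplexp; exact: FN_sample_simplex.
- by apply: PN_bvv; exact: FN_sample_simplex.
Qed.

Lemma intR_dyadic (f V : R -> R) (N : nat) (M : R) : bmeas f ->
  (forall s t : R, 0 <= s -> s <= t -> t <= 1 -> V s <= V t) ->
  (forall t : R, 0 <= t <= 1 -> `|f t| <= M) ->
  (forall k, (k < 2 ^ N)%N -> `|intR (dyadic N k) (dyadic N k.+1) f| <=
     2 ^- N * (V (dyadic N k.+1) - V (dyadic N k))) ->
  forall t : R, 0 <= t <= 1 -> `|intR 0 t f| <= 2 ^- N * (V 1 - V 0 + M).
Proof.
move=> bf Vm fM cell t t01; have N0 : (0 < 2 ^ N)%N by rewrite expn_gt0.
have := @intR_cells R f V (2 ^ N) M N0 bf Vm fM; rewrite natrX; apply=> //.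
Qed.

(** On each cell the distance to the average is at most the oscillation, and the
    oscillations add up to the total variation, whatever N. *)
Lemma FN_integral_dist k (w : R -> 'rV[R]_k) (B : R) : bvv w ->
  (forall t : R, 0 <= t <= 1 -> `|w t| <= B) -> exists2 C : R, 0 <= C &
  forall N (t : R), 0 <= t <= 1 -> (forall s : R, 0 <= s <= 1 -> `|FN N w s| <= B) ->
    intR 0 t (fun s => `|FN N w s - w s|) <= C / 2 ^+ N.
Proof.
move=> bw wB; have [V wV] := choice bw.
pose W (t : R) := \sum_(i < k) V i t.
have Vm i := majorant_mono (wV i).
have Wm (s t : R) : 0 <= s -> s <= t -> t <= 1 -> W s <= W t.
  by move=> s0 st t1; apply: ler_sum => i _; exact: Vm.
have z01 : 0 <= (0 : R) <= 1 by rewrite lexx ler01.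
have B0 : 0 <= B by exact: le_trans (wB 0 z01).
have W10 : 0 <= W 1 - W 0 by rewrite subr_ge0 Wm.
have WB : 0 <= W 1 - W 0 + (B + B) by apply: addr_ge0 => //; exact: addr_ge0.
exists (W 1 - W 0 + (B + B)) => //.
move=> N t t01 FB; have bF := bvv_bmeasv (FN_bvv N w).
have bd := bmeasvB bF (bvv_bmeasv bw).
have := @intR_dyadic (fun s => `|FN N w s - w s|) W N.+1 (B + B)
  (bmeasv_norm bd) Wm.
move=> /(_ _ _ t t01) => H.
apply: (@le_trans _ _ (2 ^- N.+1 * (W 1 - W 0 + (B + B)))).
  apply: (le_trans (ler_norm _)); apply: H => [s s01|j jN].
    rewrite normr_id; apply: (le_trans (ler_normB _ _)).
    by apply: lerD; [exact: FB|exact: wB].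
  rewrite [leRHS]mulrC -(dyadic_step N.+1 j).
  apply: intR_bound_oo.
  - exact: dyadic_ge0.
  - exact: le_dyadic.
  - exact: dyadic_le1.
  - exact: bmeasv_norm.
  - move=> s /andP[js sj]; have j1 := @dyadic_le1 R _ _ jN.
    have js' := ltW js; have sj' := ltW sj.
    rewrite normr_id (FN_row bw (lt_le_trans sj j1) jN) ?js'//.
    apply: norm_le_coord => [|i].
      by rewrite subr_ge0 Wm ?dyadic_ge0// le_dyadic.
    rewrite !mxE; apply: (@le_trans _ _ (V i (dyadic N.+1 j.+1) - V i (dyadic N.+1 j))).
      apply: (avg_dist jN (wV i)); rewrite ?lexx ?dyadic_ge0 ?js'//.
    rewrite /W (bigD1 i)//= [X in _ <= _ - X](bigD1 i)//= opprD addrACA lerDl.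
    rewrite subr_ge0; apply: ler_sum => i' _.
    by apply: Vm => //; [exact: dyadic_ge0|exact: le_dyadic].
rewrite mulrC; apply: ler_wpM2l => //.
rewrite lef_pV2 ?posrE ?exprn_gt0// exprS ler_peMl ?exprn_ge0//.
by rewrite ler1n.
Qed.

(** Chattering: on each cell the pulse of mode i lasts exactly for the sampled
    value of d_i, so that the oscillating difference integrates to the
    oscillation of d_i over the cell; against a weight G of bounded variation
    it remains small because G hardly moves within a cell. *)
Lemma PN_integral_dist (d : R -> 'rV[R]_q) (i : 'I_q) (G : R -> R) : bvv d ->
  (forall t : R, 0 <= t <= 1 -> simplexr (d t)) -> bv G ->
  exists2 C : R, 0 <= C & forall N (t : R), 0 <= t <= 1 ->
  `|intR 0 t (fun s => (PN N (FN N d) s ord0 i - d s ord0 i) * G s)| <= C / 2 ^+ N.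
Proof.
move=> bd sd bG; have [VG GV] := bG; have [Vd dV] := bd i.
have [B GB] := (bv_bmeas bG).2.
have z01 : 0 <= (0 : R) <= 1 by rewrite lexx ler01.
have B0 : 0 <= B by exact: le_trans (GB 0 z01).
have VGm := majorant_mono GV; have Vdm := majorant_mono dV.
pose V (t : R) := VG t + B * Vd t.
have Vm (s t : R) : 0 <= s -> s <= t -> t <= 1 -> V s <= V t.
  by move=> s0 st t1; rewrite lerD ?VGm// ler_wpM2l// Vdm.
exists (V 1 - V 0 + B); first by rewrite addr_ge0// subr_ge0 Vm.
move=> N t t01.
pose D := PN N (FN N d); pose e (s : R) := D s ord0 i - d s ord0 i.
have sF k : (k < 2 ^ N)%N -> simplexr (FN N d (dyadic N k)).
  move=> kN; apply: (FN_values N (@convex_simplex R q) bd sd).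
  by rewrite dyadic_ge0 dyadic_le1// ltnW.
have bD : bmeas (fun s => D s ord0 i) by exact/bv_bmeas/PN_bvv.
have be : bmeas e by apply: bmeasB => //; exact: bv_bmeas.
have bmG := bv_bmeas bG.
have e1 (s : R) : 0 <= s <= 1 -> `|e s| <= 1.
  move=> s01; have [sD _] := simplexp_simplexr (PN_simplexp sF s01).
  have [sds _] := sd s s01; have /andP[D0 D1] := sD i; have /andP[d0 d1] := sds i.
  by rewrite /e /D; rewrite ler_norml; apply/andP; split; lra.
rewrite mulrC; apply: (@intR_dyadic (fun s => e s * G s) V N B) => //.
- exact: bmeasM.
- by move=> s s01; rewrite normrM -[leRHS]mul1r ler_pM// ?e1 ?GB.
move=> k kN; have k1 := @dyadic_le1 R _ _ kN; have kS := le_dyadic (R := R) N (leqnSn k).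
have k0 := @dyadic_ge0 R N k.
pose a := dyadic (R := R) N k; pose b := dyadic (R := R) N k.+1.
have split_eG : intR a b (fun s => e s * G s) =
    intR a b (fun s => e s * (G s - G a)) + G a * intR a b e.
  rewrite -intRZ// -intRD//; last 2 first.
  - by apply: bmeasM => //; apply: bmeasB => //; exact: bmeas_cst.
  - exact: bmeasZ.
  by apply: eq_intR => s _; ring.
have a01 : 0 <= a <= 1 by rewrite k0 (le_trans kS).
rewrite -/a -/b split_eG [leRHS]mulrC -(dyadic_step N k) -/a -/b.
apply: (le_trans (ler_normD _ _)).
have -> : (V b - V a) * (b - a) = (VG b - VG a) * (b - a) +
    B * ((Vd b - Vd a) * (b - a)) by rewrite /V; ring.
apply: lerD.
  apply: intR_bound => //.
    by apply: bmeasM => //; apply: bmeasB => //; exact: bmeas_cst.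
  move=> s /andP[as_ sb]; have s1 := le_trans sb k1; have s0 := le_trans k0 as_.
  rewrite normrM -[leRHS]mul1r ler_pM ?e1 ?s0//.
  apply: (le_trans (GV a s k0 as_ s1)); rewrite lerD2r; exact: VGm.
rewrite normrM ler_pM ?GB//.
pose dl := FN N d a ord0 i.
have dlE : dl = avg N.+1 (fun s => d s ord0 i) k.*2.
  have k2N : (k.*2 < 2 ^ N.+1)%N by rewrite expnS mul2n ltn_double.
  have a1 : a < 1 by apply: (lt_le_trans (lt_dyadic N (ltnSn k))).
  rewrite /dl (FN_row bd a1 k2N) ?mxE//.
  by rewrite -dyadicS -/a lexx /a [X in X < _]dyadicS lt_dyadic.
have -> : intR a b e = intR a b (fun s => dl - d s ord0 i).
  rewrite /e [LHS]intRB//; last exact: bv_bmeas.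
  rewrite [RHS]intRB//; [|exact: bmeas_cst|exact: bv_bmeas].
  congr (_ - _); rewrite intR_cst// (intR_PN sF i kN) /dl -/a.
  by rewrite mulrC -(dyadic_step N k).
apply: intR_bound => //.
  by apply: bmeasB; [exact: bmeas_cst|exact: bv_bmeas].
move=> s /andP[as_ sb]; rewrite dlE; apply: (avg_dist _ dV) => //.
- by rewrite expnS mul2n ltn_double.
- by rewrite -dyadicS.
- by rewrite /b (dyadicS N k.+1) doubleS; apply: le_dyadic.
- by rewrite as_.
Qed.

Lemma field_bv xi i j : admissible xi ->
  bv (fun t => vfield P i t (traj xi t) (xi.1 t) ord0 j).
Proof.
move=> axi; have [Uxi _ bu _] := axi; have [B B0 tB] := trajectory_lipschitz L0 P_ok.
have [V uV] := choice bu.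
exists (fun t => K * (t + B * t + \sum_(k < m) V k t)) => s t s0 st t1.
have s01 : 0 <= s <= 1 by rewrite s0 (le_trans st).
have t01 : 0 <= t <= 1 by rewrite t1 (le_trans s0).
have := field_lipschitz L0 P_ok i (traj xi t) (traj xi s) t01 s01 (Uxi t t01) (Uxi s s01).
have := coord_le_norm (vfield P i t (traj xi t) (xi.1 t) -
  vfield P i s (traj xi s) (xi.1 s)) j.
rewrite !mxE => /le_trans/[apply] /le_trans; apply; rewrite -/K -mulrBr ler_pM2l//.
have h1 : `|t - s| = t - s by rewrite ger0_norm// subr_ge0.
have h2 := tB xi axi s t s0 st t1.
have h3 : `|xi.1 t - xi.1 s| <= \sum_(k < m) V k t - \sum_(k < m) V k s.
  rewrite -sumrB; apply: norm_le_coord => [|k].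
    by apply: sumr_ge0 => k _; rewrite subr_ge0; apply: (majorant_mono (uV k)).
  rewrite !mxE (bigD1 k)//=; apply: (le_trans (uV k s t s0 st t1)).
  rewrite lerDl; apply: sumr_ge0 => k' _; rewrite subr_ge0.
  exact: (majorant_mono (uV k')).
rewrite h1; apply: (le_trans (lerD (lerD (lexx _) h2) h3)).
by rewrite le_eqVlt; apply/orP; left; apply/eqP; ring.
Qed.

(** The input enters through its L1 distance to its averages; the modes enter
    through integrals of d - PN (FN d) against fields along the fixed
    trajectory, which have bounded variation in time. *)
Lemma rho_trajectory xi : admissible xi -> exists2 C : R, 0 <= C &
  forall N (t : R), 0 <= t <= 1 -> `|traj (rho N xi) t - traj xi t| <= C / 2 ^+ N.
Proof.
move=> axi; have [Uxi sxi bu bd] := axi; have [B B0 UB] := inputs_bounded P_ok.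
have uB (t : R) : 0 <= t <= 1 -> `|xi.1 t| <= B by move=> t01; apply: UB; exact: Uxi.
have [Cu Cu0 uC] := FN_integral_dist bu uB.
have /choice[Cd dC] : forall ij : 'I_q * 'I_n, exists C : R, 0 <= C /\
    forall N (t : R), 0 <= t <= 1 ->
    `|intR 0 t (fun s => (PN N (FN N xi.2) s ord0 ij.1 - xi.2 s ord0 ij.1) *
      vfield P ij.1 s (traj xi s) (xi.1 s) ord0 ij.2)| <= C / 2 ^+ N.
  move=> [i j]; have [C C0 hC] := PN_integral_dist i bd sxi (field_bv i j axi).
  by exists C.
pose Cs := \sum_(ij : 'I_q * 'I_n) Cd ij.
have Cs0 : 0 <= Cs by apply: sumr_ge0 => ij _; case: (dC ij).
pose C := K * Cu + Cs; have C0 : 0 <= C by rewrite addr_ge0// mulr_ge0// ltW.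
exists (2 * C * weight K 1).
  by rewrite !mulr_ge0//; exact/ltW/weight_gt0.
move=> N t t01; pose eta := rho N xi.
have aeta : admissible eta by apply/XrP/Xp_Xr; exact: rho_Xp.
have [Ueta seta _ _] := aeta.
have N0 : 0 <= (2 ^+ N)^-1 :> R by rewrite invr_ge0 exprn_ge0.
have -> : 2 * C * weight K 1 / 2 ^+ N = 2 * (C / 2 ^+ N) * weight K 1 by ring.
apply: (trajectory_stable L0 P_ok axi aeta) t01; first exact: mulr_ge0.
move=> {}t t01; have /andP[t0 t1] := t01.
have bx := trajectory_bmeasv L0 P_ok axi.
have b1 : bmeasv (fun s => rhs P s (traj xi s) (eta.1 s) (eta.2 s)).
  exact: (rhs_bmeasv L0 P_ok aeta aeta bx).
have b2 : bmeasv (fun s => rhs P s (traj xi s) (xi.1 s) (eta.2 s)).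
  exact: (rhs_bmeasv L0 P_ok axi aeta bx).
apply: norm_le_coord => [|j]; first exact: mulr_ge0.
pose h1 (s : R) := rhs P s (traj xi s) (eta.1 s) (eta.2 s) ord0 j -
  rhs P s (traj xi s) (xi.1 s) (eta.2 s) ord0 j.
pose h2 i (s : R) := (eta.2 s ord0 i - xi.2 s ord0 i) *
  vfield P i s (traj xi s) (xi.1 s) ord0 j.
have bh1 : bmeas h1 by apply: bmeasB; [exact: b1|exact: b2].
have bh2 i : bmeas (h2 i).
  apply: bmeasM; last exact: (field_bmeasv L0 P_ok i axi bx).
  have [_ _ _ be] := aeta.
  by apply: bmeasB; exact: bv_bmeas.
rewrite mxE (@eq_intR _ _ _ _ (fun s => h1 s + \sum_(i < q) h2 i s)); last first.
  move=> s _; rewrite /h1 /h2 /velocity /rhs !mxE !summxE -!sumrB -big_split/=.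
  by apply: eq_bigr => i _; rewrite !mxE; ring.
rewrite intRD//; last exact: bmeas_sum.
rewrite intR_sum// [leRHS]mulrDl; apply: (le_trans (ler_normD _ _)); apply: lerD.
  apply: (le_trans (intR_abs (lexx 0) t1 bh1)).
  have FB (s : R) : 0 <= s <= 1 -> `|FN N xi.1 s| <= B.
    by move=> s01; apply: UB; exact: (Ueta s s01).
  have bu1 : bmeasv (fun s => FN N xi.1 s - xi.1 s).
    by apply: bmeasvB; apply: bvv_bmeasv => //; exact: FN_bvv.
  rewrite -mulrA; apply: (@le_trans _ _ (K * intR 0 t (fun s => `|FN N xi.1 s - xi.1 s|))).
    rewrite -intRZ//; last exact: bmeasv_norm.
    apply: le_intR => //; [exact: bmeas_norm|by apply: bmeasZ; exact: bmeasv_norm|].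
    move=> s /andP[s0 st]; have s01 : 0 <= s <= 1 by rewrite s0 (le_trans st t1).
    have := coord_le_norm (rhs P s (traj xi s) (eta.1 s) (eta.2 s) -
      rhs P s (traj xi s) (xi.1 s) (eta.2 s)) j.
    rewrite !mxE => /le_trans; apply.
    have := rhs_lipschitz L0 P_ok (traj xi s) (traj xi s) s01 (Ueta s s01)
      (Uxi s s01) (seta s s01).
    by rewrite [traj xi s - _]subrr normr0 add0r.
  by rewrite ler_pM2l//; exact: uC.
apply: (le_trans (ler_norm_sum _ _ _)).
apply: (@le_trans _ _ (\sum_(i < q) Cd (i, j) / 2 ^+ N)).
  by apply: ler_sum => i _; have [_] := dC (i, j); exact.
rewrite -mulr_suml ler_wpM2r// /Cs.
rewrite (eq_bigr (fun ij : 'I_q * 'I_n => Cd (ij.1, ij.2))); last by case.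
rewrite -(pair_bigA _ (fun i j => Cd (i, j)))/=.
apply: ler_sum => i _; rewrite (bigD1 j)//= lerDl.
by apply: sumr_ge0 => j' _; case: (dC (i, j')).
Qed.

End Rho.

(** * Convergence of the algorithm *)

Lemma if_elim (b : bool) (A B : Prop) : (if b then A else B) ->
  (b -> A) /\ (b = false -> B).
Proof. by case: b. Qed.

Lemma if_intro (b : bool) (A B : Prop) : (b -> A) -> (b = false -> B) ->
  if b then A else B.
Proof. by case: b => hA hB; [exact: hA | exact: hB]. Qed.

Section Generalities.
Context {R : realType}.

Lemma least_spec (A : set nat) (k : nat) : A k -> A (least A) /\ (least A <= k)%N.
Proof.
move=> Ak; have [] := @xgetPex _ 0%N [set k | A k /\ forall l, A l -> (k <= l)%N].
  have ex : exists k, `[< A k >] by exists k; apply/asboolP.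
  case: (ex_minnP ex) => j /asboolP Aj jmin; exists j; split=> // l Al.
  by apply: jmin; apply/asboolP.
by move=> Al lmin; split=> //; exact: lmin.
Qed.

Lemma lerB_trans (u v w p r : R) : v - w <= p -> u - v <= r -> u - w <= p + r.
Proof. by move=> *; lra. Qed.

Lemma lerB_add (u v p r : R) : v <= p -> u - v <= r -> u <= p + r.
Proof. by move=> *; lra. Qed.

Lemma ler_slack (w a b : R) : b <= (1 - w) * a -> w * a <= a - b.
Proof. by move=> *; lra. Qed.

Lemma lerB_drop (u v p k : R) : u - v <= p -> p <= - k -> u <= v - k.
Proof. by move=> *; lra. Qed.

Lemma expr_small (x e : R) : 0 <= x -> x < 1 -> 0 < e ->
  \forall k \near \oo, x ^+ k <= e.
Proof.
move=> x0 x1 e0; have xn : `|x| < 1 by rewrite ger0_norm.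
have /cvgrPdist_le /(_ e e0) := cvg_expr xn.
apply: filterS => k; rewrite sub0r normrN ger0_norm// exprn_ge0//.
Qed.

(** A nonincreasing merit that is bounded below cannot drop infinitely often by
    a fixed amount. *)
Lemma descent_cvg0 (th a : nat -> R) (b : R) (j0 : nat) :
  (forall j, (j0 <= j)%N -> th j <= 0) -> (forall j, (j0 <= j)%N -> b <= a j) ->
  (forall j, (j0 <= j)%N -> a j.+1 <= a j) ->
  (forall e, 0 < e -> exists2 k, 0 < k & forall j, (j0 <= j)%N ->
     th j <= - e -> a j.+1 <= a j - k) ->
  th i @[i --> \oo] --> 0.
Proof.
move=> th0 ba mono drop; apply/cvgrPdist_lt => e e0.
have [k k0 dropk] := drop e e0.
pose Q := [set a j | j in [set j | (j0 <= j)%N]].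
have hQ : has_inf Q.
  split; first by exists (a j0), j0 => /=.
  by exists b => _ [j jj <-]; exact: ba.
have [_ [j1 /= j01 <-] aj1] := inf_adherent k0 hQ.
exists j1 => // j /= j1j; have j0j := leq_trans j01 j1j.
have ajj1 : a j <= a j1.
  rewrite -(subnKC j1j); elim: (j - j1)%N => [|i IH]; first by rewrite addn0.
  rewrite addnS; apply: le_trans IH; apply: mono.
  exact: leq_trans j01 (leq_addr _ _).
rewrite sub0r normrN ler0_norm ?th0// ltNge; apply/negP => the.
have := dropk j j0j; rewrite lerNr the => /(_ isT) aj.
have : inf Q <= a j.+1 by apply: (ge_inf hQ.2); exists j.+1 => //=; exact: leqW.
by move=> infa; have := le_lt_trans ajj1 aj1; lra.
Qed.

Lemma L2norm_ge0 k (w : R -> 'rV[R]_k) : 0 <= L2norm w.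
Proof. exact: sqrtr_ge0. Qed.

Lemma normX_ge0 m q (x : control R m q) : 0 <= normX x.
Proof. by rewrite addr_ge0// L2norm_ge0. Qed.

Lemma L2norm0 k : L2norm (0 : R -> 'rV[R]_k) = 0.
Proof.
have e0 : enorm (0 : 'rV[R]_k) = 0.
  by rewrite -(scale0r (0 : 'rV[R]_k)) enormZ normr0 mul0r.
rewrite /L2norm (@eq_Rintegral _ _ _ _ _ (fun=> 0)).
  by rewrite Rintegral_cst// mul0r sqrtr0.
by move=> t _; rewrite /= e0 expr0n.
Qed.

Lemma normX0 m q : normX (0 : control R m q) = 0.
Proof. by rewrite /normX !L2norm0 addr0. Qed.

Lemma DD0 m q (G : control R m q -> R) x : DD G x 0 = 0.
Proof.
rewrite /DD (_ : (fun l => _) = fun=> 0); first by apply: cvg_lim => //; exact: cvg_cst.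
by apply/funext => l; rewrite scaler0 addr0 subrr mul0r.
Qed.

End Generalities.

Section Algorithm.
Context {R : realType} {n m q Nc : nat}.
Variables (P : problem R n m q Nc) (L : R) (S : alg_params R).
Hypotheses (Nc_gt0 : (0 < Nc)%N) (L0 : 0 < L) (P_ok : problem_ok P L).
Hypothesis S_ok : alg_params_ok S.
Variable g : control R m q -> control R m q.
Hypothesis g_argmin : is_argmin_map P S g.
Local Notation ctl := (control R m q).
Local Notation admissible := (admissible P).
Local Notation J := (J P).
Local Notation psi := (psi P).
Local Notation Psi := (Psi P).
Local Notation theta := (theta P S).
Implicit Types xi eta : ctl.

Let one01 : 0 <= (1 : R) <= 1. Proof. by rewrite ler01 lexx. Qed.
Let zero01 : 0 <= (0 : R) <= 1. Proof. by rewrite ler01 lexx. Qed.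
Let hcost : diff_lipschitz L (cost P). Proof. by case: P_ok => _ _ h _; exact: h. Qed.
Let hconstr j : diff_lipschitz L (constr P j).
Proof. by case: P_ok => _ _ _ h; exact: (h j). Qed.

Lemma Xp_admissible xi : Xp P xi -> admissible xi.
Proof. by move=> /Xp_Xr/XrP. Qed.

Lemma J_bounded : exists B : R, forall xi, admissible xi -> `|J xi| <= B.
Proof.
have [B JB] := functional_bounded L0 P_ok hcost.
by exists B => xi axi; exact: JB.
Qed.

Lemma psi_bounded : exists B : R, forall j (t : R) xi, 0 <= t <= 1 ->
  admissible xi -> `|psi j t xi| <= B.
Proof.
have /choice[B pB] : forall j : 'I_Nc, exists B : R, forall xi (t : R),
    admissible xi -> 0 <= t <= 1 -> `|constr P j (phi P t xi)| <= B.
  by move=> j; exact: (functional_bounded L0 P_ok (hconstr j)).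
exists (\sum_(j < Nc) `|B j|) => j t xi t01 axi.
apply: (le_trans (pB j xi t axi t01)); apply: (le_trans (ler_norm _)).
by rewrite (bigD1 j)//= lerDl sumr_ge0.
Qed.

Let j0 : 'I_Nc := Ordinal Nc_gt0.

Lemma sup_jt_ge (F : 'I_Nc -> R -> R) (B : R) j (t : R) :
  (forall j (t : R), 0 <= t <= 1 -> F j t <= B) -> 0 <= t <= 1 ->
  F j t <= sup [set F j t | j in [set: 'I_Nc] & t in `[0 : R, 1]].
Proof.
move=> FB t01; apply: ub_le_sup.
  by exists B => _ [i _ [s + <-]]; rewrite /= in_itv/= => s01; exact: FB.
by exists j => //; exists t => //=; rewrite in_itv.
Qed.

Lemma sup_jt_le (F : 'I_Nc -> R -> R) (B : R) :
  (forall j (t : R), 0 <= t <= 1 -> F j t <= B) ->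
  sup [set F j t | j in [set: 'I_Nc] & t in `[0 : R, 1]] <= B.
Proof.
move=> FB; apply: ge_sup.
  by exists (F j0 0), j0 => //; exists 0 => //=; rewrite in_itv.
by move=> _ [i _ [s + <-]]; rewrite /= in_itv/= => s01; exact: FB.
Qed.

Lemma psi_le_Psi j (t : R) xi : 0 <= t <= 1 -> admissible xi ->
  psi j t xi <= Psi xi.
Proof.
move=> t01 axi; have [B pB] := psi_bounded.
apply: (@sup_jt_ge (fun j t => psi j t xi) B) => // i s s01.
exact: le_trans (ler_norm _) (pB i s xi s01 axi).
Qed.

Lemma Psi_le (b : R) xi : (forall j (t : R), 0 <= t <= 1 -> psi j t xi <= b) ->
  Psi xi <= b.
Proof. exact: sup_jt_le. Qed.

(** One constant serves all admissible controls and all constraint indices, which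
    makes the Armijo step uniform. *)
Lemma first_order : exists2 C : R, 0 < C & forall xi eta, admissible xi ->
  admissible eta -> forall l : R, 0 <= l <= 1 ->
  `|J (seg l xi eta) - J xi - l * DD J xi (eta - xi)| <= C * l ^+ 2 /\
  forall j (t : R), 0 <= t <= 1 ->
  `|psi j t (seg l xi eta) - psi j t xi - l * DD (psi j t) xi (eta - xi)|
    <= C * l ^+ 2.
Proof.
have [C C0 hC] := functional_second L0 P_ok; exists C; first exact: C0.
move=> xi eta axi aeta l l01; split=> [|j t t01].
  exact: (directional_derivative (ltW C0) (hC (cost P) 1 hcost one01) axi aeta l01).
exact: (directional_derivative (ltW C0) (hC (constr P j) t (hconstr j) t01)
  axi aeta l01).
Qed.

Lemma DD_psi_le xi eta j (t : R) : admissible xi -> admissible eta ->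
  0 <= t <= 1 -> DD (psi j t) xi (eta - xi) <= maxDpsi P xi (eta - xi).
Proof.
move=> axi aeta t01; have [B pB] := psi_bounded; have [C C0 hC] := first_order.
apply: (@sup_jt_ge (fun j t => DD (psi j t) xi (eta - xi)) (C + (B + B))) => // i s s01.
have [_ /(_ i s s01)] := hC xi eta axi aeta 1 one01.
rewrite seg1 mul1r expr1n mulr1 ler_norml => /andP[h _].
have h1 := pB i s xi s01 axi; have h2 := pB i s eta s01 aeta.
move: h1 h2; rewrite !ler_norml => /andP[h1 h1'] /andP[h2 h2'].
by move: h h1 h1' h2 h2'; move: (DD _ _ _) (psi i s eta) (psi i s xi) => *; lra.
Qed.

Lemma theta_attained xi : Xp P xi -> theta xi = zeta P S xi (g xi).
Proof.
move=> /g_argmin[[Xg gmin] _]; apply/eqP; rewrite eq_le; apply/andP; split.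
  apply: ge_inf; last by exists (g xi).
  by exists (zeta P S xi (g xi)) => _ [eta Xeta <-]; exact: gmin.
apply: lb_le_inf; first by exists (zeta P S xi (g xi)), (g xi).
by move=> _ [eta Xeta <-]; exact: gmin.
Qed.

Lemma g_admissible xi : Xp P xi -> admissible (g xi).
Proof. by move=> /g_argmin[[/XrP]]. Qed.

(** The control xi itself is a competitor, and all its directional derivatives
    vanish. *)
Lemma theta_le0 xi : Xp P xi -> theta xi <= 0.
Proof.
move=> Xxi; have [[_ gmin] _] := g_argmin Xxi.
rewrite theta_attained//; apply: (le_trans (gmin xi (Xp_Xr Xxi))).
have [g0 _ _ _] := S_ok.
have D0 : maxDpsi P xi 0 <= 0 by apply: sup_jt_le => j t _; rewrite DD0.
rewrite /zeta subrr normX0 DD0; case: ifP => Pxi; rewrite addr0.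
  by rewrite ge_max lexx/= -[leRHS]addr0 lerD// mulr_ge0_le0// ltW.
by rewrite ge_max D0 andbT sub0r oppr_le0 ltW// ltNge Pxi.
Qed.

Lemma theta_feasible xi : Xp P xi -> Psi xi <= 0 ->
  DD J xi (g xi - xi) <= theta xi /\ forall j (t : R), 0 <= t <= 1 ->
  DD (psi j t) xi (g xi - xi) + gamma S * Psi xi <= theta xi.
Proof.
move=> Xxi Pxi; have axi := Xp_admissible Xxi; have ag := g_admissible Xxi.
rewrite theta_attained// /zeta Pxi; have n0 := normX_ge0 (g xi - xi).
set a := DD J xi _; set b := maxDpsi _ _ _ + _.
have amax : a <= Num.max a b by rewrite le_max lexx.
have bmax : b <= Num.max a b by rewrite le_max lexx orbT.
split=> [|j t t01]; first by apply: (le_trans amax); rewrite lerDl.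
apply: (@le_trans _ _ b); first by rewrite lerD2r DD_psi_le.
by apply: (le_trans bmax); rewrite lerDl.
Qed.

Lemma theta_infeasible xi : Xp P xi -> 0 < Psi xi -> forall j (t : R),
  0 <= t <= 1 -> DD (psi j t) xi (g xi - xi) <= theta xi.
Proof.
move=> Xxi Pxi j t t01; have axi := Xp_admissible Xxi; have ag := g_admissible Xxi.
rewrite theta_attained// /zeta [Psi xi <= 0]leNgt Pxi/=; have n0 := normX_ge0 (g xi - xi).
apply: (le_trans (DD_psi_le j axi ag t01)).
apply: (@le_trans _ _ (Num.max (DD J xi (g xi - xi) - Psi xi)
  (maxDpsi P xi (g xi - xi)))); first by rewrite le_max lexx orbT.
by rewrite lerDl.
Qed.

Let alpha01 : 0 < alpha S < 1. Proof. by case: S_ok => _ []. Qed.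
Let beta01 : 0 < beta S < 1. Proof. by case: S_ok => _ []. Qed.
Let omega01 : 0 < omega S < 1. Proof. by case: S_ok => _ []. Qed.

(** For l small compared with e, the linear decrease l theta dominates the
    remainder C l^2; in the feasible case gamma l <= 1 moreover keeps the term
    (1 - gamma l) Psi nonpositive. *)
Lemma mu_test_uniform (e : R) : 0 < e ->
  exists M, forall xi, Xp P xi -> theta xi <= - e -> mu_test P S g xi M.
Proof.
move=> e0; have [C C0 hC] := first_order; have [g0 _ _ _] := S_ok.
have /andP[a0 a1] := alpha01; have /andP[b0 b1] := beta01.
pose l0 := Num.min (gamma S)^-1 ((1 - alpha S) * e / C).
have l00 : 0 < l0.
  by rewrite lt_min invr_gt0 g0/= divr_gt0// mulr_gt0// subr_gt0.
have /filter_ex[M Ml] := expr_small (ltW b0) b1 l00.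
exists M => xi Xxi the; have axi := Xp_admissible Xxi; have ag := g_admissible Xxi.
pose l := beta S ^+ M; have l_gt0 : 0 < l by rewrite exprn_gt0.
have l01 : 0 <= l <= 1 by rewrite ltW//= exprn_ile1// ltW.
have lg : gamma S * l <= 1.
  by rewrite -ler_pdivlMl// mulr1 (le_trans Ml)// ge_min lexx.
have Cl : C * l <= (1 - alpha S) * e.
  by rewrite -ler_pdivlMl// mulrC (le_trans Ml)// ge_min lexx orbT.
have decr : l * theta xi + C * l ^+ 2 <= alpha S * l * theta xi.
  have h1 : l * (C * l) <= l * ((1 - alpha S) * e) by rewrite ler_pM2l.
  have h2 : l * ((1 - alpha S) * theta xi) <= l * ((1 - alpha S) * - e).
    by rewrite ler_pM2l// ler_pM2l// subr_gt0.
  by move: (theta xi) h1 h2 => th; lra.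
have [hJ hpsi] := hC xi (g xi) axi ag l l01.
rewrite /mu_test -/l; have -> : xi_step S g xi M = seg l xi (g xi) by [].
case: ifP => Pxi.
  have [tJ tpsi] := theta_feasible Xxi Pxi; split.
    apply: le_trans decr; move: hJ; rewrite ler_norml => /andP[_].
    have : l * DD J xi (g xi - xi) <= l * theta xi by rewrite ler_pM2l.
    by move: (DD J xi _) (theta xi) (J _) => D th Js; lra.
  apply: Psi_le => j t t01; apply: le_trans decr.
  have := hpsi j t t01; rewrite ler_norml => /andP[_].
  have : l * (DD (psi j t) xi (g xi - xi) + gamma S * Psi xi) <= l * theta xi.
    by rewrite ler_pM2l// tpsi.
  have : (1 - gamma S * l) * Psi xi <= 0.
    by rewrite mulr_ge0_le0// subr_ge0.
  have := psi_le_Psi j t01 axi.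
  move: (DD _ _ _) (theta xi) (Psi xi) (psi j t xi) (psi j t _) => D th Ps p p'.
  by move: (l ^+ 2) => l2; lra.
have {}Pxi : 0 < Psi xi by rewrite ltNge Pxi.
rewrite lerBlDr; apply: Psi_le => j t t01; rewrite -lerBlDr.
apply: le_trans decr; have := hpsi j t t01; rewrite ler_norml => /andP[_].
have : l * DD (psi j t) xi (g xi - xi) <= l * theta xi.
  by rewrite ler_pM2l// theta_infeasible.
have := psi_le_Psi j t01 axi.
move: (DD _ _ _) (theta xi) (Psi xi) (psi j t xi) (psi j t _) => D th Ps p p'.
by move: (l ^+ 2) => l2; lra.
Qed.

Lemma rho_functionals xi : admissible xi -> exists2 C : R, 0 <= C &
  forall N, J (rho N xi) - J xi <= C / 2 ^+ N /\
            Psi (rho N xi) - Psi xi <= C / 2 ^+ N.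
Proof.
move=> axi; have [C C0 hC] := rho_trajectory L0 P_ok axi.
pose K := L * @dimc R n m; have K0 : 0 <= K by rewrite mulr_ge0 ?ltW// dimc_ge0.
exists (K * C); first exact: mulr_ge0.
move=> N; have lip h (t : R) : diff_lipschitz L h -> 0 <= t <= 1 ->
    h (phi P t (rho N xi)) - h (phi P t xi) <= K * C / 2 ^+ N.
  move=> hh t01; apply: (le_trans (ler_norm _)).
  apply: (le_trans (@diff_lipschitz_lip R n m L L0 h _ _ hh)).
  by rewrite -[leRHS]mulrA ler_wpM2l//; exact: hC.
split; first exact: lip.
rewrite lerBlDr; apply: Psi_le => j t t01.
have := lip _ t (hconstr j) t01; rewrite lerBlDr => /le_trans; apply.
by rewrite lerD2l psi_le_Psi.
Qed.

(** The rate 2^-k of the projection beats the slack alphabar betabar^k granted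
    to it because betabar > 1/2. *)
Lemma nu_test_exists xi : Xp P xi -> theta xi < 0 ->
  mu_test P S g xi (mu P S g xi) -> exists k, nu_test P S g xi k.
Proof.
move=> Xxi th0 mt; have axi := Xp_admissible Xxi; have ag := g_admissible Xxi.
have /andP[a0 a1] := alpha01; have /andP[b0 b1] := beta01.
have /andP[w0 w1] := omega01.
have [_ _ ab0 /andP[bb0 bb1]] := S_ok.
set xi' := xi_step S g xi (mu P S g xi).
have l01 : 0 <= beta S ^+ mu P S g xi <= 1.
  by rewrite exprn_ge0 ?exprn_ile1// ltW.
have axi' : admissible xi' by exact: (admissible_seg P_ok axi ag l01).
have [C C0 hC] := rho_functionals axi'.
pose a := alpha S * beta S ^+ mu P S g xi.
have a_gt0 : 0 < a by rewrite mulr_gt0// exprn_gt0.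
have half : 2^-1 < betabar S.
  apply: lt_trans bb0; rewrite ltf_pV2 ?posrE// ?sqrtr_gt0//.
  rewrite ltNge; apply/negP => s2.
  have := ler_pM (ler0n R 2) (ler0n R 2) s2 s2.
  by rewrite -[leRHS]expr2 sqr_sqrtr ?ler0n// -natrM ler_nat.
have bp : 0 < betabar S by apply: lt_trans half; rewrite invr_gt0.
pose x := (2 * betabar S)^-1.
have b2 : 1 < 2 * betabar S by rewrite -ltr_pdivrMl ?mulr1.
have x0 : 0 <= x by rewrite invr_ge0 ltW// mulr_gt0.
have x1 : x < 1 by rewrite invf_lt1// mulr_gt0.
have e1 : 0 < (1 - omega S) * a / alphabar S.
  by rewrite divr_gt0// mulr_gt0// subr_gt0.
have e2 : 0 < alphabar S * - theta xi / (C + 1).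
  by rewrite divr_gt0 ?mulr_gt0 ?oppr_gt0// ltr_wpDl.
have near1 := expr_small (ltW bp) bb1 e1; have near2 := expr_small x0 x1 e2.
have /filter_ex[k [k1 k2]] : \forall k \near \oo, betabar S ^+ k <=
    (1 - omega S) * a / alphabar S /\ x ^+ k <= alphabar S * - theta xi / (C + 1).
  by apply: filterS2 near1 near2.
exists k; rewrite /nu_test -/xi' -/a.
pose b := alphabar S * betabar S ^+ k.
have ba : b <= (1 - omega S) * a by rewrite /b mulrC -ler_pdivlMr.
have rate : C / 2 ^+ k <= b * - theta xi.
  have bk : 0 < betabar S ^+ k by rewrite exprn_gt0.
  have xk : x ^+ k = (2 ^+ k)^-1 / betabar S ^+ k.
    by rewrite exprVn exprMn invfM.
  have C1 : 0 < C + 1 by rewrite ltr_wpDl.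
  rewrite xk ler_pdivlMr// mulrAC ler_pdivrMr// in k2.
  rewrite /b -mulrA [_ * - _]mulrC mulrA; apply: le_trans k2.
  by rewrite mulrC ler_wpM2l ?invr_ge0 ?exprn_ge0// lerDl.
have [rJ rPsi] := hC k.
have slack : a * theta xi + C / 2 ^+ k <= (a - b) * theta xi.
  by rewrite mulrBl lerD2l -mulrN.
have [mfeas minf] := if_elim mt.
split; first exact: ba.
apply: if_intro => Pxi.
  have [mJ mPsi] := mfeas Pxi.
  split; first exact: (le_trans (lerB_trans mJ rJ) slack).
  apply: (le_trans (le_trans (lerB_add mPsi rPsi) slack)).
  rewrite mulr_ge0_le0 ?subr_ge0 ?(ltW th0)//.
  by apply: (le_trans ba); rewrite ler_piMl ?(ltW a_gt0)// gerBl ltW.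
exact: (le_trans (lerB_trans (minf Pxi) rPsi) slack).
Qed.

(** Writing a = alpha beta^mu, the bound alphabar betabar^nu <= (1 - omega) a leaves
    a decrease of at least omega a |theta|, and a >= alpha beta^M where M depends
    on e alone. *)
Lemma step_decrease (e : R) : 0 < e -> exists2 k, 0 < k & forall xi, Xp P xi ->
  theta xi <= - e -> let eta := algorithmA_step P S g xi in
  [/\ Xp P eta, Psi xi <= 0 -> J eta <= J xi - k /\ Psi eta <= 0 &
    (Psi xi <= 0) = false -> Psi eta <= Psi xi - k].
Proof.
move=> e0; have [M hM] := mu_test_uniform e0.
have /andP[a0 a1] := alpha01; have /andP[b0 b1] := beta01.
have /andP[w0 w1] := omega01.
exists (omega S * (alpha S * beta S ^+ M) * e).
  by rewrite !mulr_gt0// exprn_gt0.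
move=> xi Xxi the; have axi := Xp_admissible Xxi; have ag := g_admissible Xxi.
have th0 : theta xi < 0 by apply: (le_lt_trans the); rewrite oppr_lt0.
have [mt muM] := least_spec (A := [set k | mu_test P S g xi k]) (hM xi Xxi the).
rewrite -/(mu P S g xi) in mt muM.
have [k hk] := nu_test_exists Xxi th0 mt.
have [nt _] := least_spec (A := [set k | nu_test P S g xi k]) hk.
rewrite -/(nu P S g xi) in nt.
have stepE : algorithmA_step P S g xi =
    rho (nu P S g xi) (xi_step S g xi (mu P S g xi)).
  by rewrite /algorithmA_step (lt_eqF th0).
pose a := alpha S * beta S ^+ mu P S g xi.
pose b := alphabar S * betabar S ^+ nu P S g xi.
have [ba /if_elim[nfeas ninf]] : b <= (1 - omega S) * a /\ if Psi xi <= 0 then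
    J (algorithmA_step P S g xi) - J xi <= (a - b) * theta xi /\
    Psi (algorithmA_step P S g xi) <= 0
  else Psi (algorithmA_step P S g xi) - Psi xi <= (a - b) * theta xi.
  by rewrite stepE; exact: nt.
have aM : alpha S * beta S ^+ M <= a by rewrite ler_pM2l// ler_wiXn2l// ltW.
have decr : (a - b) * theta xi <= - (omega S * (alpha S * beta S ^+ M) * e).
  have wa : omega S * (alpha S * beta S ^+ M) <= a - b.
    have h : omega S * (alpha S * beta S ^+ M) <= omega S * a by rewrite ler_pM2l.
    exact: le_trans h (ler_slack ba).
  have p0 : 0 <= omega S * (alpha S * beta S ^+ M).
    by rewrite !mulr_ge0 ?exprn_ge0 ?ltW.
  apply: (@le_trans _ _ ((a - b) * - e)).
    by apply: ler_wpM2l => //; exact: le_trans wa.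
  rewrite mulrN lerN2; apply: ler_wpM2r => //; exact: ltW.
split=> [|Pxi|Pxi].
- rewrite stepE; apply: (rho_Xp P_ok); apply: (admissible_seg P_ok axi ag).
  by rewrite exprn_ge0 ?exprn_ile1// ltW.
- by have [hJ hPsi] := nfeas Pxi; split; [exact: (lerB_drop hJ decr)|exact: hPsi].
- exact: (lerB_drop (ninf Pxi) decr).
Qed.

Lemma step_nonincreasing xi : Xp P xi -> let eta := algorithmA_step P S g xi in
  [/\ Xp P eta, Psi xi <= 0 -> J eta <= J xi /\ Psi eta <= 0 &
    (Psi xi <= 0) = false -> Psi eta <= Psi xi].
Proof.
move=> Xxi; have := theta_le0 Xxi; rewrite le_eqVlt => /predU1P[th0|th0].
  have -> : algorithmA_step P S g xi = xi by rewrite /algorithmA_step th0 eqxx.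
  by split=> // Pxi; split.
have e0 : 0 < - theta xi by rewrite oppr_gt0.
have [k k0 hk] := step_decrease e0.
have the : theta xi <= - - theta xi by rewrite opprK.
have [Xs feas inf_] := hk xi Xxi the.
have drop (u : R) : u - k <= u by rewrite gerBl ltW.
split=> [//|Pxi|Pxi]; last exact: (le_trans (inf_ Pxi) (drop _)).
by have [hJ hPsi] := feas Pxi; split; [exact: (le_trans hJ (drop _))|exact: hPsi].
Qed.

(** Feasibility is never lost.  Once it is reached the merit is J, which is
    bounded below on bounded trajectories; if it is never reached the merit is
    Psi, which stays positive. *)
Lemma theta_cvg0 (xi : nat -> ctl) : generated_by_A P S g xi ->
  theta (xi i) @[i --> \oo] --> (0 : R).
Proof.
move=> [X0 xiS]; have X j : Xp P (xi j).
  by elim: j => // j IH; rewrite xiS; case: (step_nonincreasing IH).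
have th0 j := theta_le0 (X j).
have [[j1 Pj1]|infeas] := pselect (exists j, Psi (xi j) <= 0).
  have next j : Psi (xi j) <= 0 -> J (xi j.+1) <= J (xi j) /\ Psi (xi j.+1) <= 0.
    by move=> Pj; rewrite xiS; have [_ feas _] := step_nonincreasing (X j); exact: feas.
  have feas j : (j1 <= j)%N -> Psi (xi j) <= 0.
    move=> /subnKC <-; elim: (j - j1)%N => [|i IH]; first by rewrite addn0.
    by rewrite addnS; case: (next _ IH).
  have [B JB] := J_bounded.
  apply: (@descent_cvg0 R _ (fun j => J (xi j)) (- B) j1) => [j _|j _|j jj|e e0].
  - exact: th0.
  - by have := JB (xi j) (Xp_admissible (X j)); rewrite ler_norml => /andP[].
  - by case: (next j (feas j jj)).
  - have [k k0 hk] := step_decrease e0; exists k => [//|j jj the].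
    rewrite xiS; have [_ hfeas _] := hk _ (X j) the.
    exact: (proj1 (hfeas (feas j jj))).
have pos j : (Psi (xi j) <= 0) = false.
  by apply/negP => Pj; apply: infeas; exists j.
apply: (@descent_cvg0 R _ (fun j => Psi (xi j)) 0 0) => [j _|j _|j _|e e0].
- exact: th0.
- by rewrite ltW// ltNge pos.
- by rewrite xiS; have [_ _ hinf] := step_nonincreasing (X j); exact: hinf.
- have [k k0 hk] := step_decrease e0; exists k => [//|j _ the].
  by rewrite xiS; have [_ _ hinf] := hk _ (X j) the; exact: hinf.
Qed.

End Algorithm.

Theorem theorem9 (R : realType) (n m q Nc : nat)
    (n_gt0 : (0 < n)%N) (m_gt0 : (0 < m)%N)
    (q_gt0 : (0 < q)%N) (Nc_gt0 : (0 < Nc)%N)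
    (P : problem R n m q Nc) (L : R) (S : alg_params R)
    (L_gt0 : 0 < L) (P_ok : problem_ok P L) (S_ok : alg_params_ok S)
    (g : control R m q -> control R m q) (g_argmin : is_argmin_map P S g)
    (xi : nat -> control R m q) (xi_A : generated_by_A P S g xi) :
  theta P S (xi i) @[i --> \oo] --> (0 : R).
Proof. exact: (theta_cvg0 Nc_gt0 L_gt0 P_ok S_ok g_argmin xi_A). Qed.
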